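(* For $0<\sigma<2$ define the following positive kernel on $\mathbb{T}^n$: $$K^{\sigma/2}(x):=\frac{1}{|\Gamma(-\sigma/2)|}\int_0^\infty W_t(x)\,\frac{dt}{t^{1+\sigma/2}},\qquad x\in\mathbb{T}^n,\ x\ne0.$$ Then $$K^{\sigma/2}(x)=\frac{2^\sigma\Gamma(\frac{n+\sigma}{2})}{|\Gamma(-\sigma/2)|\pi^{n/2}}\sum_{\nu\in\mathbb{Z}^n}\frac{1}{|x-2\pi\nu|^{n+\sigma}},\qquad x\in\mathbb{T}^n,\ x\neq0,$$ and the following hold. (1) Suppose that $0<\sigma<1$. If $f\in C^{0,\sigma+\varepsilon}(\mathbb{T}^n)$ for some $\varepsilon>0$ such that $0<\sigma+\varepsilon\le1$, then $(-\Delta)^{\sigma/2}f$ is a continuous function and, for all $x\in\mathbb{T}^n$, $$(-\Delta)^{\sigma/2}f(x)=\int_{\mathbb{T}^n}(f(x)-f(y))K^{\sigma/2}(x-y)\,dy,$$ where the integral is absolutely convergent. (2) Suppose that $1\le\sigma<2$. If $f\in C^{1,\sigma+\varepsilon-1}(\mathbb{T}^n)$ for some $\varepsilon>0$ such that $0<\sigma+\varepsilon-1\le1$, then $(-\Delta)^{\sigma/2}f$ is a continuous function and, for all $x\in\mathbb{T}^n$, $$(-\Delta)^{\sigma/2}f(x)=\int_{\mathbb{T}^n}\big(f(x)-f(y)-\nabla f(x)\cdot(x-y)\big)K^{\sigma/2}(x-y)\,dy=\operatorname{P.V.}\int_{\mathbb{T}^n}(f(x)-f(y))K^{\sigma/2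}(x-y)\,dy.$$
   Context: $\mathbb{T}^n$, $n\ge1$, is the torus $\mathbb{R}^n/2\pi\mathbb{Z}^n$, identified with $Q_n=(-\pi,\pi]^n$, and $\int_{\mathbb{T}^n}=\int_{Q_n}$; in the integrals $x-y$ is taken as its representative $z\in Q_n$ (i.e. one substitutes $y=x-z$, $z\in Q_n$), and P.V. is the limit as $\delta\to0^+$ of the integral over $\{|x-y|\ge\delta\}$. The heat kernel is $W_t(x)=\frac1{(2\pi)^n}\sum_{\nu\in\mathbb{Z}^n}e^{-t|\nu|^2}e^{i\nu\cdot x}=\frac1{(4\pi t)^{n/2}}\sum_{\nu\in\mathbb{Z}^n}e^{-|x-2\pi\nu|^2/(4t)}$, $t>0$. For $0<\alpha\le1$ and $k\in\mathbb{N}_0$, $C^{k,\alpha}(\mathbb{T}^n)$ is the space of real $f\in C^k(\mathbb{T}^n)$ whose derivatives of order $k$ are $\alpha$-Hölder continuous with respect to the geodesic distance. With $c_\nu(f)=\frac1{(2\pi)^n}\int_{\mathbb{T}^n}f(x)e^{-i\nu\cdot x}dx$, for $\phi\in C^\infty(\mathbb{T}^n)$ put $(-\Delta)^{\sigma/2}\phi(x)=\sum_{\nu\in\mathbb{Z}^n}|\nu|^\sigma c_\nu(\phi)e^{i\nu\cdot x}$, which is a continuous linear symmetric operator on $C^\infty(\mathbb{T}^n)$. For $f\in L^1(\mathbb{T}^n)$, $(-\Delta)^{\sigma/2}f$ is the periodic distribution $\phi\mapsto\int_{\mathbb{T}^n}f\,(-\Delta)^{\sigma/2}\phi\,dx$,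 $\phi\in C^\infty(\mathbb{T}^n)$; that it is a continuous function means it coincides with the distribution $\phi\mapsto\int_{\mathbb{T}^n} g\phi$ for a continuous $g$, whose values are denoted $(-\Delta)^{\sigma/2}f(x)$. *)

(* Defs.v *)
From HB Require Import structures.
From mathcomp Require Import all_boot all_order all_algebra.
From mathcomp Require Import all_classical all_reals all_analysis.
From mathcomp Require Import complex.
Set Implicit Arguments.
Unset Strict Implicit.
Unset Printing Implicit Defensive.
Import Order.TTheory GRing.Theory Num.Theory.
Import numFieldNormedType.Exports.

Local Open Scope classical_set_scope.
Local Open Scope ring_scope.

Section measure_cons.
Context d (T : measurableType d) (R : realType) (n : nat).
Context (lam : {sigma_finite_measure set T -> \bar R})
  (mu : {sigma_finite_measure set (n.-tuple T) -> \bar R}).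

Definition cons_pair (p : T * n.-tuple T) : n.+1.-tuple T :=
  [tuple of p.1 :: p.2].

Lemma measurable_cons_pair : measurable_fun setT cons_pair.
Proof. exact: measurable_cons. Qed.

Definition measure_cons : set (n.+1.-tuple T) -> \bar R :=
  pushforward (lam \x mu)%E cons_pair.

Let measure_cons0 : measure_cons set0 = 0%E.
Proof. by rewrite /measure_cons /pushforward preimage_set0 measure0. Qed.

Let measure_cons_ge0 A : (0 <= measure_cons A)%E.
Proof. exact: (@measure_ge0 _ _ _ (lam \x mu)%E). Qed.

Let measure_cons_additive : semi_sigma_additive measure_cons.
Proof.
move=> F mF tF mUF; rewrite /measure_cons /pushforward preimage_bigcup.
apply: measure_semi_sigma_additive.
- by move=> k; rewrite -[X in measurable X]setTI; exact: measurable_cons_pair.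
- apply/trivIsetP => /= i j _ _ ij; rewrite -preimage_setI.
  by move/trivIsetP : tF => /(_ _ _ _ _ ij) ->//; rewrite preimage_set0.
- rewrite -preimage_bigcup -[X in measurable X]setTI.
  exact: measurable_cons_pair.
Qed.

HB.instance Definition _ := isMeasure.Build _ _ _
  measure_cons measure_cons0 measure_cons_ge0 measure_cons_additive.

Let measure_cons_sigma_finite : sigma_finite setT measure_cons.
Proof.
have /sigma_finiteP[F [FT ndF Foo]] := sigma_finiteT lam.
have /sigma_finiteP[G [GT ndG Goo]] := sigma_finiteT mu.
pose g (t : n.+1.-tuple T) : T * n.-tuple T :=
  (tnth t ord0, [tuple of behead t]).
have gK p : g (cons_pair p) = p.
  by case: p => a u; congr (_, _); apply/val_inj.
have mg : measurable_fun setT g.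
  apply/measurable_fun_pair; first exact: measurable_tnth.
  exact: measurable_behead.
exists (fun k => g @^-1` (F k `*` G k)).
  rewrite -preimage_bigcup (_ : \bigcup_k _ = setT) ?preimage_setT//.
  apply/seteqP; split => // -[x y] _.
  have [i _ Fix] : (\bigcup_k F k) x by rewrite -FT.
  have [j _ Gjy] : (\bigcup_k G k) y by rewrite -GT.
  exists (maxn i j) => //; split => /=.
    by move: x Fix; exact/subsetPset/ndF/leq_maxl.
  by move: y Gjy; exact/subsetPset/ndG/leq_maxr.
move=> k; have [mF Fkoo] := Foo k; have [mG Gkoo] := Goo k; split.
  by rewrite -[X in measurable X]setTI; apply: mg => //; exact: measurableX.
rewrite /measure_cons /pushforward -comp_preimage.
rewrite (_ : g \o cons_pair = id) ?preimage_id//; last exact/funext.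
by rewrite product_measure1E// lte_mul_pinfty// ge0_fin_numE.
Qed.

HB.instance Definition _ := Measure_isSigmaFinite.Build _ _ _
  measure_cons measure_cons_sigma_finite.

End measure_cons.

Fixpoint lebesgue_tuple (R : realType) (n : nat) :
    {sigma_finite_measure set (n.-tuple (measurableTypeR R)) -> \bar R} :=
  if n is m.+1 then measure_cons (@lebesgue_measure R) (lebesgue_tuple R m)
  else dirac ([tuple] : 0.-tuple (measurableTypeR R)).

Section real_tools.
Context (R : realType).

(** [Gamma] is Euler's integral for [0 < x], continued to the other
    non-poles by [Gamma (x + 1) = x * Gamma x], applied the least number [m]
    of times for which [0 < x + m]. *)
Definition euler_integral (x : R) : R :=
  \int[lebesgue_measure]_(t in `]0, +oo[) (t `^ (x - 1) * expR (- t)).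

Definition Gamma (x : R) : R :=
  let m := if 0 < x then 0%N else (Num.truncn (- x)).+1 in
  euler_integral (x + m%:R) / \prod_(k < m) (x + k%:R).

(** Unconditional sum, meaningful for absolutely summable families. *)
Definition rsum (I : choiceType) (u : I -> R) : R :=
  fine (\esum_(i in [set: I]) (EFin \o u)^\+ i -
        \esum_(i in [set: I]) (EFin \o u)^\- i)%E.

Definition csum (I : choiceType) (u : I -> R[i]) : R[i] :=
  Complex (rsum (fun i => complex.Re (u i))) (rsum (fun i => complex.Im (u i))).

Definition expi (theta : R) : R[i] := Complex (cos theta) (sin theta).

End real_tools.

Section torus.
Context (R : realType) (n : nat).
Implicit Types (x y z : 'rV[R]_n) (nu : 'rV[int]_n) (f g : 'rV[R]_n -> R).

Definition dot x y : R := \sum_i x 0 i * y 0 i.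

(** The norm that the library puts on ['rV[R]_n] is the sup norm. *)
Definition enorm x : R := Num.sqrt (dot x x).

Definition ivec nu : 'rV[R]_n := map_mx intr nu.

(** Functions on the torus are represented by periodic functions on R^n. *)
Definition periodic (T : Type) (f : 'rV[R]_n -> T) : Prop :=
  forall x nu, f (x + (2 * pi) *: ivec nu) = f x.

Definition Q : set 'rV[R]_n := [set x | forall i, - pi < x 0 i <= pi].

Definition row_of (t : n.-tuple (measurableTypeR R)) : 'rV[R]_n :=
  \row_i tnth t i.

Definition Rn_int (D : set 'rV[R]_n) f : R :=
  \int[lebesgue_tuple R n]_(t in row_of @^-1` D) f (row_of t).

Definition Rn_integrable (D : set 'rV[R]_n) f : Prop :=
  (lebesgue_tuple R n).-integrable (row_of @^-1` D) (EFin \o f \o row_of).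

Definition Rn_cint (D : set 'rV[R]_n) (phi : 'rV[R]_n -> R[i]) : R[i] :=
  Complex (Rn_int D (fun x => complex.Re (phi x)))
          (Rn_int D (fun x => complex.Im (phi x))).

(** The Fourier series is real, since its terms at [nu] and [- nu] are
    conjugate. *)
Definition heat_kernel (t : R) x : R :=
  complex.Re ((((2 * pi) ^+ n)^-1)%:C%C *
    csum (fun nu => (expR (- (t * enorm (ivec nu) ^+ 2)))%:C%C
                    * expi (dot (ivec nu) x))).

(** As in [(-Delta)^(sigma/2)] and [K^(sigma/2)], the parameter [sigma] of the
    definitions below is the order of the operator. *)
Definition frac_integrand (sigma : R) x (t : R) : R :=
  heat_kernel t x / t `^ (1 + sigma / 2).

Definition frac_kernel (sigma : R) x : R :=
  `|Gamma (- (sigma / 2))|^-1 *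
  \int[lebesgue_measure]_(t in `]0, +oo[) frac_integrand sigma x t.

Definition basis (i : 'I_n) : 'rV[R]_n := delta_mx 0 i.

Fixpoint partials (s : seq 'I_n) f : 'rV[R]_n -> R :=
  if s is i :: s' then fun x => 'D_(basis i) (partials s' f) x else f.

Definition grad f x : 'rV[R]_n := \row_i 'D_(basis i) f x.

Definition Ck (k : nat) f : Prop :=
  (forall s : seq 'I_n, (size s < k)%N ->
     forall i x, derivable (partials s f) x (basis i)) /\
  (forall s : seq 'I_n, (size s <= k)%N -> continuous (partials s f)).

Definition geodesic x y : R :=
  inf [set enorm (x - y - (2 * pi) *: ivec nu) | nu in [set: 'rV[int]_n]].

Definition holder (alpha : R) f : Prop :=
  exists C : R, forall x y, `|f x - f y| <= C * geodesic x y `^ alpha.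

Definition Ckalpha_torus (k : nat) (alpha : R) f : Prop :=
  [/\ periodic f, Ck k f &
      forall s : seq 'I_n, size s = k -> holder alpha (partials s f)].

Definition Cinfty_torus (phi : 'rV[R]_n -> R[i]) : Prop :=
  periodic phi /\
  forall k, Ck k (fun x => complex.Re (phi x)) /\
            Ck k (fun x => complex.Im (phi x)).

Definition fourier_coef (phi : 'rV[R]_n -> R[i]) nu : R[i] :=
  (((2 * pi) ^+ n)^-1)%:C%C *
  Rn_cint Q (fun x => phi x * expi (- dot (ivec nu) x)).

Definition frac_lap_smooth (sigma : R) (phi : 'rV[R]_n -> R[i]) x : R[i] :=
  csum (fun nu => (enorm (ivec nu) `^ sigma)%:C%C * fourier_coef phi nu
                  * expi (dot (ivec nu) x)).

Definition distribution_of f (phi : 'rV[R]_n -> R[i]) : R[i] :=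
  Rn_cint Q (fun x => (f x)%:C%C * phi x).

Definition frac_lap_distribution (sigma : R) f (phi : 'rV[R]_n -> R[i]) : R[i] :=
  Rn_cint Q (fun x => (f x)%:C%C * frac_lap_smooth sigma phi x).

Definition frac_lap_is_continuous_fun (sigma : R) f g : Prop :=
  [/\ periodic g, continuous g &
      forall phi, Cinfty_torus phi ->
        frac_lap_distribution sigma f phi = distribution_of g phi].

End torus.

Arguments Q {R n}.

(* Main.v *)
(** Both forms of the heat kernel agree by Poisson summation, which in dimension one amounts to the
    two series having the same Fourier coefficients (a Gaussian integral); the higher-dimensional
    kernels are products. The lattice formula for [K] then is a Gamma integral, term by term.

    Tonelli's theorem in the time variable turns the heat kernel identity
    [int (1 - cos (nu . z)) W_t(z) dz = 1 - exp (- t |nu|^2)] into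
    [int (1 - cos (nu . z)) K(z) dz = |nu|^sigma], and the moment bound
    [int |z|^a W_t(z) dz <= M min(t^(a/2), 1)] into [int |z|^a K(z) dz < oo] for [a > sigma].
    If the second differences [2 f(x) - f(x - z) - f(x + z)] are [O(|z|^a)] with [a > sigma], then
    half of their integral against [K] is therefore a continuous function [g], and by Fubini its
    Fourier components are those of [f] multiplied by [|nu|^sigma]. Since the Fourier series of a
    smooth [phi] converges rapidly to [phi], and taking a Fourier component is a symmetric operation,
    [int f (-Delta)^(sigma/2) phi = int g phi]. Finally, [K] is even, so [g] can be rewritten with
    the first-order differences of the statement.

    Fourier components are handled through the real integrals
    [osc nu u theta = int u(y) cos (theta - nu . y) dy]. *)

Require Import Defs.
From HB Require Import structures.
From mathcomp Require Import all_boot all_order all_algebra.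
From mathcomp Require Import all_classical all_reals all_analysis.
From mathcomp Require Import measurable_realfun.
From mathcomp Require Import complex ring lra.
Set Implicit Arguments.
Unset Strict Implicit.
Unset Printing Implicit Defensive.
Import Order.TTheory GRing.Theory Num.Theory.
Import numFieldNormedType.Exports.
Local Open Scope classical_set_scope.
Local Open Scope ring_scope.

(** * Unordered sums *)

(** Apart from the lattice formula, everything about the kernel is computed for [heat_kernel] at
    fixed time and then integrated in time, so the singularity at the origin is never estimated
    directly. Moments of order at most 2 suffice, and [1 - cos], whose heat integral is known
    exactly, controls them.

    Symmetrizing in [z] lets both ranges of [sigma] share one argument: the gradient term is odd, so
    second differences have order [a = sigma + eps] in either case, and the gradient returns only
    when they are split again at the end.

    Inversion for smooth functions regularizes with the heat kernel. Uniqueness of Fourier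
    coefficients on the circle, needed for Poisson summation, cannot do so without circularity,
    since positivity of the heat kernel is drawn from Poisson summation; powers of [(1 + cos) / 2]
    concentrate instead.

    Real-valued sums and integrals take default values when they diverge. Hence summability and
    integrability accompany each computation, and signed statements are often reduced to nonnegative
    ones, where Tonelli holds unconditionally. *)

Section sums.
Context {R : realType} {I : countType}.
Implicit Types (u v M : I -> R).

Definition rsummable u : Prop := (\esum_(i in [set: I]) `|u i|%:E < +oo)%E.

Lemma le_rsummable u v : (forall i, `|u i| <= v i) -> rsummable v -> rsummable u.
Proof.
move=> uv; apply: le_lt_trans; apply: le_esum => i _ /=.
by rewrite lee_fin; apply: le_trans (uv i) (ler_norm _).
Qed.

Lemma rsummable_norm u : rsummable u -> rsummable (fun i => `|u i|).
Proof. by rewrite /rsummable; under [in X in _ -> X]eq_esum do rewrite normr_id. Qed.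

Lemma rsummableD u v : rsummable u -> rsummable v -> rsummable (fun i => u i + v i).
Proof.
move=> su sv; apply: (@le_lt_trans _ _
  (\esum_(i in [set: I]) (`|u i|%:E + `|v i|%:E))%E).
  by apply: le_esum => i _; rewrite -EFinD lee_fin ler_normD.
by rewrite esumD ?lte_add_pinfty.
Qed.

(** A natural number above [|c|] reduces scaling to repeated addition. *)
Lemma rsummableZ c u : rsummable u -> rsummable (fun i => c * u i).
Proof.
move=> su; rewrite /rsummable.
have [N cN] : exists N : nat, `|c| <= N%:R.
  by exists (Num.Def.archi_bound `|c|); apply/ltW/archi_boundP.
have H : forall k, rsummable (fun i => k%:R * u i).
  elim=> [|k IH].
    by rewrite /rsummable esum1// => i _; rewrite mul0r normr0.
  by under eq_fun do rewrite -addn1 natrD mulrDl mul1r; exact: rsummableD.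
apply: le_rsummable (rsummable_norm (H N)) => i.
by rewrite !normrM normr_nat ler_wpM2r.
Qed.

Lemma rsummableN u : rsummable u -> rsummable (fun i => - u i).
Proof. by rewrite /rsummable; under [in X in _ -> X]eq_esum do rewrite normrN. Qed.

Lemma rsummableB u v : rsummable u -> rsummable v -> rsummable (fun i => u i - v i).
Proof. by move=> su sv; apply: rsummableD => //; exact: rsummableN. Qed.

Lemma rsum_ge0E u : (forall i, 0 <= u i) ->
  rsum u = fine (\esum_(i in [set: I]) (u i)%:E)%E.
Proof.
move=> u0; rewrite /rsum [X in (_ - X)%E]esum1 ?sube0; last first.
  move=> i _; have u0' x : [set: I] x -> (0 <= (EFin \o u) x)%E by rewrite lee_fin.
  by rewrite (ge0_funenegE u0') ?inE.
by congr fine; apply: eq_esum => i _; rewrite funeposE/= (elimT max_idPl)// lee_fin.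
Qed.

Lemma rsum_ge0EFin u : (forall i, 0 <= u i) -> rsummable u ->
  (rsum u)%:E = (\esum_(i in [set: I]) (u i)%:E)%E.
Proof.
move=> u0 su; rewrite rsum_ge0E// fineK// ge0_fin_numE ?esum_ge0//; last first.
  by move=> i _; rewrite lee_fin.
by move: su; rewrite /rsummable; under eq_esum do rewrite ger0_norm//.
Qed.

Lemma rsumB_ge0 u v : (forall i, 0 <= u i) -> (forall i, 0 <= v i) ->
  rsummable u -> rsummable v -> rsum (fun i => u i - v i) = rsum u - rsum v.
Proof.
move=> u0 v0 su sv; rewrite {1}/rsum.
have -> : EFin \o (fun i => u i - v i) = ((EFin \o u) \- (EFin \o v))%E.
  by apply/funext => i /=; rewrite EFinB.
rewrite esumB//; [|by move=> i _; rewrite lee_fin..].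
by rewrite -!rsum_ge0EFin.
Qed.

(** Shifting by a summable majorant makes all terms nonnegative. This is how linearity is
    transferred from [esum] to [rsum]. *)
Lemma rsumE M u : (forall i, `|u i| <= M i) -> rsummable M ->
  rsum u = rsum (fun i => u i + M i) - rsum M.
Proof.
move=> uM sM; rewrite -rsumB_ge0//.
- by congr rsum; apply/funext => i; rewrite addrK.
- by move=> i; rewrite -lerBlDr sub0r; move: (uM i); rewrite ler_norml => /andP[].
- by move=> i; rewrite (le_trans (normr_ge0 _) (uM i)).
- by apply: rsummableD => //; exact: le_rsummable sM.
Qed.

Lemma rsumD_ge0 u v : (forall i, 0 <= u i) -> (forall i, 0 <= v i) ->
  rsummable u -> rsummable v -> rsum (fun i => u i + v i) = rsum u + rsum v.
Proof.
move=> u0 v0 su sv; apply: EFin_inj; rewrite EFinD !rsum_ge0EFin//.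
- by rewrite -esumD// => i _; rewrite lee_fin.
- by move=> i; rewrite addr_ge0.
- exact: rsummableD.
Qed.

Let add_norm_ge0 u i : 0 <= u i + `|u i|.
Proof. by rewrite -lerBlDr sub0r lerNl ler_normr lexx orbT. Qed.

Let rsumnE u : rsummable u -> rsum u = rsum (fun i => u i + `|u i|) - rsum (fun i => `|u i|).
Proof. by move=> su; apply: rsumE => //; exact: rsummable_norm. Qed.

Lemma rsumD u v : rsummable u -> rsummable v ->
  rsum (fun i => u i + v i) = rsum u + rsum v.
Proof.
move=> su sv; have nsu := rsummable_norm su; have nsv := rsummable_norm sv.
rewrite (@rsumE (fun i => `|u i| + `|v i|)); last 2 first.
- by move=> i; exact: ler_normD.
- exact: rsummableD.
under [in X in rsum X - _]eq_fun do rewrite addrACA.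
rewrite (@rsumD_ge0 (fun i => u i + `|u i|) (fun i => v i + `|v i|))//; last 2 first.
- exact: rsummableD.
- exact: rsummableD.
by rewrite (@rsumD_ge0 (fun i => `|u i|))// (rsumnE su) (rsumnE sv); lra.
Qed.

Lemma rsumN u : rsummable u -> rsum (fun i => - u i) = - rsum u.
Proof.
move=> su; apply/eqP; rewrite -addr_eq0 -rsumD//; last exact: rsummableN.
under eq_fun do rewrite addNr.
by rewrite rsum_ge0E// esum1.
Qed.

Lemma rsumB u v : rsummable u -> rsummable v ->
  rsum (fun i => u i - v i) = rsum u - rsum v.
Proof. by move=> su sv; rewrite rsumD ?rsumN//; exact: rsummableN. Qed.

Lemma rsum_ge0 u : (forall i, 0 <= u i) -> 0 <= rsum u.
Proof.
by move=> u0; rewrite rsum_ge0E// fine_ge0// esum_ge0// => i _; rewrite lee_fin.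
Qed.

Lemma le_rsum u v : (forall i, u i <= v i) -> rsummable u -> rsummable v ->
  rsum u <= rsum v.
Proof.
move=> uv su sv; rewrite -subr_ge0 -rsumB//.
by apply: rsum_ge0 => i; rewrite subr_ge0.
Qed.

Lemma ler_norm_rsum u v : (forall i, `|u i| <= v i) -> rsummable v ->
  `|rsum u| <= rsum v.
Proof.
move=> uv sv; have su := le_rsummable uv sv.
rewrite ler_norml -rsumN//; apply/andP; split; apply: le_rsum => //.
- by move=> i; move: (uv i); rewrite ler_norml => /andP[].
- exact: rsummableN.
- by move=> i; rewrite (le_trans (ler_norm _)).
Qed.

Lemma esumZl_EFin c u : 0 <= c -> (forall i, 0 <= u i) ->
  (\esum_(i in [set: I]) (c * u i)%:E = c%:E * \esum_(i in [set: I]) (u i)%:E)%E.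
Proof.
move=> c0 u0.
(* One inequality suffices: the converse is the same inequality for the factor [c^-1] and the family
   [c * u]. *)
have leZ : forall (k : R) (w : I -> R), 0 <= k -> (forall i, 0 <= w i) ->
  (\esum_(i in [set: I]) (k * w i)%:E <= k%:E * \esum_(i in [set: I]) (w i)%:E)%E.
  move=> k w k0 w0; apply: ge_ereal_sup => _ /= [X [fX _] <-].
  rewrite fsbig_finite//=; under eq_bigr do rewrite EFinM.
  rewrite -ge0_sume_distrr; last by move=> i _; rewrite lee_fin.
  rewrite lee_wpmul2l ?lee_fin//; apply: esum_ge; exists X => //.
  by rewrite fsbig_finite.
have [->|cn0] := eqVneq c 0; first by rewrite mul0e esum1// => i _; rewrite mul0r.
apply/eqP; rewrite eq_le leZ//=.
have cp : 0 < c by rewrite lt_neqAle eq_sym cn0.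
rewrite muleC -lee_pdivlMr// muleC.
apply: le_trans (leZ c^-1 (fun i => c * u i) _ _); last 2 first.
- by rewrite invr_ge0.
- by move=> i; rewrite mulr_ge0.
by apply: le_esum => i _; rewrite mulKf.
Qed.

Lemma rsumZ c u : rsummable u -> rsum (fun i => c * u i) = c * rsum u.
Proof.
have H (k : R) (w : I -> R) : 0 <= k -> (forall i, 0 <= w i) -> rsum (fun i => k * w i) = k * rsum w.
  move=> k0 w0; rewrite !rsum_ge0E//; last by move=> i; rewrite mulr_ge0.
  rewrite esumZl_EFin//.
  (* If the sum is infinite, both sides are [0] because [fine] sends infinity to [0]; hence no
     summability of [w] is assumed in [H]. *)
  case: (\esum_(i in [set: I]) (w i)%:E)%E (esum_ge0 (fun i (_ : [set: I] i) => (w0 i : (0 <= (w i)%:E)%E))) => //=.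
  move=> _; have [->|kn0] := eqVneq k 0; first by rewrite mul0e mul0r.
  by rewrite gt0_muley ?lte_fin ?lt_neqAle 1?eq_sym ?kn0//= mulr0.
have HP (k : R) (w : I -> R) : 0 <= k -> rsummable w -> rsum (fun i => k * w i) = k * rsum w.
  move=> k0 sw; rewrite (rsumnE sw) mulrBr -!H// -rsumB.
  - by congr rsum; apply/funext => i; rewrite -mulrBr addrK.
  - by apply: rsummableZ; apply: rsummableD => //; exact: rsummable_norm.
  - by apply: rsummableZ; exact: rsummable_norm.
move=> su; have [c0|c0] := leP 0 c; first exact: HP.
have -> : (fun i => c * u i) = (fun i => - ((- c) * u i)).
  by apply/funext => i; rewrite mulNr opprK.
rewrite rsumN; last exact: rsummableZ.
by rewrite HP// ?mulNr ?opprK// oppr_ge0 ltW.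
Qed.

Lemma rsummable_pick (j : I) (c : R) : rsummable (fun i => if i == j then c else 0).
Proof.
rewrite /rsummable (esumID [set j])//.
rewrite setTI esum_set1// eqxx esum1 ?adde0 ?ltry//.
by move=> i /= [_ /eqP /negbTE ->]; rewrite normr0.
Qed.

Lemma rsum_pick (j : I) (c : R) : rsum (fun i => if i == j then c else 0) = c.
Proof.
have H (d : R) : 0 <= d -> rsum (fun i => if i == j then d else 0) = d.
  move=> d0; have du i : 0 <= (if i == j then d else 0) by case: ifP.
  rewrite rsum_ge0E// (esumID [set j])//; last by move=> *; rewrite lee_fin.
  rewrite setTI esum_set1 ?eqxx ?lee_fin// esum1 ?adde0//.
  by move=> i /= [_ /eqP /negbTE ->].
have [/H//|/ltW c0] := leP 0 c.
have := rsumN (rsummable_pick j (- c)); rewrite (H (- c)) ?oppr_ge0//.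
rewrite opprK => {2}<-.
by congr rsum; apply/funext => i; case: ifP; rewrite ?opprK ?oppr0.
Qed.

End sums.

Section sums_reindex.
Context {R : realType} {I J : countType}.

Lemma rsum_reindex (e : I -> J) (u : J -> R) : bijective e ->
  rsum u = rsum (u \o e).
Proof.
move=> be; have se : set_bij [set: I] [set: J] e.
  by split => //; [move=> x y _ _; exact: (bij_inj be)|
    move=> y _; case: be => f _ fK; exists (f y)].
rewrite /rsum (reindex_esum _ _ _ _ se) [X in (_ - X)%E](reindex_esum _ _ _ _ se).
by congr (fine (_ - _)%E); apply: eq_esum => i _; rewrite ?funeposE ?funenegE.
Qed.

Lemma rsummable_reindex (e : I -> J) (u : J -> R) : bijective e ->
  rsummable u <-> rsummable (u \o e).
Proof.
move=> be; have se : set_bij [set: I] [set: J] e.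
  by split => //; [move=> x y _ _; exact: (bij_inj be)|
    move=> y _; case: be => f _ fK; exists (f y)].
by rewrite /rsummable (reindex_esum _ _ _ _ se).
Qed.

Lemma rsummableM (u : I -> R) (v : J -> R) : rsummable u -> rsummable v ->
  rsummable (fun p : I * J => u p.1 * v p.2).
Proof.
move=> su sv; rewrite /rsummable.
have -> : [set: I * J] = [set: I] `*`` (fun=> [set: J]) by apply/seteqP; split.
rewrite -(esum_esum (a := fun i j => `|u i * v j|%:E)).
  under eq_esum do under eq_esum do rewrite normrM.
  under eq_esum.
    move=> i _; rewrite esumZl_EFin//.
    rewrite -rsum_ge0EFin//; last exact: rsummable_norm.
    rewrite -EFinM mulrC.
    over.
  rewrite esumZl_EFin//; last exact: rsum_ge0.
  rewrite -rsum_ge0EFin//; last exact: rsummable_norm.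
  by rewrite -EFinM ltry.
by move=> i j _ _; rewrite lee_fin.
Qed.

(** For nonnegative families this is iterated summation. Adding its absolute value to one factor at
    a time, by [rsumE], then removes the two sign conditions in turn. *)
Lemma rsumM (u : I -> R) (v : J -> R) : rsummable u -> rsummable v ->
  rsum (fun p : I * J => u p.1 * v p.2) = rsum u * rsum v.
Proof.
have H (f : I -> R) (g : J -> R) : (forall i, 0 <= f i) -> (forall i, 0 <= g i) ->
    rsummable f -> rsummable g ->
    rsum (fun p : I * J => f p.1 * g p.2) = rsum f * rsum g.
  move=> f0 g0 sf sg; rewrite [LHS]rsum_ge0E; last by move=> p; exact: mulr_ge0.
  have -> : [set: I * J] = [set: I] `*`` (fun=> [set: J]) by apply/seteqP; split.
  rewrite -(esum_esum (a := fun i j => (f i * g j)%:E)); last first.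
    by move=> i j _ _; rewrite lee_fin mulr_ge0.
  under eq_esum do rewrite esumZl_EFin// -rsum_ge0EFin// -EFinM mulrC.
  rewrite esumZl_EFin ?rsum_ge0// -rsum_ge0EFin//.
  by rewrite -EFinM/= mulrC.
have HR (f : I -> R) (g : J -> R) : (forall i, 0 <= f i) ->
    rsummable f -> rsummable g ->
    rsum (fun p : I * J => f p.1 * g p.2) = rsum f * rsum g.
  move=> f0 sf sg; have ng := rsummable_norm sg.
  have gg i : 0 <= g i + `|g i|.
    by rewrite -lerBlDr sub0r lerNl ler_normr lexx orbT.
  rewrite (@rsumE _ _ (fun i => `|g i|) g)// mulrBr -!H//; last exact: rsummableD.
  rewrite -rsumB; last 2 first.
  - exact: (rsummableM sf (rsummableD sg ng)).
  - exact: (rsummableM sf ng).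
  by congr rsum; apply/funext => p; rewrite /= -mulrBr addrK.
move=> su sv; have nu := rsummable_norm su.
have uu i : 0 <= u i + `|u i|.
  by rewrite -lerBlDr sub0r lerNl ler_normr lexx orbT.
rewrite (@rsumE _ _ (fun i => `|u i|) u)// mulrBl -!HR//; last exact: rsummableD.
rewrite -rsumB; last 2 first.
- exact: (rsummableM (rsummableD su nu) sv).
- exact: (rsummableM nu sv).
by congr rsum; apply/funext => p; rewrite /= -mulrBl addrK.
Qed.

End sums_reindex.

Lemma bounded_integrable {R : realType} d (T : measurableType d)
    (mu : {measure set T -> \bar R}) (D : set T) (g : T -> R) (c : R) :
  measurable D -> (mu D < +oo)%E -> measurable_fun D g ->
  (forall x, D x -> `|g x| <= c) -> mu.-integrable D (EFin \o g).
Proof.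
move=> mD Doo mg gc; apply: measurable_bounded_integrable => //.
exists c; split; first by rewrite num_real.
by move=> y cy x /= Dx; rewrite (le_trans (gc x Dx))// ltW.
Qed.

Section integrableR.
Context {R : realType} d {T : measurableType d} (mu : {measure set T -> \bar R}).
Context (D : set T) (mD : measurable D).
Implicit Types f g : T -> R.

Lemma integrableRD f g : mu.-integrable D (EFin \o f) -> mu.-integrable D (EFin \o g) ->
  mu.-integrable D (EFin \o (fun x => f x + g x)).
Proof.
move=> fi gi; have := integrableD mD fi gi.
by apply: eq_integrable => // x _ /=; rewrite EFinD.
Qed.

Lemma integrableRB f g : mu.-integrable D (EFin \o f) -> mu.-integrable D (EFin \o g) ->
  mu.-integrable D (EFin \o (fun x => f x - g x)).
Proof.
move=> fi gi; have := integrableB mD fi gi.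
by apply: eq_integrable => // x _ /=; rewrite EFinB.
Qed.

Lemma integrableRZ c f : mu.-integrable D (EFin \o f) ->
  mu.-integrable D (EFin \o (fun x => c * f x)).
Proof.
move=> fi; have := integrableZl mD c fi.
by apply: eq_integrable => // x _ /=; rewrite EFinM.
Qed.

Lemma le_integrableR f g : measurable_fun D f -> mu.-integrable D (EFin \o g) ->
  (forall x, D x -> `|f x| <= g x) -> mu.-integrable D (EFin \o f).
Proof.
move=> mf gi fg; apply: le_integrable gi => //; first exact/measurable_EFinP.
by move=> x Dx /=; rewrite lee_fin (le_trans (fg x Dx))// ler_norm.
Qed.

End integrableR.

Section sums_integral.
Context {R : realType} {I : countType}.

(** Enumerating [I] by [pickle] turns an unordered sum into a series over [nat], to which
    measurability of countable sums and monotone convergence apply. *)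
Lemma esum_nneseries (f : I -> \bar R) : (forall i, 0 <= f i)%E ->
  (\esum_(i in [set: I]) f i = \sum_(k <oo) oapp f 0 (pickle_inv k))%E.
Proof.
move=> f0; rewrite nneseries_esumT; last by move=> k; case: pickle_inv.
pose S := [set pickle i | i in [set: I]].
have se : set_bij [set: I] S pickle.
  split => [i _|i j _ _|k [i _ <-]]; [by exists i| |by exists i].
  exact: (pcan_inj pickleK_inv).
rewrite [RHS](esumID S); last by move=> k _; case: pickle_inv.
rewrite setTI [X in (_ + X)%E]esum1 ?adde0.
  rewrite (reindex_esum _ _ _ _ se).
  by apply: eq_esum => i _; rewrite pickleK_inv.
move=> k [_ /= Sk]; case E : (pickle_inv k) => [i|]//=.
by exfalso; apply: Sk; exists i => //; have := @pickle_invK I k; rewrite E.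
Qed.

Context d {T : measurableType d} (mu : {measure set T -> \bar R}).

Lemma measurable_fun_esum (D : set T) (f : I -> T -> \bar R) :
  (forall i, measurable_fun D (f i)) -> (forall i x, 0 <= f i x)%E ->
  measurable_fun D (fun x => \esum_(i in [set: I]) f i x)%E.
Proof.
move=> mf f0.
have -> : (fun x => \esum_(i in [set: I]) f i x)%E =
  (fun x => \sum_(k <oo) oapp (f^~ x) 0 (pickle_inv k))%E.
  by apply/funext => x; rewrite esum_nneseries.
apply: (ge0_emeasurable_sum (h := fun k x => oapp (f^~ x) 0%E (pickle_inv k))).
  by move=> k x _ _; case: pickle_inv => /=.
by move=> k _; case: pickle_inv => /=.
Qed.

Lemma ge0_integral_esum (D : set T) (f : I -> T -> \bar R) : measurable D ->
  (forall i, measurable_fun D (f i)) -> (forall i x, 0 <= f i x)%E ->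
  (\int[mu]_(x in D) (\esum_(i in [set: I]) f i x) =
   \esum_(i in [set: I]) (\int[mu]_(x in D) f i x))%E.
Proof.
move=> mD mf f0; under eq_integral do rewrite esum_nneseries//.
rewrite esum_nneseries; last by move=> i; exact: integral_ge0.
rewrite integral_nneseries//.
- by apply: eq_eseriesr => k _; case: pickle_inv => //=; rewrite integral0.
- by move=> k; case: pickle_inv.
- by move=> k x _; case: pickle_inv => /=.
Qed.

Lemma measurable_fun_rsum (D : set T) (f : I -> T -> R) : measurable D ->
  (forall i, measurable_fun D (f i)) ->
  measurable_fun D (fun x => rsum (f^~ x)).
Proof.
move=> mD mf; rewrite /rsum.
apply: (measurableT_comp (f := fine)); first exact: fine_measurable.
apply: emeasurable_funB; apply: measurable_fun_esum => i //.
- have : measurable_fun D (EFin \o f i) by exact/measurable_EFinP.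
  by move/measurable_funepos; apply: eq_measurable_fun => x _; rewrite !funeposE.
- have : measurable_fun D (EFin \o f i) by exact/measurable_EFinP.
  by move/measurable_funeneg; apply: eq_measurable_fun => x _; rewrite !funenegE.
Qed.

(** On a set of finite measure the constants [M i] are integrable, and adding them makes every term
    nonnegative. The exchange is then Tonelli for series. *)
Lemma Rintegral_rsum (D : set T) (f : I -> T -> R) (M : I -> R) : measurable D ->
  (mu D < +oo)%E ->
  (forall i, measurable_fun D (f i)) -> (forall i x, `|f i x| <= M i) ->
  rsummable M ->
  \int[mu]_(x in D) (rsum (f^~ x)) = rsum (fun i => \int[mu]_(x in D) f i x).
Proof.
move=> mD Doo mf fM sM.
have intb (g : T -> R) (c : R) : measurable_fun D g -> (forall x, `|g x| <= c) ->
    mu.-integrable D (EFin \o g).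
  by move=> mg gc; apply: (bounded_integrable mD Doo mg (c := c)).
have M0 i : 0 <= M i by apply: le_trans (normr_ge0 _) (fM i point).
have fM0 i x : 0 <= f i x + M i.
  by rewrite -lerBlDr sub0r; move: (fM i x); rewrite ler_norml => /andP[].
have sfx x : rsummable (f^~ x) by exact: le_rsummable sM.
have sfMx x : rsummable (fun i => f i x + M i) by exact: rsummableD.
have intc (c : R) : \int[mu]_(x in D) c = c * fine (mu D).
  by rewrite Rintegral_cst.
under eq_Rintegral => x _ do rewrite (rsumE (fM^~ x) sM).
have bdd x : `|rsum (fun i => f i x + M i)| <= rsum M + rsum M.
  rewrite -rsumD//; apply: ler_norm_rsum; last exact: rsummableD.
  by move=> i; rewrite (le_trans (ler_normD _ _))// lerD// ger0_norm.
have mfM i : measurable_fun D (fun x => f i x + M i) by exact: measurable_funD.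
rewrite RintegralB//; last 2 first.
- by apply: (intb _ (rsum M + rsum M)) => //; exact: measurable_fun_rsum.
- by apply: (intb _ `|rsum M|).
have iM i : `|\int[mu]_(x in D) f i x| <= M i * fine (mu D).
  rewrite -intc; apply: le_trans (le_normr_Rintegral _ _) _ => //.
    by apply: intb (fM i).
  apply: le_Rintegral => //.
  - by apply: (intb _ (M i)) => [|x]; rewrite ?normr_id//; exact: measurableT_comp.
  - by apply: (intb _ (M i)) => // x; rewrite ger0_norm.
have sMD : rsummable (fun i => M i * fine (mu D)).
  by under eq_fun do rewrite mulrC; exact: rsummableZ.
rewrite (rsumE iM sMD); congr (_ - _); last first.
  by rewrite intc mulrC -rsumZ//; under eq_fun do rewrite mulrC.
rewrite /Rintegral.
under eq_integral do rewrite rsum_ge0EFin//.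
rewrite ge0_integral_esum//; last by move=> i; exact/measurable_EFinP.
rewrite rsum_ge0E//; last first.
  move=> i; rewrite -lerBlDr sub0r; move: (iM i); rewrite ler_norml => /andP[]//.
congr fine; apply: eq_esum => i _.
rewrite -intc -RintegralD//; last 2 first.
- by apply: intb (fM i).
- by apply: (intb _ (M i)) => // x; rewrite ger0_norm.
rewrite /Rintegral fineK//; apply: integrable_fin_num => //.
apply: (intb _ (M i + M i)) => // x.
by rewrite (le_trans (ler_normD _ _))// lerD// ger0_norm.
Qed.

End sums_integral.

Section tannery.
Context {R : realType} {I : countType}.
Implicit Types (u v M : I -> R).

Lemma rsum_seq (s : seq I) v : uniq s ->
  rsummable (fun i => if i \in s then v i else 0) /\
  rsum (fun i => if i \in s then v i else 0) = \sum_(i <- s) v i.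
Proof.
elim: s => [_|j s IH /=/andP[js /IH[sv Ev]]].
  have -> : (fun i : I => if i \in [::] then v i else 0) = (fun=> 0) by [].
  rewrite big_nil rsum_ge0E// /rsummable; split; last by rewrite esum1.
  by rewrite esum1// => i _; rewrite normr0.
have E : (fun i => if i \in j :: s then v i else 0) =
    (fun i => (if i == j then v j else 0) + (if i \in s then v i else 0)).
  apply/funext => i; rewrite inE; case: eqP => [->|_] /=; last by rewrite add0r.
  by rewrite (negbTE js) addr0.
have sj := rsummable_pick j (v j).
rewrite E big_cons; split; first exact: rsummableD.
by rewrite rsumD// rsum_pick Ev.
Qed.

Lemma rsum_tail M e : (forall i, 0 <= M i) -> rsummable M -> 0 < e ->
  exists2 s : seq I, uniq s & rsum M - \sum_(i <- s) M i < e.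
Proof.
move=> M0 sM e0.
have E := rsum_ge0EFin M0 sM.
have fn : (\esum_(i in [set: I]) (M i)%:E)%E \is a fin_num by rewrite -E.
have [_ [X [fX _] <-]] := ub_ereal_sup_adherent e0 fn.
rewrite -/(esum _ _) -E fsbig_finite//= -EFinD sumEFin lte_fin => H.
by exists (finmap.enum_fset (fset_set X)); [exact: finmap.fset_uniq|lra].
Qed.

(** Tannery's theorem. A finite set of indices carries almost all of the majorant; the limit is
    taken term by term there, and elsewhere each difference is at most [2 * M i]. *)
Lemma cvg_rsum (T : Type) (F : set_system T) (u : T -> I -> R) v M : Filter F ->
  rsummable M -> (forall i, u ^~ i @ F --> v i) ->
  (\forall x \near F, forall i, `|u x i| <= M i) -> (forall i, `|v i| <= M i) ->
  (fun x => rsum (u x)) @ F --> rsum v.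
Proof.
move=> FF sM uv uM vM.
have M0 i : 0 <= M i by exact: le_trans (vM i).
apply/cvgrPdist_lt => e e0.
(* The tail of [M] is counted twice below, for [u x] and for [v], which uses up [e / 2]. *)
have e4 : 0 < e / 4 by rewrite divr_gt0.
have [s us Hs] := rsum_tail M0 sM e4.
have sumcvg : (fun x => \sum_(i <- s) `|v i - u x i|) @ F --> (0 : R).
  elim: (s) => [|i r IH].
    by under eq_fun do rewrite big_nil; exact: cvg_cst.
  rewrite -[X in _ --> X](addr0 (0 : R)); under eq_fun do rewrite big_cons.
  apply: cvgD => //.
  rewrite -(normr0 R) -(subrr (v i)); apply: cvg_norm; apply: cvgB => //; exact: cvg_cst.
have e2 : 0 < e / 2 by rewrite divr_gt0.
near=> x.
have ux : forall i, `|u x i| <= M i by near: x.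
have sx : \sum_(i <- s) `|v i - u x i| < e / 2.
  have : `|0 - \sum_(i <- s) `|v i - u x i| | < e / 2.
    by near: x; move/cvgrPdist_lt : sumcvg; apply.
  by rewrite sub0r normrN ger0_norm// sumr_ge0.
have su := le_rsummable ux sM; have sv := le_rsummable vM sM.
rewrite -rsumB//.
have [sd Ed] := rsum_seq (fun i => `|v i - u x i|) us.
have [sMs EMs] := rsum_seq M us.
have sMt : rsummable (fun i => 2 * (M i - (if i \in s then M i else 0))).
  by apply: rsummableZ; exact: rsummableB.
apply: le_lt_trans (ler_norm_rsum (v := fun i =>
   (if i \in s then `|v i - u x i| else 0) +
   2 * (M i - (if i \in s then M i else 0))) _ _) _.
- move=> i; case: ifPn => _; first by rewrite subrr mulr0 addr0.
  rewrite add0r subr0; apply: le_trans (ler_normB _ _) _.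
  by rewrite mulr_natl mulr2n lerD.
- exact: rsummableD.
rewrite rsumD// rsumZ ?rsumB//; last exact: rsummableB.
rewrite Ed EMs; lra.
Unshelve. all: by end_near. Qed.

End tannery.

Section sums_integral_in.
Context {R : realType} {I : countType}.
Context d {T : measurableType d} (mu : {measure set T -> \bar R}).

Lemma Rintegral_rsum_in (D : set T) (f : I -> T -> R) (M : I -> R) : measurable D ->
  (mu D < +oo)%E ->
  (forall i, measurable_fun D (f i)) -> (forall i x, D x -> `|f i x| <= M i) ->
  (forall i, 0 <= M i) -> rsummable M ->
  \int[mu]_(x in D) (rsum (f^~ x)) = rsum (fun i => \int[mu]_(x in D) f i x).
Proof.
move=> mD Doo mf fM M0 sM.
(* Extension by zero makes the bound hold on the whole space, as [Rintegral_rsum] requires. *)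
pose g i x := if x \in D then f i x else 0.
transitivity (\int[mu]_(x in D) (rsum (g^~ x))).
  by apply: eq_Rintegral => x xD; rewrite /g xD.
rewrite (Rintegral_rsum (M := M))//.
- by congr rsum; apply/funext => i; apply: eq_Rintegral => x xD; rewrite /g xD.
- move=> i; apply: eq_measurable_fun (mf i) => x xD.
  by rewrite /g xD.
- move=> i x; rewrite /g; case: ifPn => [|_]; last by rewrite normr0.
  by rewrite inE; exact: fM.
Qed.

End sums_integral_in.

(** * Convergence of inverse-square and Gaussian sums over the integers *)

Section lattice_sums.
Context {R : realType}.

Lemma rsummable_int (u : int -> R) : (forall k, 0 <= u k) ->
  rsummable (fun k : nat => u (Posz k)) -> rsummable (fun k : nat => u (Negz k)) ->
  rsummable u.
Proof.
move=> u0 sp sn; rewrite /rsummable (esumID (range Posz))//.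
rewrite !setTI (_ : ~` range Posz = range Negz).
  rewrite (reindex_esum [set: nat] _ Posz); last first.
    by split => [i _|x y _ _ []//|k [i _ <-]]; [exists i|exists i].
  rewrite [X in (_ + X)%E](reindex_esum [set: nat] _ Negz); last first.
    by split => [i _|x y _ _ []//|k [i _ <-]]; [exists i|exists i].
  exact: lte_add_pinfty.
apply/seteqP; split => [[k|k]/= H|_ [k _ <-] [j _]//]; last by exists k.
by exfalso; apply: H; exists k.
Qed.

Lemma rsummable_nat_bound (u : nat -> R) (C : R) : (forall k, 0 <= u k) ->
  (forall N, \sum_(k < N) u k <= C) -> rsummable u.
Proof.
move=> u0 H; rewrite /rsummable -nneseries_esumT//.
apply: (@le_lt_trans _ _ C%:E); last exact: ltry.
apply: lime_le; first exact: is_cvg_nneseries.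
apply: nearW => N; rewrite sumEFin lee_fin big_mkord.
by apply: le_trans (H N); apply: ler_sum => i _; rewrite ger0_norm.
Qed.

Lemma rsummable_nat_inv_sqr : rsummable (fun k : nat => (1 + k%:R ^+ 2)^-1 : R).
Proof.
apply: (@rsummable_nat_bound _ 4) => [k|N]; first by rewrite invr_ge0 addr_ge0// sqr_ge0.
(* Telescoping: [(1 + k^2)^-1 <= 4 / ((k + 1) * (k + 2))], and the right-hand side is four times a
   difference of consecutive reciprocals. *)
suff : \sum_(k < N) (1 + k%:R ^+ 2 : R)^-1 <= 4 * (1 - N.+1%:R^-1).
  by move=> /le_trans; apply; rewrite ler_piMr// gerBl invr_ge0.
elim: N => [|N IH]; first by rewrite big_ord0 invr1 subrr mulr0.
rewrite big_ord_recr/=; apply: le_trans (lerD IH (lexx _)) _.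
have n0 : (0 : R) <= N%:R by [].
have E : (N.+1%:R : R)^-1 - (N.+2%:R)^-1 = ((N%:R + 1) * (N%:R + 2))^-1.
  rewrite (_ : N.+1%:R = N%:R + 1); last by rewrite -addn1 natrD.
  rewrite (_ : N.+2%:R = N%:R + 2); last by rewrite -addn2 natrD.
  by field; apply/andP; split; rewrite gt_eqF// ltr_wpDl.
suff : (1 + N%:R ^+ 2 : R)^-1 <= 4 * ((N%:R + 1) * (N%:R + 2))^-1 by rewrite -E;
  move: (N.+1%:R^-1 : R) (N.+2%:R^-1 : R) ((1 + N%:R ^+ 2)^-1 : R) => p q r; lra.
rewrite -[leLHS]mul1r ler_pdivrMr; last by rewrite ltr_pwDl// sqr_ge0.
rewrite mulrAC ler_pdivlMr; last by rewrite mulr_gt0// ltr_wpDl.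
nra.
Qed.

Lemma rsummable_inv_sqr : rsummable (fun k : int => (1 + k%:~R ^+ 2)^-1 : R).
Proof.
have H0 := rsummable_nat_inv_sqr; apply: rsummable_int => //.
  by move=> k; rewrite invr_ge0 addr_ge0// sqr_ge0.
apply: le_rsummable H0 => k; have n0 : (0 : R) <= k%:R by [].
rewrite ger0_norm ?invr_ge0 ?addr_ge0 ?sqr_ge0//.
rewrite lef_pV2 ?posrE ?ltr_pwDl ?sqr_ge0// lerD2l NegzE mulrNz sqrrN.
by rewrite -pmulrn lerXn2r ?nnegrE// ler_nat.
Qed.

(** This follows from [1 + b * y^2 <= exp (b * y^2)] and [1 + y^2 <= (1 + b^-1) * (1 + b * y^2)]. *)
Lemma expRN_sqr_le (b y : R) : 0 < b -> expR (- (b * y ^+ 2)) <= (1 + b^-1) * (1 + y ^+ 2)^-1.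
Proof.
move=> b0; rewrite expRN -[leLHS]mul1r ler_pdivrMr ?expR_gt0//.
have y2 := sqr_ge0 y; have b1 : 0 < b^-1 by rewrite invr_gt0.
rewrite mulrAC ler_pdivlMr ?ltr_pwDl// mul1r.
apply: le_trans (_ : _ <= (1 + b^-1) * (1 + b * y ^+ 2)) _.
  have -> : (1 + b^-1) * (1 + b * y ^+ 2) = 1 + y ^+ 2 + b^-1 + b * y ^+ 2.
    by field; exact: lt0r_neq0.
  have := mulr_ge0 (ltW b0) y2; lra.
by rewrite ler_wpM2l ?expR_ge1Dx// addr_ge0// ltW.
Qed.

Lemma rsummable_gauss (b : R) : 0 < b -> rsummable (fun k : int => expR (- (b * k%:~R ^+ 2))).
Proof.
move=> b0; apply: le_rsummable (rsummableZ (1 + b^-1) rsummable_inv_sqr) => k.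
by rewrite ger0_norm ?expR_ge0// expRN_sqr_le.
Qed.

End lattice_sums.

(** * Iterated integrals and integrals over the torus *)

Section fubini_on.
Context d1 d2 {T1 : measurableType d1} {T2 : measurableType d2} {R : realType}.
Context (m1 : {sigma_finite_measure set T1 -> \bar R})
  (m2 : {sigma_finite_measure set T2 -> \bar R}) (D1 : set T1) (D2 : set T2).
Hypotheses (mD1 : measurable D1) (mD2 : measurable D2).

(** Iterated integrals over a rectangle become iterated integrals over the whole product of the
    extension by zero; this equation and the next describe its sections. *)
Let patch2 (f : T1 * T2 -> \bar R) (x : T1) (y : T2) :
  (f \_ (D1 `*` D2)) (x, y) = if x \in D1 then ((fun y => f (x, y)) \_ D2) y else 0%E.
Proof. by rewrite /patch in_setX/=; case: (x \in D1). Qed.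

Let patch1 (f : T1 * T2 -> \bar R) (x : T1) (y : T2) :
  (f \_ (D1 `*` D2)) (x, y) = if y \in D2 then ((fun x => f (x, y)) \_ D1) x else 0%E.
Proof. by rewrite /patch in_setX/= andbC; case: (y \in D2). Qed.

Let int2 (f : T1 * T2 -> \bar R) :
  (\int[m1]_(x in D1) (\int[m2]_(y in D2) f (x, y)) =
   \int[m1]_x (\int[m2]_y (f \_ (D1 `*` D2)) (x, y)))%E.
Proof.
rewrite integral_mkcond; apply: eq_integral => x _.
under [RHS]eq_integral do rewrite patch2.
rewrite [LHS]/patch; case: ifP => xD; first exact: integral_mkcond.
by rewrite integral0.
Qed.

Let int1 (f : T1 * T2 -> \bar R) :
  (\int[m2]_(y in D2) (\int[m1]_(x in D1) f (x, y)) =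
   \int[m2]_y (\int[m1]_x (f \_ (D1 `*` D2)) (x, y)))%E.
Proof.
rewrite integral_mkcond; apply: eq_integral => y _.
under [RHS]eq_integral do rewrite patch1.
rewrite [LHS]/patch; case: ifP => yD; first exact: integral_mkcond.
by rewrite integral0.
Qed.

Let mpatch (f : T1 * T2 -> \bar R) : measurable_fun (D1 `*` D2) f ->
  measurable_fun setT (f \_ (D1 `*` D2)).
Proof.
by move=> mf; apply/(measurable_restrictT _ (measurableX mD1 mD2)).
Qed.

Lemma tonelli_on (f : T1 * T2 -> \bar R) : measurable_fun (D1 `*` D2) f ->
  (forall x y, D1 x -> D2 y -> 0 <= f (x, y))%E ->
  (\int[m1]_(x in D1) (\int[m2]_(y in D2) f (x, y)) =
   \int[m2]_(y in D2) (\int[m1]_(x in D1) f (x, y)))%E.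
Proof.
move=> mf f0; rewrite int1 int2 fubini_tonelli//; first exact: mpatch.
by move=> [x y]; rewrite /patch; case: ifP => //; rewrite inE => -[]; exact: f0.
Qed.

Lemma measurable_fun_tonelli_on (f : T1 * T2 -> \bar R) :
  measurable_fun (D1 `*` D2) f ->
  (forall x y, D1 x -> D2 y -> 0 <= f (x, y))%E ->
  measurable_fun D1 (fun x => \int[m2]_(y in D2) f (x, y))%E.
Proof.
move=> mf f0; apply/(measurable_restrictT _ mD1).
have := @measurable_fun_fubini_tonelli_F _ _ _ _ _ m2 _ (mpatch mf) _.
rewrite /fubini_F => H.
have {}H := H (fun x => _); apply: eq_measurable_fun (H _) => [x _|[x y]].
  under eq_integral do rewrite patch2.
  by rewrite {2}/patch; case: ifP => xD; rewrite ?integral0// [in RHS]integral_mkcond.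
by rewrite /patch; case: ifP => //; rewrite inE => -[]; exact: f0.
Qed.

(* The inner integrals have to be finite everywhere, and not only almost
   everywhere, for the equality of the iterated integrals of their [fine] parts. *)
Lemma fubini_on (f : T1 -> T2 -> R) :
  measurable_fun (D1 `*` D2) (fun p => f p.1 p.2) ->
  (\int[m1]_(x in D1) (\int[m2]_(y in D2) `|f x y|%:E) < +oo)%E ->
  (forall x, D1 x -> m2.-integrable D2 (EFin \o f x)) ->
  (forall y, D2 y -> m1.-integrable D1 (EFin \o f^~ y)) ->
  \int[m1]_(x in D1) (\int[m2]_(y in D2) f x y) =
  \int[m2]_(y in D2) (\int[m1]_(x in D1) f x y).
Proof.
move=> mf foo i2 i1; rewrite {1 3}/Rintegral.
pose g (p : T1 * T2) := (f p.1 p.2)%:E.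
have mg : measurable_fun (D1 `*` D2) g by exact/measurable_EFinP.
have E1 : (\int[m1]_(x in D1) (\int[m2]_(y in D2) f x y)%:E =
    \int[m1]_(x in D1) (\int[m2]_(y in D2) g (x, y)))%E.
  apply: eq_integral => x; rewrite inE => D1x; rewrite fineK//.
  exact: integrable_fin_num (i2 _ D1x).
have E2 : (\int[m2]_(y in D2) (\int[m1]_(x in D1) f x y)%:E =
    \int[m2]_(y in D2) (\int[m1]_(x in D1) g (x, y)))%E.
  apply: eq_integral => y; rewrite inE => D2y; rewrite fineK//.
  exact: integrable_fin_num (i1 _ D2y).
rewrite E1 E2 int1 int2 Fubini//.
apply/integrable12ltyP; first exact: mpatch.
apply: le_lt_trans foo; rewrite (int2 (fun p => `|g p|))%E.
apply: ge0_le_integral => //=.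
- by move=> x _; exact: integral_ge0.
- apply: (measurable_fun_fubini_tonelli_F (fun p => `|(g \_ (D1 `*` D2)) p|)%E) => //=.
  by apply: measurableT_comp => //; exact: mpatch.
- apply: (measurable_fun_fubini_tonelli_F ((fun p => `|g p|%E) \_ (D1 `*` D2))).
    by apply: mpatch; apply: measurableT_comp.
  by move=> p; rewrite /patch; case: ifP.
- move=> x _; apply: ge0_le_integral => //=.
  + apply: measurableT_comp => //; apply: measurableT_comp => //; exact: mpatch.
  + apply: (measurableT_comp (f := (fun p => `|g p|%E) \_ (D1 `*` D2))) => //.
    by apply: mpatch; apply: measurableT_comp.
  + by move=> y _; rewrite /patch; case: ifP; rewrite ?abse0.
Qed.

End fubini_on.

(** * Translation and reflection, first on the line, then on the periodic cell in any dimension *)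

Section lebesgue_shift.
Context {R : realType}.
Local Notation mu := (@lebesgue_measure R).

(** The translated measure agrees with Lebesgue measure on half-open intervals, hence everywhere by
    uniqueness. *)
Lemma lebesgue_measure_shift (c : R) (A : set R) : measurable A ->
  pushforward mu (fun x : measurableTypeR R => x + c : measurableTypeR R) A = mu A.
Proof.
have mc : measurable_fun setT (fun x : measurableTypeR R => x + c : measurableTypeR R).
  exact: measurable_funD.
pose m' := Measure.on (pushforward mu (fun x : measurableTypeR R => x + c : measurableTypeR R)).
move=> mA; apply/esym/lebesgue_measure_unique => //= _ [[a b]] _ <-.
rewrite /pushforward (_ : _ @^-1` _ = `]a - c, b - c]%classic); last first.
  apply/seteqP; split=> x /=; rewrite !in_itv/= ltrBlDr lerBrDr//.
rewrite !lebesgue_measure_itv/= !lte_fin ltrD2r.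
by case: ifP => // _; rewrite -!EFinD; congr EFin; ring.
Qed.

Lemma ge0_integral_shift (c u v : R) (G : R -> \bar R) :
  measurable_fun setT G -> (forall x, 0 <= G x)%E ->
  (\int[mu]_(x in `]u, v]) G (x + c)%R = \int[mu]_(x in `](u + c)%R, (v + c)%R]) G x)%E.
Proof.
move=> mG G0.
have mc : measurable_fun setT (fun x : measurableTypeR R => x + c : measurableTypeR R).
  exact: measurable_funD.
rewrite (_ : `]u, v]%classic =
  (fun x : measurableTypeR R => x + c : measurableTypeR R) @^-1` `]u + c, v + c]); last first.
  by apply/seteqP; split=> x /=; rewrite !in_itv/= ltrD2r lerD2r.
rewrite -(@ge0_integral_pushforward _ _ _ _ _ _ mc mu _ G)//=; last exact: measurable_funS mG.
by apply: eq_measure_integral => //= A mA AS; exact: lebesgue_measure_shift.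
Qed.

Lemma ge0_integral_opp (u : R) (G : R -> \bar R) :
  measurable_fun setT G -> (forall x, 0 <= G x)%E ->
  (\int[mu]_(x in `](- u)%R, u]) G (- x)%R = \int[mu]_(x in `](- u)%R, u]) G x)%E.
Proof.
move=> mG G0.
have mGN : measurable_fun setT (fun x : R => G (- x)) by exact: (measurableT_comp mG).
(* A half-open interval is not symmetric, so its null endpoint is added before reflecting and
   removed afterwards. *)
rewrite integral_itv_obnd_cbnd; last exact: measurable_funS mGN.
rewrite -(@integral_itv_bndo_bndc _ _ u G); last exact: measurable_funS mG.
rewrite (_ : `[- u, u]%classic =
    (-%R : _ -> measurableTypeR R) @^-1` `[- u, u]); last first.
  by apply/seteqP; split=> x /=; rewrite !in_itv/= lerN2 lerNl andbC.
rewrite -ge0_integral_pushforward//=; last exact: measurable_funS mG.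
transitivity (\int[mu]_(x in `[(- u)%R, u]) G x)%E.
  by apply: eq_measure_integral => //= A mA AS; exact: lebesgue_measureN.
by rewrite integral_itv_bndoo//; exact: measurable_funS mG.
Qed.

End lebesgue_shift.

Section cell.
Context {R : realType}.
Local Notation mu := (@lebesgue_measure R).
Local Notation RT := (measurableTypeR R).

Definition cell : set R := `]- pi, pi]%classic.

Definition Qt (n : nat) : set (n.-tuple RT) := @row_of R n @^-1` Q.

Lemma QtE n (t : n.-tuple RT) : Qt t <-> forall i, cell (tnth t i).
Proof.
split=> H i; have := H i; rewrite /cell /= ?mxE ?in_itv//=.
Qed.

Lemma measurable_cell : measurable (cell : set RT).
Proof. exact: measurable_itv. Qed.

Lemma measurable_Qt n : measurable (@Qt n).
Proof.
have -> : @Qt n = \bigcap_(i in [set: 'I_n]) ((fun t : n.-tuple RT => tnth t i) @^-1` cell).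
  by apply/seteqP; split => [t /QtE H i _|t H]; [exact: H|apply/QtE => i; exact: H].
apply: fin_bigcap_measurable => // i _.
rewrite -[X in measurable X]setTI; apply: measurable_tnth => //.
exact: measurable_cell.
Qed.

Lemma Qt_cons n (x : RT) (u : n.-tuple RT) :
  Qt (cons_pair (x, u)) <-> cell x /\ Qt u.
Proof.
split => [/QtE H|[cx /QtE Hu]].
  split; first by have := H ord0; rewrite (tnth_nth 0).
  by apply/QtE => i; have := H (lift ord0 i); rewrite !(tnth_nth 0).
apply/QtE => i; case: (unliftP ord0 i) => [j ->|->].
  by have := Hu j; rewrite !(tnth_nth 0).
by rewrite (tnth_nth 0).
Qed.

Local Notation lam n := (lebesgue_tuple R n).

Lemma ge0_integral_cons n (f : n.+1.-tuple RT -> \bar R) :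
  measurable_fun setT f -> (forall t, 0 <= f t)%E ->
  (\int[lam n.+1]_(t in @Qt n.+1) f t =
   \int[mu]_(x in cell) \int[lam n]_(u in @Qt n) f (cons_pair (x, u)))%E.
Proof.
move=> mf f0; have mQ := measurable_Qt.
have mc := @measurable_cons_pair _ RT n.
rewrite /= /measure_cons ge0_integral_pushforward//=; last exact: measurable_funS mf.
have -> : @cons_pair _ RT n @^-1` @Qt n.+1 = cell `*` @Qt n.
  by apply/seteqP; split => -[x u] /Qt_cons.
rewrite integral_mkcond fubini_tonelli1/=.
- rewrite [RHS]integral_mkcond; apply: eq_integral => x _.
  rewrite /fubini_F /patch; case: ifPn => xc.
    by rewrite [RHS]integral_mkcond; apply: eq_integral => u _; rewrite in_setX/= xc.
  by under eq_integral do rewrite in_setX/= (negbTE xc); rewrite integral0.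
- apply/(measurable_restrictT _ (measurableX measurable_cell (mQ n))).
  exact/measurable_funTS/measurableT_comp.
- by move=> p; rewrite /patch; case: ifP.
- exact: mQ.
Qed.

Lemma lebesgue_cell : mu cell = (2 * pi)%:E.
Proof.
rewrite /cell lebesgue_measure_itv/= lte_fin gtrN ?pi_gt0// -EFinD.
by congr EFin; ring.
Qed.

Lemma lebesgue_cell_lty : (mu cell < +oo)%E.
Proof. by rewrite [X in (X < _)%E]lebesgue_cell ltry. Qed.

Lemma lebesgue_tuple_Qt n : lam n (@Qt n) = ((2 * pi) ^+ n)%:E.
Proof.
elim: n => [|n IH].
  by rewrite /= diracE expr0 mem_set//; apply/QtE => -[].
rewrite -[LHS]mul1e -integral_cst; last exact: measurable_Qt.
rewrite ge0_integral_cons//.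
transitivity (\int[mu]_(x in cell) (cst (lam n (@Qt n)) x))%E.
  apply: eq_integral => x _.
  by rewrite -[RHS]mul1e -integral_cst//; exact: measurable_Qt.
rewrite IH integral_cst; last exact: measurable_cell.
by rewrite [X in (_ * X)%E]lebesgue_cell -EFinM exprSr.
Qed.

Lemma lebesgue_tuple_Qt_lty n : (lam n (@Qt n) < +oo)%E.
Proof. by rewrite lebesgue_tuple_Qt ltry. Qed.

(** The family of coordinate maps is indexed by [nat], so that induction on [n] can pass to
    [fun i => Ts i.+1]. *)
Definition tmap n (Ts : nat -> R -> R) (t : n.-tuple RT) : n.-tuple RT :=
  [tuple Ts i (tnth t i) | i < n].

Lemma measurable_tmap n (Ts : nat -> R -> R) :
  (forall i, measurable_fun setT (Ts i)) -> measurable_fun setT (@tmap n Ts).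
Proof.
move=> mT; apply/measurable_fun_tnthP => i.
have -> : (@tnth _ _)^~ i \o @tmap n Ts = fun t => Ts i (tnth t i).
  by apply/funext => t /=; rewrite tnth_mktuple.
exact: (measurableT_comp (mT i) (measurable_tnth i)).
Qed.

(** Preservation of Lebesgue measure on the cell, tested on nonnegative functions so that Tonelli
    lifts it coordinate by coordinate in [ge0_integral_tmap]. The instances are reflection and
    translation modulo [2 * pi]. *)
Definition cell_invariant (T : R -> R) := measurable_fun setT T /\
  forall G : R -> \bar R, measurable_fun setT G -> (forall x, 0 <= G x)%E ->
  (\int[mu]_(x in cell) G (T x) = \int[mu]_(x in cell) G x)%E.

Lemma tmap_cons n Ts (x : RT) (u : n.-tuple RT) :
  tmap Ts (cons_pair (x, u)) = cons_pair (Ts 0%N x, tmap (fun i => Ts i.+1) u).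
Proof.
apply: eq_from_tnth => i; rewrite tnth_mktuple.
case: (unliftP ord0 i) => [j ->|->]; last by rewrite !(tnth_nth 0).
have E k y (w : n.-tuple RT) : tnth (cons_pair (y, w)) (lift ord0 k) = tnth w k.
  by rewrite !(tnth_nth 0).
by rewrite !E tnth_mktuple.
Qed.

Lemma ge0_integral_tmap n (Ts : nat -> R -> R) (f : n.-tuple RT -> \bar R) :
  (forall i, cell_invariant (Ts i)) ->
  measurable_fun setT f -> (forall t, 0 <= f t)%E ->
  (\int[lam n]_(t in @Qt n) f (tmap Ts t) = \int[lam n]_(t in @Qt n) f t)%E.
Proof.
elim: n Ts f => [|n IH] Ts f iT mf f0.
  by apply: eq_integral => t _; congr f; apply: eq_from_tnth => -[].
have mT : measurable_fun setT (@tmap n.+1 Ts).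
  by apply: measurable_tmap => i; case: (iT i).
rewrite ge0_integral_cons; [|exact: measurableT_comp|by move=> t; exact: f0].
rewrite ge0_integral_cons; [|exact: mf|exact: f0].
under eq_integral do under eq_integral do rewrite tmap_cons.
have mfx (x : RT) : measurable_fun setT (fun u => f (cons_pair (x, u))).
  apply: (measurableT_comp mf).
  apply: (measurableT_comp (f := @cons_pair _ RT n) (g := pair x)).
    exact: measurable_cons_pair.
  exact: pair1_measurable.
under eq_integral => x _.
  rewrite (IH (fun i => Ts i.+1) (fun u => f (cons_pair (Ts 0%N x, u)))
    (fun i => iT i.+1) (mfx _) (fun u => f0 _)).
  over.
have [_ /(_ (fun x => \int[lam n]_(u in @Qt n) f (cons_pair (x, u)))%E)] := iT 0%N.
apply; last by move=> x; exact: integral_ge0.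
have H := @measurable_fun_tonelli_on _ _ RT _ R (lam n) setT (@Qt n) measurableT
  (@measurable_Qt n) (fun p => f (cons_pair p)).
apply: H => //.
apply/measurable_funTS/measurableT_comp => //; exact: measurable_cons_pair.
Qed.

End cell.

Section cellrep.
Context {R : realType}.
Local Notation mu := (@lebesgue_measure R).

(** The ceiling, rather than the floor, matches a cell that is open on the left and closed on the
    right. *)
Definition cellrepz (x : R) : int := Num.ceil ((x - pi) / (2 * pi)).

Definition cellrep (x : R) : R := x - (2 * pi) * (cellrepz x)%:~R.

Lemma cellrep_eq (x : R) (k : int) : cell (x - (2 * pi) * k%:~R) -> cellrepz x = k.
Proof.
have p0 : 0 < 2 * pi :> R by rewrite mulr_gt0// pi_gt0.
rewrite /cell/= in_itv/= => /andP[h1 h2]; apply: ceil_def.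
rewrite ltr_pdivlMr// ler_pdivrMr// intrD; apply/andP; split; lra.
Qed.

Lemma cellrep_cell (x : R) : cell (cellrep x).
Proof.
have p0 : 0 < 2 * pi :> R by rewrite mulr_gt0// pi_gt0.
have := ceil_itv ((x - pi) / (2 * pi)).
rewrite ltr_pdivlMr// ler_pdivrMr// intrD => /andP[h1 h2].
rewrite /cell/= in_itv/= /cellrep /cellrepz; apply/andP; split; lra.
Qed.

Lemma cellrep_id (x : R) : cell x -> cellrep x = x.
Proof.
by move=> cx; rewrite /cellrep (@cellrep_eq x 0) mulr0 ?subr0.
Qed.

Lemma cellrep_shift (x : R) (k : int) : cellrep (x + (2 * pi) * k%:~R) = cellrep x.
Proof.
have E : x + 2 * pi * k%:~R - 2 * pi * (k + cellrepz x)%:~R = cellrep x.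
  by rewrite /cellrep intrD; ring.
rewrite {1}/cellrep (@cellrep_eq _ (k + cellrepz x)); rewrite E//; exact: cellrep_cell.
Qed.

Lemma measurable_cellrep : measurable_fun setT cellrep.
Proof.
apply: measurable_funB => //; apply: measurable_funM => //.
apply: nondecreasing_measurable => // x y xy; rewrite ler_int; apply: le_ceil.
by rewrite ler_pM2r ?invr_gt0 ?mulr_gt0 ?pi_gt0// lerD2r.
Qed.

Lemma cell_invariant_opp : cell_invariant (-%R : R -> R).
Proof. by split => // G mG G0; exact: ge0_integral_opp. Qed.

Lemma cell_invariant_shift (a : R) : cell_invariant (fun x => cellrep (x + a)).
Proof.
have p0 : 0 < pi :> R := pi_gt0 R.
have mT (c : R) : measurable_fun setT (fun x : R => cellrep (x + c)).
  by apply: (measurableT_comp measurable_cellrep); exact: measurable_funD.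
split; first exact: mT.
(* [b] is the representative of [a] in []0, 2 * pi]]. Translation by [b] modulo [2 * pi] cuts the
   cell at [pi - b] and swaps the two pieces: the left one moves by [b], the right one by
   [b - 2 * pi]. *)
pose b := cellrep (a - pi) + pi.
have wb x : cellrep (x + a) = cellrep (x + b).
  rewrite -(cellrep_shift (x + b) (cellrepz (a - pi))); congr cellrep.
  by rewrite /b /cellrep; ring.
have /andP[b1 b2] : - pi < cellrep (a - pi) <= pi.
  by have := cellrep_cell (a - pi); rewrite /cell/= in_itv.
move=> G mG G0; under eq_integral do rewrite wb.
have mGw : measurable_fun setT (fun x : R => G (cellrep (x + b))).
  exact: (measurableT_comp mG).
have U1 : cell = `]- pi, pi - b] `|` `]pi - b, pi] :> set R.
  apply/seteqP; split => x; rewrite /cell/= !in_itv/=.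
    by move=> /andP[x1 x2]; have [xb|xb] := leP x (pi - b); [left|right]; lra.
  by move=> [] /andP[x1 x2]; rewrite /b in x1 x2 *; lra.
have U2 : cell = `]- pi, - pi + b] `|` `]- pi + b, pi] :> set R.
  apply/seteqP; split => x; rewrite /cell/= !in_itv/=.
    by move=> /andP[x1 x2]; have [xb|xb] := leP x (- pi + b); [left|right]; lra.
  by move=> [] /andP[x1 x2]; rewrite /b in x1 x2 *; lra.
have dsj (u v w : R) : [disjoint `]u, v] & `]v, w]].
  apply/disj_setPS => x /= []; rewrite !in_itv/= => /andP[_ h1] /andP[h2 _].
  by move: (le_lt_trans h1 h2); rewrite ltxx.
rewrite {1}U1 U2 !ge0_integral_setU//; try exact: measurable_funS mG;
  try exact: measurable_funS mGw.
rewrite addeC; congr (_ + _)%E.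
- rewrite (_ : `]- pi, - pi + b] = `](pi - b) + (b - 2 * pi), pi + (b - 2 * pi)])%classic; last first.
    rewrite (_ : pi - b + _ = - pi); last by ring.
    by rewrite (_ : pi + _ = - pi + b)//; ring.
  rewrite -ge0_integral_shift//; apply: eq_integral => x; rewrite inE/= in_itv/= => /andP[h1 h2].
  rewrite -(cellrep_shift (x + b) (-1)); congr G; rewrite -[RHS]cellrep_id.
    by congr cellrep; rewrite mulrN1; ring.
  by rewrite /cell/= in_itv/=; rewrite /b in h1 *; lra.
- rewrite (_ : `]- pi + b, pi] = `](- pi) + b, (pi - b) + b])%classic; last by rewrite subrK.
  rewrite -ge0_integral_shift//; apply: eq_integral => x; rewrite inE/= in_itv/= => /andP[h1 h2].
  by congr G; apply: cellrep_id; rewrite /cell/= in_itv/=; rewrite /b in h2 *; lra.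
Qed.

End cellrep.

Section measurable_continuous.
Context {R : realType} {n : nat} d {T : measurableType d}.
Implicit Types rho : T -> 'rV[R]_n.

Let grid (k : nat) (x : 'rV[R]_n) : 'rV[int]_n :=
  \row_i Num.floor (k.+1%:R * x 0 i).

Let cell_of (k : nat) (nu : 'rV[int]_n) (x : 'rV[R]_n) : bool :=
  \big[andb/true]_i ((nu 0 i)%:~R <= k.+1%:R * x 0 i < (nu 0 i + 1)%:~R).

Let cell_ofE k nu x : cell_of k nu x = (nu == grid k x).
Proof.
rewrite /cell_of big_andE; apply/forallP/eqP => [H|-> i]; last first.
  by rewrite mxE; exact: floor_itv.
by apply/rowP => i; rewrite mxE; apply/esym/floor_def; exact: H.
Qed.

(* A continuous function is the pointwise limit of its discretizations on the
   grids [k.+1^-1 Z^n], which factor through a countable set. *)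
Lemma measurable_continuous (D : set T) rho (f : 'rV[R]_n -> R) :
  measurable D -> (forall i, measurable_fun D (fun t => rho t 0 i)) ->
  continuous f -> measurable_fun D (f \o rho).
Proof.
move=> mD mrho cf.
pose F (k : nat) (nu : 'rV[int]_n) : R := f (\row_i ((nu 0 i)%:~R / k.+1%:R)).
(* Only one term of this sum is nonzero, so [h k] is [f] evaluated at the grid point below [rho t];
   written as a countable sum, it is visibly measurable. *)
pose h (k : nat) (t : T) := rsum (fun nu => if nu == grid k (rho t) then F k nu else 0).
apply: (measurable_fun_cvg (h := h)) => //.
  move=> k; apply: measurable_fun_rsum => // nu.
  under eq_fun do rewrite -cell_ofE.
  apply: measurable_fun_if => //.
  rewrite /cell_of.
  have : forall s : seq 'I_n, measurable_fun D (fun t => \big[andb/true]_(i <- s)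
      ((nu 0 i)%:~R <= k.+1%:R * rho t 0 i < (nu 0 i + 1)%:~R)).
    elim=> [|i s IH].
      by under eq_fun do rewrite big_nil; exact: measurable_cst.
    under eq_fun do rewrite big_cons.
    apply: measurable_and => //; apply: measurable_and.
      by apply: measurable_fun_ler => //; exact: measurable_funM.
    by apply: measurable_fun_ltr => //; exact: measurable_funM.
  exact.
move=> t Dt.
have -> : h ^~ t = fun k => f (\row_i ((Num.floor (k.+1%:R * rho t 0 i))%:~R / k.+1%:R)).
  apply/funext => k; rewrite /h.
  rewrite (_ : (fun nu => _) = (fun nu => if nu == grid k (rho t) then F k (grid k (rho t)) else 0)).
    by rewrite rsum_pick /F; congr f; apply/rowP => i; rewrite !mxE.
  by apply/funext => nu; case: eqP => // ->.
apply: continuous_cvg; first exact: cf.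
apply/cvg_ballP => e e0; near=> k.
split=> // i j; rewrite (ord1 i) !mxE.
rewrite /ball/=.
have k0 : 0 < k.+1%:R :> R by [].
have /andP[f1 f2] := floor_itv (k.+1%:R * rho t 0 j).
have f3 : (Num.floor (k.+1%:R * rho t 0 j))%:~R / k.+1%:R <= rho t 0 j.
  by rewrite ler_pdivrMr// [leRHS]mulrC.
rewrite ger0_norm ?subr_ge0//.
apply: (@le_lt_trans _ _ k.+1%:R^-1); last by near: k; exact: (near_infty_natSinv_lt (PosNum e0)).
rewrite intrD in f2.
by rewrite lerBlDr -[X in X + _]mul1r -mulrDl ler_pdivlMr// [leLHS]mulrC [leRHS]addrC ltW.
Unshelve. all: by end_near. Qed.

End measurable_continuous.

Section torus_integral.
Context {R : realType} {n : nat}.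
Local Notation RT := (measurableTypeR R).
Local Notation lam := (lebesgue_tuple R n).
Implicit Types (f g : 'rV[R]_n -> R).

(** Measurability is pulled back to tuples, where [lebesgue_tuple] lives. *)
Definition mfunR f := measurable_fun setT (f \o @row_of R n).

Lemma measurable_row_of i : measurable_fun setT (fun t : n.-tuple RT => row_of t 0 i).
Proof.
by under eq_fun do rewrite mxE; exact: measurable_tnth.
Qed.

Lemma continuous_mfunR f : continuous f -> mfunR f.
Proof. by move=> cf; apply: measurable_continuous => //; exact: measurable_row_of. Qed.

Lemma integral_tmap (Ts : nat -> R -> R) (f : n.-tuple RT -> \bar R) :
  (forall i, cell_invariant (Ts i)) -> measurable_fun setT f ->
  (\int[lam]_(t in @Qt R n) f (tmap Ts t) = \int[lam]_(t in @Qt R n) f t)%E.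
Proof.
move=> iT mf; rewrite [LHS]integralE [RHS]integralE.
congr (_ - _)%E.
- rewrite -(ge0_integral_tmap iT (measurable_funepos mf))//.
  by apply: eq_integral => t _; rewrite !funeposE.
- rewrite -(ge0_integral_tmap iT (measurable_funeneg mf))//.
  by apply: eq_integral => t _; rewrite !funenegE.
Qed.

(** Translation by [a] modulo [2 * pi]; the value [0] past the last coordinate completes the
    [nat]-indexed family expected by [tmap]. *)
Let Ts_shift (a : 'rV[R]_n) (k : nat) : R -> R :=
  fun x => cellrep (x + (if insub k is Some i then a 0 i else 0)).

Let row_of_shift (a : 'rV[R]_n) t :
  row_of (tmap (Ts_shift a) t) = row_of t + a + (2 * pi) *: ivec R (\row_i - cellrepz ((row_of t + a) 0 i)).
Proof.
apply/rowP => i; rewrite !mxE tnth_mktuple /Ts_shift valK /cellrep.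
by rewrite mulrNz mulrN.
Qed.

Let row_of_opp t : row_of (tmap (fun=> -%R) t) = - @row_of R n t.
Proof. by apply/rowP => i; rewrite !mxE tnth_mktuple. Qed.

Let iT_shift a k : cell_invariant (Ts_shift a k).
Proof. exact: cell_invariant_shift. Qed.

Lemma mfunR_shift f a : Defs.periodic f -> mfunR f -> mfunR (fun x => f (x + a)).
Proof.
move=> pf mf; rewrite /mfunR (_ : _ \o _ = (f \o @row_of R n) \o tmap (Ts_shift a)).
  by apply: measurableT_comp => //; apply: measurable_tmap => i; case: (iT_shift a i).
by apply/funext => t /=; rewrite row_of_shift pf.
Qed.

Lemma mfunR_opp f : mfunR f -> mfunR (fun x => f (- x)).
Proof.
move=> mf; rewrite /mfunR (_ : _ \o _ = (f \o @row_of R n) \o tmap (fun=> -%R)).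
  apply: measurableT_comp => //; apply: measurable_tmap => i.
  by case: (@cell_invariant_opp R).
by apply/funext => t /=; rewrite row_of_opp.
Qed.

Lemma Rn_int_shift f a : Defs.periodic f -> mfunR f ->
  Rn_int Q (fun x => f (x + a)) = Rn_int Q f.
Proof.
move=> pf mf; rewrite /Rn_int /Rintegral; congr fine.
rewrite -[RHS](integral_tmap (iT_shift a)); last exact/measurable_EFinP.
by apply: eq_integral => t _; rewrite row_of_shift pf.
Qed.

Lemma Rn_int_opp f : mfunR f -> Rn_int Q (fun x => f (- x)) = Rn_int Q f.
Proof.
move=> mf; rewrite /Rn_int /Rintegral; congr fine.
rewrite -[RHS](integral_tmap (fun=> @cell_invariant_opp R)); last exact/measurable_EFinP.
by apply: eq_integral => t _; rewrite row_of_opp.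
Qed.

Lemma Rn_int_subl f a : Defs.periodic f -> mfunR f ->
  Rn_int Q (fun x => f (a - x)) = Rn_int Q f.
Proof.
move=> pf mf; rewrite -[RHS](Rn_int_shift a)// -[RHS]Rn_int_opp; last exact: mfunR_shift.
by congr Rn_int; apply/funext => x; rewrite addrC.
Qed.

Lemma Rn_integrable_opp f : mfunR f -> Rn_integrable Q f -> Rn_integrable Q (fun x => f (- x)).
Proof.
move=> mf /integrableP[_ foo]; apply/integrableP; split.
  by have /measurable_EFinP := mfunR_opp mf; exact: measurable_funTS.
rewrite (le_lt_trans _ foo)//.
rewrite -[leRHS](integral_tmap (fun=> @cell_invariant_opp R))//.
  by under [leRHS]eq_integral do rewrite /= row_of_opp.
exact/measurableT_comp/measurable_EFinP.
Qed.

Lemma bounded_Rn_integrable f (c : R) : mfunR f -> (forall x, Q x -> `|f x| <= c) ->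
  Rn_integrable Q f.
Proof.
move=> mf fc; apply: (bounded_integrable (c := c)) => //.
- exact: measurable_Qt.
- exact: lebesgue_tuple_Qt_lty.
- exact: measurable_funTS.
- by move=> t Qt; exact: fc.
Qed.

End torus_integral.

(** * Poisson summation *)

Section fourier_uniqueness.
Context {R : realType}.
Local Notation mu := (@lebesgue_measure R).
Implicit Types (f D : R -> R).

Definition per1 f := forall (x : R) (k : int), f (x + (2 * pi) * k%:~R) = f x.

Lemma Rintegral_cell_shift f (a : R) : per1 f -> measurable_fun setT f ->
  \int[mu]_(x in cell) f (x + a) = \int[mu]_(x in cell) f x.
Proof.
move=> pf mf; rewrite /Rintegral; congr fine.
have [mT iT] := cell_invariant_shift a.
have fE x : f (x + a) = f (cellrep (x + a)).
  by rewrite -{1}(subrK ((2 * pi) * (cellrepz (x + a))%:~R) (x + a)) pf.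
have mf' : measurable_fun setT (EFin \o f) by exact/measurable_EFinP.
rewrite [LHS]integralE [RHS]integralE; congr (_ - _)%E.
- rewrite -(iT _ (measurable_funepos mf'))//.
  by apply: eq_integral => x _; rewrite !funeposE /= fE.
- rewrite -(iT _ (measurable_funeneg mf'))//.
  by apply: eq_integral => x _; rewrite !funenegE /= fE.
Qed.

Lemma continuous_bounded_cell f : continuous f ->
  exists M : R, 0 <= M /\ forall x, cell x -> `|f x| <= M.
Proof.
move=> cf; have p0 := pi_gt0 R.
have pp : - pi <= pi :> R by lra.
have [|c _ Hc] := @EVT_max R (fun x => `|f x|) (- pi) pi pp.
- by apply: continuous_subspaceT => x; apply: continuous_comp; [exact: cf|exact: norm_continuous].
exists `|f c|; split => // x /andP[x1 x2]; apply: Hc.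
by rewrite in_itv/= (ltW x1).
Qed.

Lemma cell_integrable f : continuous f -> mu.-integrable cell (EFin \o f).
Proof.
move=> cf; have [M [_ Mf]] := continuous_bounded_cell cf.
apply: (bounded_integrable (c := M)) => //; rewrite ?lebesgue_cell_lty//.
- exact: measurable_cell.
- by apply: measurable_funTS; exact: continuous_measurable_fun.
Qed.

Lemma cos_mulD (a b : R) : cos a * cos b = 2^-1 * (cos (a + b) + cos (a - b)).
Proof. by rewrite cosD cosB; field. Qed.

Lemma cosDpi2z (x : R) (k : int) : cos (x + (2 * pi) * k%:~R) = cos x.
Proof.
have H m y : cos (y + (2 * pi) * m%:R) = cos y :> R.
  elim: m y => [|m IH] y; first by rewrite mulr0 addr0.
  rewrite -[RHS]IH -[in RHS]cosD2pi; congr cos.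
  by rewrite -addn1 natrD -mulr_natl; ring.
case: k => m; first exact: H.
by rewrite NegzE mulrNz mulrN; have := H m.+1 (x - 2 * pi * m.+1%:R); rewrite subrK.
Qed.

(** Vanishing of all Fourier coefficients extends to integrals against [w^N], where
    [w = (1 + cos) / 2] is centred at [x0]. For large [N] these weights concentrate at [x0], and
    their integral against [D] would be positive. *)
Lemma fourier_unique_pos D : continuous D -> per1 D ->
  (forall (k : int) theta, \int[mu]_(x in cell) (D x * cos (k%:~R * x + theta)) = 0) ->
  forall x0, ~ 0 < D x0.
Proof.
move=> cD pD D0 x0 Dx0.
have p0 := pi_gt0 R.
pose w (x : R) : R := (1 + cos x) / 2.
have cw : continuous w.
  move=> x; apply: cvgM; last exact: cvg_cst.
  by apply: cvgD; [exact: cvg_cst|exact: continuous_cos].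
have w01 x : 0 <= w x <= 1.
  have := cos_geN1 x; have := cos_le1 x; rewrite /w => h1 h2; apply/andP; split; lra.
pose E (x : R) := D (x + x0).
have cE : continuous E.
  move=> x; apply: continuous_comp; last exact: cD.
  by apply: cvgD; [exact: cvg_id|exact: cvg_cst].
have E0 (k : int) theta : \int[mu]_(x in cell) (E x * cos (k%:~R * x + theta)) = 0.
  rewrite -(D0 k (theta - k%:~R * x0)).
  rewrite -[RHS](Rintegral_cell_shift x0).
  - apply: eq_Rintegral => x _; rewrite /E; congr (_ * cos _); ring.
  - move=> x m; rewrite pD; congr (_ * _).
    by rewrite -[RHS](cosDpi2z _ (k * m)) intrM; congr cos; ring.
  - apply: measurable_funM; apply: continuous_measurable_fun => //.
    move=> x; apply: continuous_comp; last exact: continuous_cos.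
    by apply: cvgD; [apply: cvgM; [exact: cvg_cst|exact: cvg_id]|exact: cvg_cst].
have cwN N : continuous (fun x => w x ^+ N).
  by move=> x; apply: (@continuous_comp _ _ _ w (fun y => y ^+ N)); [exact: cw|exact: exprn_continuous].
(* Each factor [w] turns a frequency [k] into a combination of [k], [k + 1] and [k - 1], by the
   addition formulas. *)
have EwN0 N (k : int) theta :
    \int[mu]_(x in cell) (E x * w x ^+ N * cos (k%:~R * x + theta)) = 0.
  elim: N k theta => [|N IH] k theta.
    by rewrite -[RHS](E0 k theta); apply: eq_Rintegral => x _; rewrite expr0 mulr1.
  have ci (j : int) : mu.-integrable cell
      (EFin \o (fun x => E x * w x ^+ N * cos (j%:~R * x + theta))).
    apply: cell_integrable => x; apply: cvgM.
      by apply: cvgM; [exact: cE|exact: cwN].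
    apply: continuous_comp; last exact: continuous_cos.
    by apply: cvgD; [apply: cvgM; [exact: cvg_cst|exact: cvg_id]|exact: cvg_cst].
  have mc := @measurable_cell R.
  transitivity (2^-1 * \int[mu]_(x in cell) (E x * w x ^+ N * cos (k%:~R * x + theta)) +
    4^-1 * \int[mu]_(x in cell) (E x * w x ^+ N * cos ((k + 1)%:~R * x + theta)) +
    4^-1 * \int[mu]_(x in cell) (E x * w x ^+ N * cos ((k - 1)%:~R * x + theta))).
    rewrite -!RintegralZl// -!RintegralD//; last 4 first.
    - by apply: integrableRD => //; exact: integrableRZ.
    - exact: integrableRZ.
    - exact: integrableRZ.
    - exact: integrableRZ.
    apply: eq_Rintegral => x _; rewrite exprSr /w !intrD.
    rewrite (_ : (k%:~R + 1%:~R) * x + theta = k%:~R * x + theta + x); last by rewrite mulr1z; ring.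
    rewrite (_ : (k%:~R + (-1)%:~R) * x + theta = k%:~R * x + theta - x); last by rewrite mulrN1z; ring.
    move: (k%:~R * x + theta) (((1 + cos x) / 2) ^+ N) => c W.
    by rewrite cosD cosB; field.
  by rewrite !IH !mulr0 !addr0.
have [M [M0 EM]] := continuous_bounded_cell cE.
have E00 : 0 < E 0 by rewrite /E add0r.
have [d /= d0 dE] : exists2 d : R, 0 < d & forall x, `|x| < d -> E 0 / 2 < E x.
  have := cE 0 => /cvgrPdist_lt /(_ (E 0 / 2) (divr_gt0 E00 (ltr0n _ 2))).
  rewrite -filter_from_ballE => -[d /= d0 Hd]; exists d => // x xd.
  have := Hd x; rewrite /ball/= sub0r normrN => /(_ xd); rewrite ltr_norml; lra.
(* [E] exceeds [E 0 / 2] on [|x| <= dd], and [dd < pi] stays in the range where [cos] decreases. So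
   [w] is at least [a] for [|x| <= dd / 2] and at most [b < a] for [dd <= |x| <= pi]. *)
pose dd := Num.min d pi / 2.
have dd0 : 0 < dd by rewrite divr_gt0// lt_min d0.
have ddd : dd < d.
  by rewrite /dd; have : Num.min d pi <= d by [rewrite ge_min lexx]; lra.
have ddp : dd < pi.
  by rewrite /dd; have : Num.min d pi <= pi by [rewrite ge_min lexx orbT]; lra.
pose a := w (dd / 2); pose b := w dd.
have ba : b < a by rewrite /a /b /w ltr_pM2r// ltrD2l ltr_cos ?in_itv/=; lra.
have b0 : 0 <= b by case/andP: (w01 dd).
have a0 : 0 < a by exact: le_lt_trans ba.
(* The right-hand side is the gain on [|x| <= dd / 2], an interval of length [dd]; the left-hand
   side bounds the possible loss over the cell, of length [2 * pi]. *)
have [N HN] : exists N, 2 * pi * M * b ^+ N < E 0 / 2 * dd * a ^+ N.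
  have ba1 : `|b / a| < 1 by rewrite ger0_norm ?divr_ge0 ?(ltW a0)// ltr_pdivrMr// mul1r.
  have P1 : 0 < 2 * pi * M + 1.
    by apply: ltr_wpDl => //; rewrite mulr_ge0// mulr_ge0// ltW.
  have C0 : 0 < E 0 / 2 * dd / (2 * pi * M + 1).
    by apply: divr_gt0 => //; apply: mulr_gt0 => //; exact: divr_gt0.
  have /cvgrPdist_lt/(_ _ C0)[N _ /(_ N (leqnn N))] := cvg_expr ba1.
  rewrite /= sub0r normrN ger0_norm ?exprn_ge0 ?divr_ge0 ?(ltW a0)// => HN.
  exists N; move: HN; rewrite expr_div_n ltr_pdivrMr ?exprn_gt0//.
  rewrite mulrAC ltr_pdivlMr//.
  apply: le_lt_trans; rewrite [leRHS]mulrC ler_wpM2r ?exprn_ge0//; lra.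
have := EwN0 N 0 0; under eq_Rintegral do rewrite mul0r addr0 cos0 mulr1.
apply/eqP; rewrite gt_eqF//.
(* A step function below [E * w^N]. Between [dd / 2] and [dd] the product is nonnegative while [L]
   is at most [0]. *)
pose L (x : R) : R := (E 0 / 2 * a ^+ N) * \1_(`[- (dd / 2), dd / 2]%classic) x - M * b ^+ N.
have mc := @measurable_cell R.
have mI : measurable (`[- (dd / 2), dd / 2]%classic : set (measurableTypeR R)) by exact: measurable_itv.
have ii : mu.-integrable cell (EFin \o (fun x => E 0 / 2 * a ^+ N * \1_`[- (dd / 2), dd / 2]%classic x)).
  apply: (bounded_integrable (c := `|E 0 / 2 * a ^+ N|)) => //; rewrite ?lebesgue_cell_lty//.
  - by apply: measurable_funM => //; exact: measurable_indic.
  - by move=> x _; rewrite normrM ler_piMr// indicE ger0_norm//; case: (_ \in _).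
have i2 : mu.-integrable cell (EFin \o (fun=> M * b ^+ N)).
  apply: (bounded_integrable (c := `|M * b ^+ N|)) => //; rewrite ?lebesgue_cell_lty//.
have muI : mu `[- (dd / 2), dd / 2]%classic = dd%:E.
  rewrite lebesgue_measure_itv/= lte_fin ifT; last by lra.
  by rewrite -EFinD; congr EFin; lra.
apply: (@lt_le_trans _ _ (\int[mu]_(x in cell) L x)).
  rewrite /L RintegralB// Rintegral_cst// RintegralZl//; last first.
    apply: (bounded_integrable (c := 1)) => //; rewrite ?lebesgue_cell_lty//.

    by move=> x _; rewrite indicE ger0_norm//; case: (_ \in _).
  rewrite [X in _ * X - _](_ : _ = dd); last first.
    rewrite /Rintegral integral_indic// setIidl; last first.
      by move=> x; rewrite /cell/= !in_itv/= => /andP[h1 h2]; apply/andP; split; lra.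
    by rewrite [X in fine X = _]muI.
  rewrite [X in _ * fine X]lebesgue_cell /=.
  have -> : E 0 / 2 * a ^+ N * dd - M * b ^+ N * (2 * pi) =
    E 0 / 2 * dd * a ^+ N - 2 * pi * M * b ^+ N by ring.
  by rewrite subr_gt0.
apply: le_Rintegral => //.
- exact: integrableRB.
- by apply: cell_integrable => x; apply: cvgM; [exact: cE|exact: cwN].
move=> x cx; rewrite /L indicE; have [wx0 wx1] := andP (w01 x).
have xp : `|x| <= pi.
  by move: cx; rewrite /cell/= in_itv/= ler_norml => /andP[/ltW -> ->].
have [xd|xd] := leP `|x| (dd / 2).
  rewrite mem_set; last by rewrite /= in_itv/= -ler_norml.
  rewrite mulr1; apply: (@le_trans _ _ (E 0 / 2 * a ^+ N)).
    by rewrite gerBl mulr_ge0// exprn_ge0.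
  apply: ler_pM.
  - by rewrite divr_ge0// ltW.
  - by rewrite exprn_ge0// ltW.
  - by apply/ltW/dE; lra.
  - rewrite lerXn2r ?nnegrE ?(ltW a0)// /a /w ler_pM2r// lerD2l.
    rewrite -[cos x]cos_norm; have := xd; rewrite le_eqVlt => /predU1P[->//|xd'].
    by apply/ltW; rewrite ltr_cos ?in_itv/= ?normr_ge0//=; lra.
rewrite memNset ?mulr0 ?sub0r; last first.
  by rewrite /= in_itv/= -ler_norml; apply/negP; rewrite -ltNge.
have [xdd|xdd] := ltP `|x| dd.
  apply: (@le_trans _ _ 0); first by rewrite oppr_le0 mulr_ge0// exprn_ge0.
  rewrite mulr_ge0 ?exprn_ge0//; apply/ltW; apply: lt_trans (dE x _); last by lra.
  by rewrite divr_gt0.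
rewrite -lerNl -mulNr; apply: (@le_trans _ _ (`|E x| * w x ^+ N)).
  by rewrite ler_wpM2r ?exprn_ge0// -normrN ler_norm.
apply: ler_pM; rewrite ?normr_ge0 ?exprn_ge0//; first exact: EM.
rewrite lerXn2r ?nnegrE// /b /w ler_pM2r// lerD2l -[cos x]cos_norm.
have := xdd; rewrite le_eqVlt => /predU1P[->//|xd'].
by apply/ltW; rewrite ltr_cos ?in_itv/= ?normr_ge0//=; lra.
Qed.

Lemma fourier_unique D : continuous D -> per1 D ->
  (forall (k : int) theta, \int[mu]_(x in cell) (D x * cos (k%:~R * x + theta)) = 0) ->
  forall x, D x = 0.
Proof.
move=> cD pD D0 x; apply/eqP; rewrite eq_le !leNgt; apply/andP; split; apply/negP.
  exact: fourier_unique_pos.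
move=> Dx; apply: (@fourier_unique_pos (fun x => - D x) _ _ _ x).
- by move=> y; apply: cvgN; exact: cD.
- by move=> y k; rewrite pD.
- move=> k theta; rewrite -[RHS](mulr0 (-1)) -(D0 k theta) -RintegralZl.
  + by apply: eq_Rintegral => y _; rewrite mulN1r mulNr.
  + exact: measurable_cell.
  + apply: cell_integrable => y; apply: cvgM; first exact: cD.
    apply: continuous_comp; last exact: continuous_cos.
    by apply: cvgD; [apply: cvgM; [exact: cvg_cst|exact: cvg_id]|exact: cvg_cst].
- by rewrite oppr_gt0.
Qed.

End fourier_uniqueness.

Section derivatives.
Context {R : realType}.
Implicit Types (f g : R -> R) (x df dg : R).

(** These rules are stated for explicit [fun] expressions, so that the derivative of a formula can
    be assembled by direct application. *)
Lemma derD f g x df dg : is_derive x (1 : R) f df -> is_derive x (1 : R) g dg ->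
  is_derive x (1 : R) (fun y => f y + g y) (df + dg).
Proof. exact: is_deriveD. Qed.

Lemma derM f g x df dg : is_derive x (1 : R) f df -> is_derive x (1 : R) g dg ->
  is_derive x (1 : R) (fun y => f y * g y) (df * g x + f x * dg).
Proof.
move=> Df Dg; apply: (is_derive_eq (is_deriveM Df Dg)).
by rewrite /GRing.scale/= addrC [g x * _]mulrC.
Qed.

Lemma derN f x df : is_derive x (1 : R) f df -> is_derive x (1 : R) (fun y => - f y) (- df).
Proof. exact: is_deriveN. Qed.

Lemma der_comp f g x df dg : is_derive (g x) (1 : R) f df -> is_derive x (1 : R) g dg ->
  is_derive x (1 : R) (fun y => f (g y)) (df * dg).
Proof. by move=> Df Dg; have := @is_derive1_comp R f g x df dg Df Dg. Qed.

Lemma der_cst x (c : R) : is_derive x (1 : R) (fun=> c) 0.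
Proof. exact: is_derive_cst. Qed.

Lemma der_id x : is_derive x (1 : R) (fun y => y) 1.
Proof. exact: is_derive_id. Qed.

Lemma der_continuous f (f' : R -> R) : (forall x, is_derive x (1 : R) f (f' x)) -> continuous f.
Proof.
move=> H x; apply: differentiable_continuous; apply/derivable1_diffP.
by case: (H x).
Qed.

Lemma FTC2_der f (f' : R -> R) (a b : R) : a < b ->
  (forall x, is_derive x (1 : R) f (f' x)) -> continuous f' ->
  \int[lebesgue_measure]_(x in `[a, b]) f' x = f b - f a.
Proof.
move=> ab Df cf'; have cf := der_continuous Df.
rewrite /Rintegral (@continuous_FTC2 _ f' f)//.
- exact: continuous_subspaceT.
- split.
  + by move=> x _; case: (Df x).
  + exact/cvg_at_right_filter/cf.
  + exact/cvg_at_left_filter/cf.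
- by move=> x _; rewrite derive1E; apply: derive_val.
Qed.

End derivatives.

(** * Gaussian integrals and their cosine transform *)

Section gaussian.
Context {R : realType}.
Local Notation mu := (@lebesgue_measure R).

Definition gauss (a x : R) : R := expR (- (a * x ^+ 2)).

Lemma gauss_gt0 a x : 0 < gauss a x.
Proof. exact: expR_gt0. Qed.

Lemma der_gauss a x : is_derive x (1 : R) (gauss a) (gauss a x * (- (2 * a * x))).
Proof.
apply: (@der_comp R expR (fun x => - (a * x ^+ 2))).
apply: derN; have -> : 2 * a * x = 0 * x ^+ 2 + a * (1 * x + x * 1) by ring.
exact: (derM (der_cst _ _) (derM (der_id x) (der_id x))).
Qed.

Lemma continuous_gauss a : continuous (gauss a).
Proof. exact: der_continuous (der_gauss a). Qed.

Lemma continuous_linear (k : R) : continuous (fun x : R => k * x).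
Proof. by move=> x; apply: cvgM; [exact: cvg_cst|exact: cvg_id]. Qed.

Lemma continuous_cos_lin (k : R) : continuous (fun x : R => cos (k * x)).
Proof.
move=> x; apply: (@continuous_comp _ _ _ (fun x => k * x) cos).
  exact: continuous_linear.
exact: continuous_cos.
Qed.

Lemma continuous_sin_lin (k : R) : continuous (fun x : R => sin (k * x)).
Proof.
move=> x; apply: (@continuous_comp _ _ _ (fun x => k * x) sin).
  exact: continuous_linear.
exact: continuous_sin.
Qed.

Section gaussian_pos.
Variables (a : R) (a0 : 0 < a).

(** The standard deviation for which the centred normal density is a multiple of [gauss a]. *)
Let s : R := Num.sqrt (2 * a)^-1.
Let s2 : s ^+ 2 = (2 * a)^-1.
Proof. by rewrite sqr_sqrtr// invr_ge0 mulr_ge0// ltW. Qed.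
Let s0 : s != 0.
Proof. by rewrite sqrtr_eq0 -ltNge invr_gt0 mulr_gt0. Qed.

Let pdfE : normal_pdf 0 s = fun x => (Num.sqrt (pi / a))^-1 * gauss a x.
Proof.
rewrite normal_pdfE//; apply/funext => x; congr (_ * _).
  rewrite /normal_peak s2; congr (Num.sqrt _)^-1; field; exact: lt0r_neq0.
rewrite /normal_fun s2 subr0 /gauss; congr expR; field; exact: lt0r_neq0.
Qed.

Let sq0 : 0 < Num.sqrt (pi / a) :> R.
Proof. by rewrite sqrtr_gt0 divr_gt0// pi_gt0. Qed.

Lemma integrable_gauss : mu.-integrable setT (EFin \o gauss a).
Proof.
have := integrableRZ measurableT (Num.sqrt (pi / a)) (integrable_normal_pdf 0 s).
by apply: eq_integrable => // x _ /=; rewrite pdfE mulVKf// gt_eqF.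
Qed.

Lemma integral_gauss : \int[mu]_x gauss a x = Num.sqrt (pi / a).
Proof.
have -> : gauss a = fun x => Num.sqrt (pi / a) * normal_pdf 0 s x.
  by apply/funext => x; rewrite pdfE mulVKf// gt_eqF.
rewrite RintegralZl//; last exact: integrable_normal_pdf.
by rewrite /Rintegral integral_normal_pdf//= mulr1.
Qed.

End gaussian_pos.

(** Half of the exponent absorbs the factor: [|x| <= (1 + 2 / a) * exp (a / 2 * x^2)]. The function
    serves as the majorant for differentiating the cosine transform. *)
Lemma integrable_normMgauss a : 0 < a -> mu.-integrable setT (EFin \o (fun x => `|x| * gauss a x)).
Proof.
move=> a0; have a20 : 0 < a / 2 by rewrite divr_gt0.
apply: (le_integrableR measurableT _ (integrableRZ measurableT (1 + 2 / a) (integrable_gauss a20))).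
  apply: measurable_funM; first exact: normr_measurable.
  by apply: continuous_measurable_fun; exact: continuous_gauss.
move=> x _; rewrite normrM normr_id (ger0_norm (ltW (gauss_gt0 _ _))).
have -> : gauss a x = expR (- (a / 2 * x ^+ 2)) * gauss (a / 2) x.
  by rewrite /gauss -expRD; congr expR; field.
rewrite mulrA ler_wpM2r ?(ltW (gauss_gt0 _ _))//.
rewrite expRN ler_pdivrMr ?expR_gt0//.
apply: le_trans (_ : _ <= (1 + 2 / a) * (1 + a / 2 * x ^+ 2)) _; last first.
  by rewrite ler_wpM2l ?expR_ge1Dx// addr_ge0// divr_ge0// ltW.
have -> : (1 + 2 / a) * (1 + a / 2 * x ^+ 2) = 1 + x ^+ 2 + (a / 2 * x ^+ 2 + 2 / a).
  by field; exact: lt0r_neq0.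
have h1 : 0 <= a / 2 * x ^+ 2 + 2 / a.
  apply: addr_ge0; last by rewrite divr_ge0// ltW.
  by rewrite mulr_ge0 ?sqr_ge0// ltW.
have h2 : 0 <= (`|x| - 1) ^+ 2 := sqr_ge0 _.
have h3 : `|x| ^+ 2 = x ^+ 2 := real_normK (num_real x).
have h4 := normr_ge0 x; rewrite -h3 in h1 *; nra.
Qed.

End gaussian.

Section gaussian_fourier.
Context {R : realType}.
Local Notation mu := (@lebesgue_measure R).
Variables (a : R) (a0 : 0 < a).

Lemma le_gauss_integrable (w f : R -> R) : measurable_fun setT f ->
  mu.-integrable setT (EFin \o w) -> (forall x, `|f x| <= w x) ->
  mu.-integrable setT (EFin \o f).
Proof. by move=> mf iw fw; apply: (@le_integrableR _ _ _ mu setT measurableT f w) => // x _. Qed.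

Lemma integrable_gauss_cos (k : R) : mu.-integrable setT (EFin \o (fun x => gauss a x * cos (k * x))).
Proof.
apply: (le_gauss_integrable _ (integrable_gauss a0)) => [|x].
  apply: measurable_funM; apply: continuous_measurable_fun.
  - exact: continuous_gauss.
  - exact: continuous_cos_lin.
rewrite normrM (ger0_norm (ltW (gauss_gt0 _ _))) ler_piMr ?(ltW (gauss_gt0 _ _))//.
by rewrite ler_norml cos_geN1 cos_le1.
Qed.

Lemma integrable_gauss_sin (k : R) : mu.-integrable setT (EFin \o (fun x => x * gauss a x * sin (k * x))).
Proof.
apply: (le_gauss_integrable _ (integrable_normMgauss a0)) => [|x].
  apply: measurable_funM; first apply: measurable_funM => //.
  - by apply: continuous_measurable_fun; exact: continuous_gauss.
  - by apply: continuous_measurable_fun; exact: continuous_sin_lin.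
rewrite normrM normrM (ger0_norm (ltW (gauss_gt0 _ _))) ler_piMr//.
  by rewrite mulr_ge0// ltW// gauss_gt0.
by rewrite ler_norml sin_geN1 sin_le1.
Qed.

(** That the derivative [P'] has integral zero is the integration by parts which expresses the sine
    integral in [der_phi] through [phi k]. *)
Let P (k x : R) := gauss a x * sin (k * x).

Let P' (k x : R) := k * (gauss a x * cos (k * x)) - 2 * a * (x * gauss a x * sin (k * x)).

Let der_P k x : is_derive x (1 : R) (P k) (P' k x).
Proof.
have -> : P' k x = gauss a x * (- (2 * a * x)) * sin (k * x) +
    gauss a x * (cos (k * x) * (0 * x + k * 1)) by rewrite /P'; ring.
apply: derM; first exact: der_gauss.
apply: (@der_comp R sin (fun x => k * x)).
exact: (derM (der_cst _ _) (der_id _)).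
Qed.

Let continuous_P' k : continuous (P' k).
Proof.
have cid : continuous (fun x : R => x) by move=> x; exact: cvg_id.
move=> x; apply: cvgB; (apply: cvgM; first exact: cvg_cst); apply: cvgM.
- exact: continuous_gauss.
- exact: continuous_cos_lin.
- by apply: cvgM; [exact: cid|exact: continuous_gauss].
- exact: continuous_sin_lin.
Qed.

Let cvg_P k : (fun N : nat => P k N%:R - P k (- N%:R)) @ \oo --> (0 : R).
Proof.
apply/cvgrPdist_le => e e0.
have [M _ HM] : exists2 M : nat, True & 2 / (a * e) <= M%:R.
  exists (Num.Def.archi_bound (2 / (a * e))) => //.
  by apply/ltW/archi_boundP; rewrite divr_ge0// mulr_ge0// ltW.
exists M.+1 => // N /= MN; rewrite sub0r normrN.
have N1 : 1 <= N%:R :> R by rewrite ler1n (leq_ltn_trans _ MN).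
have NM : M%:R <= N%:R :> R by rewrite ler_nat ltnW.
have gb : gauss a N%:R <= e / 2.
  rewrite /gauss expRN invf_ple ?posrE ?expR_gt0 ?divr_gt0//.
  apply: le_trans (expR_ge1Dx _); rewrite invf_div.
  have : 2 / e <= a * N%:R.
    by move: (le_trans HM NM); rewrite ler_pdivrMr ?mulr_gt0// ler_pdivrMr// => h; nra.
  have : a * N%:R <= a * N%:R ^+ 2 by rewrite ler_wpM2l ?(ltW a0)// expr2 ler_peMl// (le_trans _ N1).
  lra.
have Pb x : `|P k x| <= gauss a x.
  rewrite normrM (ger0_norm (ltW (gauss_gt0 _ _))) ler_piMr ?(ltW (gauss_gt0 _ _))//.
  by rewrite ler_norml sin_geN1 sin_le1.
have gN : gauss a (- N%:R) = gauss a N%:R by rewrite /gauss sqrrN.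
apply: le_trans (ler_normB _ _) _.
have := Pb N%:R; have := Pb (- N%:R); rewrite gN; lra.
Qed.

Let integrable_P' k : mu.-integrable setT (EFin \o P' k).
Proof.
apply: (integrableRB measurableT); apply: (integrableRZ measurableT).
  exact: integrable_gauss_cos.
exact: integrable_gauss_sin.
Qed.

Let integral_P' k : \int[mu]_x P' k x = 0.
Proof.
pose I (N : nat) : set R := `[- N.+1%:R, N.+1%:R]%classic.
have mI N : measurable (I N : set (measurableTypeR R)) by exact: measurable_itv.
have mP : measurable_fun setT (P' k) by apply: continuous_measurable_fun; exact: continuous_P'.
have H : (\int[mu]_x (P' k x * \1_(I n) x)%:E)%E @[n --> \oo] --> (\int[mu]_x (P' k x)%:E)%E.
  (* The wrapper selects the third conclusion of dominated convergence, the convergence of the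
     integrals. *)
  apply: (proj2 (proj2 (and3_rec (fun h1 h2 h3 => conj h1 (conj h2 h3)) (@dominated_convergence _ _ _ mu setT measurableT
    (fun N x => (P' k x * \1_(I N) x)%:E) (EFin \o P' k) (EFin \o (fun x => `|P' k x|)) _ _ _ _ _)))).
  - by move=> N; apply/measurable_EFinP; apply: measurable_funM.
  - exact/measurable_EFinP.
  - apply/aeW => x _; apply: cvg_near_cst; exists (Num.Def.archi_bound `|x|) => // N /= xN.
    rewrite indicE mem_set ?mulr1// /I/= in_itv/= -ler_norml.
    apply/ltW/(lt_le_trans (archi_boundP (normr_ge0 x))).
    by rewrite ler_nat (leq_trans xN).
  - have := integrable_P' k => /integrable_norm; exact.
  - apply/aeW => x N _ /=; rewrite lee_fin normrM ler_piMr// indicE ger0_norm//.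
    by case: (_ \in _).
have E N : (\int[mu]_x (P' k x * \1_(I N) x)%:E = (P k N.+1%:R - P k (- N.+1%:R))%:E)%E.
  have NN : - N.+1%:R < N.+1%:R :> R by rewrite gtrN.
  rewrite -(FTC2_der NN (der_P k) (@continuous_P' k)).
  have iP' : mu.-integrable (I N) (EFin \o P' k).
    by apply: integrableS (integrable_P' k).
  rewrite /Rintegral fineK; last exact: integrable_fin_num iP'.
  rewrite [RHS]integral_mkcond; apply: eq_integral => x _.
  rewrite /patch indicE; case: (x \in I N); first by rewrite mulr1.
  by rewrite mulr0.
have {}H : (P k N.+1%:R - P k (- N.+1%:R))%:E @[N --> \oo] --> (\int[mu]_x (P' k x)%:E)%E.
  by apply: cvg_trans H; apply: near_eq_cvg; near=> N; rewrite E.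
have H0 : (P k N.+1%:R - P k (- N.+1%:R))%:E @[N --> \oo] --> 0%:E.
  apply: cvg_EFin; first by near=> N.
  have := @cvg_P k; rewrite -(cvg_shiftS (fun N : nat => P k N%:R - P k (- N%:R))).
  exact.
by rewrite /Rintegral (cvg_unique _ H H0).
Unshelve. all: by end_near. Qed.

Let phi (k : R) := \int[mu]_x (gauss a x * cos (k * x)).

(** Differentiation under the integral gives a sine integral, which [integral_P'] turns back into
    [phi k]: a linear first-order equation. *)
Let der_phi k : is_derive k (1 : R) phi (- (k / (2 * a)) * phi k).
Proof.
pose f (k x : R) := gauss a x * cos (k * x).
have df j x : is_derive j (1 : R) (f^~ x) (- (x * gauss a x * sin (j * x))).
  have -> : - (x * gauss a x * sin (j * x)) =
    0 * cos (j * x) + gauss a x * (- sin (j * x) * (1 * x + j * 0)) by ring.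
  apply: (derM (der_cst _ _)).
  apply: (@der_comp R cos (fun k => k * x)).
  exact: (derM (der_id _) (der_cst _ _)).
have pf j x : partial1of2 f j x = - (x * gauss a x * sin (j * x)).
  by rewrite /partial1of2 derive1E; apply: derive_val.
have Ik : `]k - 1, k + 1[%classic k by rewrite /= in_itv/=; apply/andP; split; lra.
have i1 x : `]k - 1, k + 1[%classic x -> mu.-integrable setT (EFin \o f x).
  by move=> _; exact: integrable_gauss_cos.
have i2 j x : `]k - 1, k + 1[%classic j -> [set: R] x -> derivable (f^~ x) j 1.
  by move=> _ _; case: (df j x).
have G0 (x : R) : 0 <= `|x| * gauss a x by rewrite mulr_ge0// ltW// gauss_gt0.
have Gb j (x : R) : `]k - 1, k + 1[%classic j -> [set: R] x ->
    `|partial1of2 f j x| <= `|x| * gauss a x.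
  move=> _ _; rewrite pf normrN normrM normrM (ger0_norm (ltW (gauss_gt0 _ _))).
  by rewrite ler_piMr// ler_norml sin_geN1 sin_le1.
have D := @derivable_under_integral R _ _ mu f setT measurableT k _ _ Ik i1 i2 _ G0
  (integrable_normMgauss a0) Gb.
have V := @differentiation_under_integral R _ _ mu f setT measurableT k _ _ Ik i1 i2 _ G0
  (integrable_normMgauss a0) Gb.
apply: DeriveDef; first exact: D.
rewrite -derive1E V.
have J : - (\int[mu]_x (x * gauss a x * sin (k * x))) = - (k / (2 * a)) * phi k.
  have := integral_P' k; rewrite /P' RintegralB//; last 2 first.
  - by apply: (integrableRZ measurableT); exact: integrable_gauss_cos.
  - by apply: (integrableRZ measurableT); exact: integrable_gauss_sin.
  rewrite RintegralZl//; last exact: integrable_gauss_cos.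
  rewrite RintegralZl//; last exact: integrable_gauss_sin.
  rewrite -/(phi k) => /eqP; rewrite subr_eq0 => /eqP E.
  have a20 : 2 * a != 0 by rewrite mulf_neq0// lt0r_neq0.
  apply: (mulfI a20); rewrite mulrN -E; field; exact: lt0r_neq0.
rewrite -J; under eq_Rintegral do rewrite pf -mulN1r.
by rewrite RintegralZl ?mulN1r//; exact: integrable_gauss_sin.
Qed.

(** By the equation for [phi], the product of [phi] with the inverse Gaussian in [k] has derivative
    zero; its value at [0] is the Gaussian integral. *)
Lemma gauss_fourier (k : R) :
  \int[mu]_x (gauss a x * cos (k * x)) = Num.sqrt (pi / a) * expR (- (k ^+ 2 / (4 * a))).
Proof.
pose u (k : R) := phi k * expR (k ^+ 2 / (4 * a)).
have a40 : 4 * a != 0 by rewrite mulf_neq0// lt0r_neq0.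
have du j : is_derive j (1 : R) u 0.
  have -> : 0 = - (j / (2 * a)) * phi j * expR (j ^+ 2 / (4 * a)) +
    phi j * (expR (j ^+ 2 / (4 * a)) * ((1 * j + j * 1) * (4 * a)^-1 + (j * j) * 0)).
    by field; exact: lt0r_neq0.
  apply: derM; first exact: der_phi.
  apply: (@der_comp R expR (fun j => j ^+ 2 / (4 * a))).
  exact: (derM (derM (der_id _) (der_id _)) (der_cst _ _)).
have := @is_derive_0_is_cst R u k 0 du.
rewrite /u expr0n/= mul0r expR0 mulr1 /phi.
under [in X in _ = X -> _]eq_Rintegral do rewrite mul0r cos0 mulr1.
rewrite integral_gauss// => <-.
by rewrite -mulrA -expRD subrr expR0 mulr1.
Qed.

End gaussian_fourier.

Section unfolding.
Context {R : realType}.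
Local Notation mu := (@lebesgue_measure R).

Let A (k : int) : set R := `]- pi + (2 * pi) * k%:~R, pi + (2 * pi) * k%:~R]%classic.

Let AE (k : int) (x : R) : (x \in A k) = (k == cellrepz x).
Proof.
apply/idP/eqP => [|->].
  rewrite inE /A/= in_itv/= => /andP[h1 h2]; apply/esym/cellrep_eq.
  by rewrite /cell/= in_itv/=; apply/andP; split; lra.
have := cellrep_cell x; rewrite inE /cell /A /cellrep /= !in_itv/= => /andP[h1 h2].
by apply/andP; split; lra.
Qed.

(** The intervals [A k] tile the line, each point [x] lying in the one numbered [cellrepz x]. *)
Lemma integral_unfold (f : R -> R) : measurable_fun setT f -> (forall x, 0 <= f x) ->
  (\int[mu]_x (f x)%:E =
   \esum_(k in [set: int]) (\int[mu]_(x in cell) (f (x + (2 * pi) * k%:~R))%:E))%E.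
Proof.
move=> mf f0.
have mA k : measurable (A k : set (measurableTypeR R)) by exact: measurable_itv.
transitivity (\int[mu]_x (\esum_(k in [set: int]) ((EFin \o f) \_ (A k)) x))%E.
  apply: eq_integral => x _.
  transitivity (rsum (fun k => if k == cellrepz x then f x else 0))%:E.
    by rewrite rsum_pick.
  rewrite rsum_ge0EFin; last exact: rsummable_pick.
    by apply: eq_esum => k _; rewrite /patch AE; case: ifP.
  by move=> k; case: ifP.
rewrite ge0_integral_esum//.
- apply: eq_esum => k _; rewrite -integral_mkcond.
  rewrite -(@ge0_integral_shift _ _ _ _ (EFin \o f))//.
  exact/measurable_EFinP.
- move=> k; apply/(measurable_restrictT _ (mA k)).
  exact/measurable_funTS/measurable_EFinP.
- by move=> k x; rewrite /patch; case: ifP => // _; rewrite lee_fin.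
Qed.

Lemma ge0_integral_oppT (f : R -> \bar R) : measurable_fun setT f -> (forall x, 0 <= f x)%E ->
  (\int[mu]_x f (- x)%R = \int[mu]_x f x)%E.
Proof.
move=> mf f0.
have <- : (\int[pushforward mu (-%R : _ -> measurableTypeR R)]_x f x = \int[mu]_x f (- x)%R)%E.
  by rewrite ge0_integral_pushforward.
by apply: eq_measure_integral => //= B mB _; exact: lebesgue_measureN.
Qed.

End unfolding.

Section poisson.
Context {R : realType}.
Local Notation mu := (@lebesgue_measure R).
Variables (t : R) (t0 : 0 < t).

Let a : R := (4 * t)^-1.
Let a0 : 0 < a. Proof. by rewrite invr_gt0 mulr_gt0. Qed.

(** Jacobi's theta function in real form. Up to constants, [theta1] and [gsum1] are the
    one-dimensional heat kernel as a Fourier series and as a periodized Gaussian. *)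
Definition theta1 (x : R) : R := rsum (fun k : int => expR (- (t * k%:~R ^+ 2)) * cos (k%:~R * x)).

Definition gsum1 (x : R) : R := rsum (fun k : int => gauss a (x - (2 * pi) * k%:~R)).

Let st := rsummable_gauss t0.

Lemma theta1_le (k : int) (x : R) :
  `|expR (- (t * k%:~R ^+ 2)) * cos (k%:~R * x)| <= expR (- (t * k%:~R ^+ 2)).
Proof.
rewrite normrM ger0_norm ?expR_ge0// ler_piMr ?expR_ge0//.
by rewrite ler_norml cos_geN1 cos_le1.
Qed.

Lemma continuous_theta1 : continuous theta1.
Proof.
move=> x; apply: (cvg_rsum _ st).
- by move=> k; apply: cvgM; [exact: cvg_cst|exact: continuous_cos_lin].
- by apply: nearW => y k; exact: theta1_le.
- by move=> k; exact: theta1_le.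
Qed.

Lemma theta1_per : per1 theta1.
Proof.
move=> x m; rewrite /theta1; congr rsum; apply/funext => k; congr (_ * _).
by rewrite -[RHS](cosDpi2z _ (k * m)) intrM; congr cos; ring.
Qed.

(** A majorant uniform in [|x| <= B], for Tannery's theorem. It rests on [2 * pi^2 * k^2 <= (x - 2 *
    pi * k)^2 + x^2]. *)
Lemma gauss_shift_le (B x : R) (k : int) : `|x| <= B ->
  gauss a (x - (2 * pi) * k%:~R) <= expR (a * B ^+ 2) * expR (- (2 * a * pi ^+ 2 * k%:~R ^+ 2)).
Proof.
move=> xB; rewrite /gauss -expRD ler_expR.
have : x ^+ 2 <= B ^+ 2.
  rewrite -[x ^+ 2]real_normK ?num_real// lerXn2r ?nnegrE//.
  exact: le_trans xB.
move: (k%:~R : R) => j h.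
have h2 : 0 <= (2 * x - 2 * pi * j) ^+ 2 := sqr_ge0 _.
have : 2 * pi ^+ 2 * j ^+ 2 <= (x - 2 * pi * j) ^+ 2 + B ^+ 2 by lra.
move=> /(ler_wpM2l (ltW a0)); lra.
Qed.

Let sg (B : R) : rsummable (fun k : int => expR (a * B ^+ 2) * expR (- (2 * a * pi ^+ 2 * k%:~R ^+ 2))).
Proof.
apply: rsummableZ; apply: rsummable_gauss.
by apply: mulr_gt0; [exact: mulr_gt0|rewrite exprn_gt0// pi_gt0].
Qed.

Let gpos x (k : int) : `|gauss a (x - (2 * pi) * k%:~R)| = gauss a (x - (2 * pi) * k%:~R).
Proof. by rewrite ger0_norm// ltW// gauss_gt0. Qed.

Lemma rsummable_gsum1 x : rsummable (fun k : int => gauss a (x - (2 * pi) * k%:~R)).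
Proof. by apply: le_rsummable (sg `|x|) => k; rewrite gpos gauss_shift_le. Qed.

Lemma continuous_gsum1 : continuous gsum1.
Proof.
move=> x; apply: (cvg_rsum _ (sg (`|x| + 1))).
- move=> k; apply: continuous_comp; last exact: continuous_gauss.
  by apply: cvgB; [exact: cvg_id|exact: cvg_cst].
- exists 1 => //= y /= xy k; rewrite gpos gauss_shift_le//.
  have -> : y = x - (x - y) by ring.
  by apply: le_trans (ler_normB _ _) _; rewrite lerD2l ltW.
- by move=> k; rewrite gpos gauss_shift_le// lerDl.
Qed.

Lemma gsum1_per : per1 gsum1.
Proof.
move=> x m; rewrite /gsum1 (rsum_reindex (e := fun k : int => k + m)).
  by congr rsum; apply/funext => k /=; congr gauss; rewrite intrD; ring.
by exists (fun k => k - m) => k; rewrite ?addrK ?subrK.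
Qed.

(** For [m != 0], translation by [pi / m] preserves the integral and changes its sign. *)
Lemma cos_cell_integral (m : int) (theta : R) :
  \int[mu]_(x in cell) cos (m%:~R * x + theta) = if m == 0 then 2 * pi * cos theta else 0.
Proof.
have mc := @measurable_cell R.
case: eqP => [->|m0].
  under eq_Rintegral do rewrite mul0r add0r.
  rewrite Rintegral_cst// [X in fine X]lebesgue_cell/=; ring.
have cc : continuous (fun x : R => cos (m%:~R * x + theta)).
  move=> x; apply: continuous_comp; last exact: continuous_cos.
  by apply: cvgD; [exact: continuous_linear|exact: cvg_cst].
have mR : m%:~R != 0 :> R by rewrite intr_eq0; exact/eqP.
have : \int[mu]_(x in cell) cos (m%:~R * (x + pi / m%:~R) + theta) =
  \int[mu]_(x in cell) cos (m%:~R * x + theta).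
  apply: (@Rintegral_cell_shift R (fun x => cos (m%:~R * x + theta))).
    by move=> x k; rewrite -[RHS](cosDpi2z _ (m * k)) intrM; congr cos; ring.
  exact: continuous_measurable_fun.
have -> : \int[mu]_(x in cell) cos (m%:~R * (x + pi / m%:~R) + theta) =
    -1 * \int[mu]_(x in cell) cos (m%:~R * x + theta).
  rewrite -RintegralZl//; last exact: cell_integrable.
  apply: eq_Rintegral => x _.
  have -> : m%:~R * (x + pi / m%:~R) + theta = m%:~R * x + theta + pi by field.
  by rewrite cosDpi mulN1r.
by rewrite mulN1r; lra.
Qed.

Lemma theta1_fourier (j : int) (theta : R) :
  \int[mu]_(x in cell) (theta1 x * cos (j%:~R * x + theta)) =
  2 * pi * expR (- (t * j%:~R ^+ 2)) * cos theta.
Proof.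
have mc := @measurable_cell R.
have cl (m : int) (th : R) : continuous (fun x : R => cos (m%:~R * x + th)).
  move=> x; apply: continuous_comp; last exact: continuous_cos.
  by apply: cvgD; [exact: continuous_linear|exact: cvg_cst].
have E x : theta1 x * cos (j%:~R * x + theta) =
    rsum (fun k : int => expR (- (t * k%:~R ^+ 2)) * cos (k%:~R * x) * cos (j%:~R * x + theta)).
  rewrite mulrC /theta1 -rsumZ.
    by congr rsum; apply/funext => k; rewrite mulrC.
  by apply: le_rsummable st => k; exact: theta1_le.
under eq_Rintegral do rewrite E.
rewrite (Rintegral_rsum_in (M := fun k : int => expR (- (t * k%:~R ^+ 2))))//; last 3 first.
- exact: lebesgue_cell_lty.
- move=> k; apply: measurable_funTS; apply: continuous_measurable_fun => x.
  apply: cvgM; last exact: cl.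
  by apply: cvgM; [exact: cvg_cst|exact: continuous_cos_lin].
- move=> k x _; rewrite normrM -[leRHS]mulr1 ler_pM//; first exact: theta1_le.
  by rewrite ler_norml cos_geN1 cos_le1.
(* The frequencies [j] and [- j] contribute half of the result each, so that the formula also covers
   [j = 0], where they coincide. *)
have -> : (fun k : int => \int[mu]_(x in cell) (expR (- (t * k%:~R ^+ 2)) * cos (k%:~R * x) * cos (j%:~R * x + theta))) =
  (fun k : int => (if k == j then pi * expR (- (t * j%:~R ^+ 2)) * cos theta else 0) +
    (if k == - j then pi * expR (- (t * j%:~R ^+ 2)) * cos theta else 0)).
  apply/funext => k.
  transitivity (expR (- (t * k%:~R ^+ 2)) / 2 * (\int[mu]_(x in cell) cos ((k - j)%:~R * x + - theta) +
    \int[mu]_(x in cell) cos ((k + j)%:~R * x + theta))).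
    rewrite -RintegralD//; try exact: cell_integrable.
    rewrite -RintegralZl//; last first.
      by apply: integrableRD => //; exact: cell_integrable.
    apply: eq_Rintegral => x _; rewrite -mulrA cos_mulD !intrD mulrNz.
    rewrite (_ : k%:~R * x + (j%:~R * x + theta) = (k%:~R + j%:~R) * x + theta); last by ring.
    rewrite (_ : k%:~R * x - (j%:~R * x + theta) = (k%:~R - j%:~R) * x + - theta); last by ring.
    by ring.
  rewrite !cos_cell_integral cosN subr_eq0 addr_eq0.
  case: eqP => [->|_]; case: eqP => [E1|_]; rewrite ?addr0 ?add0r ?mulr0//.
  - by field.
  - by field.
  - by rewrite E1 mulrNz sqrrN; field.
rewrite rsumD; try exact: rsummable_pick.
by rewrite !rsum_pick; ring.
Qed.

Let cosl (k theta : R) : continuous (fun x : R => 1 + cos (k * x + theta)).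
Proof.
move=> x; apply: cvgD; first exact: cvg_cst.
apply: continuous_comp; last exact: continuous_cos.
by apply: cvgD; [exact: continuous_linear|exact: cvg_cst].
Qed.

Let cos1_ge0 (y : R) : 0 <= 1 + cos y.
Proof. by have := cos_geN1 y; lra. Qed.

(** The weight [1 + cos] is nonnegative, so sum and integral can be exchanged without further
    conditions; the constant is subtracted in [gsum1_fourier]. *)
Let gsum1_unfold (j : int) (theta : R) :
  \int[mu]_(x in cell) (gsum1 x * (1 + cos (j%:~R * x + theta))) =
  \int[mu]_x (gauss a x * (1 + cos (j%:~R * x + theta))).
Proof.
rewrite /Rintegral; congr fine.
have mg : measurable_fun setT (fun x : R => gauss a x * (1 + cos (j%:~R * x + theta))).
  by apply: continuous_measurable_fun => x; apply: cvgM; [exact: continuous_gauss|exact: cosl].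
have g0 x : 0 <= gauss a x * (1 + cos (j%:~R * x + theta)).
  by rewrite mulr_ge0// ltW// gauss_gt0.
rewrite (integral_unfold mg g0).
transitivity (\int[mu]_(x in cell) (\esum_(k in [set: int])
    (gauss a (x - (2 * pi) * k%:~R) * (1 + cos (j%:~R * x + theta)))%:E))%E.
  apply: eq_integral => x _; under eq_esum do rewrite mulrC.
  rewrite esumZl_EFin//; last by move=> k; exact/ltW/gauss_gt0.
  rewrite -rsum_ge0EFin; first by rewrite -EFinM mulrC.
    by move=> k; exact/ltW/gauss_gt0.
  exact: rsummable_gsum1.
rewrite ge0_integral_esum//; last 3 first.
- exact: measurable_cell.
- move=> k; apply/measurable_EFinP/measurable_funTS; apply: continuous_measurable_fun => x.
  apply: cvgM; last exact: cosl.
  apply: continuous_comp; last exact: continuous_gauss.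
  by apply: cvgB; [exact: cvg_id|exact: cvg_cst].
- by move=> k x; rewrite lee_fin mulr_ge0// ltW// gauss_gt0.
rewrite (reindex_esum [set: int] _ -%R); last first.
  by split => // [x y _ _ /oppr_inj//|y _]; exists (- y); rewrite ?opprK.
apply: eq_esum => k _; apply: eq_integral => x _; congr EFin.
congr (gauss a _ * (1 + _)); first by rewrite mulrNz; ring.
by rewrite -[LHS](cosDpi2z _ (j * k)) intrM; congr cos; ring.
Qed.

(** Adding the integral with [x] replaced by [- x] cancels the odd part and leaves the cosine
    transform. *)
Let gauss_cos_phase (j theta : R) :
  \int[mu]_x (gauss a x * (1 + cos (j * x + theta))) =
  Num.sqrt (pi / a) * (1 + expR (- (j ^+ 2 / (4 * a))) * cos theta).
Proof.
have ig := integrable_gauss a0.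
have mT := @measurableT _ (measurableTypeR R).
have ic (k th : R) : mu.-integrable setT (EFin \o (fun x => gauss a x * (1 + cos (k * x + th)))).
  apply: (@le_gauss_integrable _ (fun x => 2 * gauss a x)).
  - by apply: continuous_measurable_fun => x; apply: cvgM; [exact: continuous_gauss|exact: cosl].
  - exact: integrableRZ.
  - move=> x; rewrite ger0_norm; last by rewrite mulr_ge0// ltW// gauss_gt0.
    rewrite mulrC ler_wpM2r ?(ltW (gauss_gt0 _ _))//.
    by have := cos_le1 (k * x + th); lra.
have E : \int[mu]_x (gauss a x * (1 + cos (j * x + theta))) =
   \int[mu]_x (gauss a x * (1 + cos (- j * x + theta))).
  rewrite /Rintegral; congr fine.
  rewrite -(@ge0_integral_oppT _ (fun x => (gauss a x * (1 + cos (j * x + theta)))%:E)).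
  - by apply: eq_integral => x _; rewrite /gauss sqrrN mulrN mulNr.
  - by apply/measurable_EFinP; apply: continuous_measurable_fun => x; apply: cvgM; [exact: continuous_gauss|exact: cosl].
  - by move=> x; rewrite lee_fin mulr_ge0// ltW// gauss_gt0.
have ij := ic j theta; have iNj := ic (- j) theta.
have igc := integrable_gauss_cos a0 j.
have : \int[mu]_x (gauss a x * (1 + cos (j * x + theta))) +
   \int[mu]_x (gauss a x * (1 + cos (- j * x + theta))) =
   2 * Num.sqrt (pi / a) + 2 * cos theta * \int[mu]_x (gauss a x * cos (j * x)).
  rewrite -integral_gauss// -RintegralD// -!RintegralZl// -RintegralD//.
  - apply: eq_Rintegral => x _; rewrite mulNr !cosD cosN sinN; ring.
  - exact: integrableRZ.
  - exact: integrableRZ.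
rewrite -E gauss_fourier//; move: (Rintegral _ _ _) (Num.sqrt _) (expR _) (cos theta).
by move=> A S e c H; lra.
Qed.

Lemma gsum1_fourier (j : int) (theta : R) :
  \int[mu]_(x in cell) (gsum1 x * cos (j%:~R * x + theta)) =
  Num.sqrt (pi / a) * expR (- (t * j%:~R ^+ 2)) * cos theta.
Proof.
have mc := @measurable_cell R.
have icg (k th : R) : mu.-integrable cell (EFin \o (fun x => gsum1 x * (1 + cos (k * x + th)))).
  by apply: cell_integrable => x; apply: cvgM; [exact: continuous_gsum1|exact: cosl].
(* With frequency [0] and phase [pi / 2] the cosine vanishes, so [H0] gives the integral of [gsum1]
   itself. *)
have H1 := gsum1_unfold j theta; have H0 := gsum1_unfold 0 (pi / 2).
rewrite !gauss_cos_phase cos_pihalf mulr0 addr0 mulr1 in H1 H0.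
have i1 := icg j%:~R theta; have i0 := icg 0 (pi / 2).
transitivity (\int[mu]_(x in cell) (gsum1 x * (1 + cos (j%:~R * x + theta))) -
  \int[mu]_(x in cell) (gsum1 x * (1 + cos (0 * x + pi / 2)))).
  rewrite -RintegralB//; apply: eq_Rintegral => x _.
  by rewrite mul0r add0r cos_pihalf; ring.
rewrite H1 [X in _ - X]H0.
have -> : j%:~R ^+ 2 / (4 * a) = t * j%:~R ^+ 2.
  by rewrite /a; field; exact: lt0r_neq0.
by ring.
Qed.

Lemma poisson1 (x : R) : theta1 x = Num.sqrt (pi / t) * gsum1 x.
Proof.
have mc := @measurable_cell R.
(* This matches the Fourier coefficients of the two sides; recall that [a] is [(4 * t)^-1]. *)
have sq : 2 * pi = Num.sqrt (pi / t) * Num.sqrt (pi / a).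
  have p0 := pi_ge0 R.
  rewrite -sqrtrM; last by rewrite divr_ge0// ltW.
  have -> : pi / t * (pi / a) = (2 * pi) ^+ 2 by rewrite /a; field; exact: lt0r_neq0.
  by rewrite sqrtr_sqr ger0_norm// mulr_ge0.
apply/eqP; rewrite -subr_eq0; apply/eqP.
apply: (@fourier_unique R (fun x => theta1 x - Num.sqrt (pi / t) * gsum1 x)).
- move=> y; apply: cvgB; first exact: continuous_theta1.
  by apply: cvgM; [exact: cvg_cst|exact: continuous_gsum1].
- by move=> y m; rewrite theta1_per gsum1_per.
- move=> k theta.
  have cl : continuous (fun x : R => cos (k%:~R * x + theta)).
    move=> y; apply: continuous_comp; last exact: continuous_cos.
    by apply: cvgD; [exact: continuous_linear|exact: cvg_cst].
  transitivity (\int[mu]_(y in cell) (theta1 y * cos (k%:~R * y + theta)) -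
     Num.sqrt (pi / t) * \int[mu]_(y in cell) (gsum1 y * cos (k%:~R * y + theta))).
    have i2 : mu.-integrable cell (EFin \o (fun y => gsum1 y * cos (k%:~R * y + theta))).
      by apply: cell_integrable => y; apply: cvgM; [exact: continuous_gsum1|exact: cl].
    rewrite -RintegralZl// -RintegralB//.
    + by apply: eq_Rintegral => y _; ring.
    + by apply: cell_integrable => y; apply: cvgM; [exact: continuous_theta1|exact: cl].
    + exact: integrableRZ.
  rewrite theta1_fourier gsum1_fourier sq; ring.
Qed.

End poisson.

Section continuity.
Context {R : realType} {T : topologicalType}.
Implicit Types f g : T -> R.

Lemma contM f g : continuous f -> continuous g -> continuous (fun x => f x * g x).
Proof. by move=> cf cg x; apply: cvgM; [exact: cf|exact: cg]. Qed.

Lemma contD f g : continuous f -> continuous g -> continuous (fun x => f x + g x).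
Proof. by move=> cf cg x; apply: cvgD; [exact: cf|exact: cg]. Qed.

Lemma contB f g : continuous f -> continuous g -> continuous (fun x => f x - g x).
Proof. by move=> cf cg x; apply: cvgB; [exact: cf|exact: cg]. Qed.

Lemma contC (c : R) : continuous (fun _ : T => c).
Proof. by move=> x; exact: cvg_cst. Qed.

Lemma cont_comp (h : R -> R) f : continuous f -> continuous h -> continuous (fun x => h (f x)).
Proof. by move=> cf ch x; apply: continuous_comp; [exact: cf|exact: ch]. Qed.

End continuity.

(** * The heat kernel on the torus *)

Section row_cons.
Context {T : Type} {n : nat}.

Definition consv (a : T) (v : 'rV[T]_n) : 'rV[T]_n.+1 :=
  \row_i (if unlift ord0 i is Some j then v 0 j else a).

Definition tailv (v : 'rV[T]_n.+1) : 'rV[T]_n := \row_j v 0 (lift ord0 j).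

Lemma consv0 a v : consv a v 0 ord0 = a.
Proof. by rewrite mxE unlift_none. Qed.

Lemma consvS a v j : consv a v 0 (lift ord0 j) = v 0 j.
Proof. by rewrite mxE liftK. Qed.

Lemma consvK a v : tailv (consv a v) = v.
Proof. by apply/rowP => j; rewrite mxE consvS. Qed.

Lemma tailvK (v : 'rV[T]_n.+1) : consv (v 0 ord0) (tailv v) = v.
Proof.
apply/rowP => i; case: (unliftP ord0 i) => [j ->|->]; last by rewrite consv0.
by rewrite consvS mxE.
Qed.

Lemma consv_bij : bijective (fun p : T * 'rV[T]_n => consv p.1 p.2).
Proof.
exists (fun v : 'rV[T]_n.+1 => (v 0 ord0, tailv v)) => [[a v]|v] /=; last exact: tailvK.
by rewrite consv0 consvK.
Qed.

End row_cons.

Section lattice_products.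
Context {R : realType}.

Lemma rsum_prod n (u : 'I_n -> int -> R) : (forall i, rsummable (u i)) ->
  rsummable (fun nu : 'rV[int]_n => \prod_i u i (nu 0 i)) /\
  rsum (fun nu : 'rV[int]_n => \prod_i u i (nu 0 i)) = \prod_i rsum (u i).
Proof.
elim: n u => [|n IH] u su.
  have E : (fun nu : 'rV[int]_0 => \prod_i u i (nu 0 i)) =
      (fun nu => if nu == 0 then 1 else 0).
    by apply/funext => nu; rewrite big_ord0 thinmx0 eqxx.
  by rewrite E big_ord0; split; [exact: rsummable_pick|rewrite rsum_pick].
have [sn En] := IH (fun i => u (lift ord0 i)) (fun i => su _).
pose f (nu : 'rV[int]_n.+1) := \prod_i u i (nu 0 i).
have fE : f \o (fun p : int * 'rV[int]_n => consv p.1 p.2) =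
    (fun p => u ord0 p.1 * \prod_i u (lift ord0 i) (p.2 0 i)).
  apply/funext => -[k nu] /=; rewrite /f big_ord_recl consv0; congr (_ * _).
  by apply: eq_bigr => i _; rewrite consvS.
split.
  by apply/(rsummable_reindex f consv_bij); rewrite fE; exact: (rsummableM (su ord0) sn).
by rewrite (rsum_reindex f consv_bij) fE (rsumM (su ord0) sn) En big_ord_recl.
Qed.

Lemma dotE n (x y : 'rV[R]_n) : dot x y = \sum_i x 0 i * y 0 i.
Proof. by []. Qed.

Lemma enorm_sqr n (x : 'rV[R]_n) : enorm x ^+ 2 = \sum_i x 0 i ^+ 2.
Proof.
rewrite /enorm sqr_sqrtr; last by apply: sumr_ge0 => i _; rewrite -expr2 sqr_ge0.
by apply: eq_bigr => i _; rewrite expr2.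
Qed.

Lemma expR_sum n (u : 'I_n -> R) : expR (\sum_i u i) = \prod_i expR (u i).
Proof. by apply: (big_morph expR (@expRD R) (@expR0 R)). Qed.

Lemma gauss_prod n (a : R) (x : 'rV[R]_n) :
  expR (- (a * enorm x ^+ 2)) = \prod_i gauss a (x 0 i).
Proof. by rewrite enorm_sqr mulr_sumr -sumrN expR_sum. Qed.

Lemma rsummable_heat n (t : R) : 0 < t ->
  rsummable (fun nu : 'rV[int]_n => expR (- (t * enorm (ivec R nu) ^+ 2))).
Proof.
move=> t0; have [+ _] := rsum_prod (fun i : 'I_n => rsummable_gauss t0).
congr rsummable; apply/funext => nu; rewrite gauss_prod.
by apply: eq_bigr => i _; rewrite /ivec mxE.
Qed.

Lemma rsummable_prod_inv_sqr n :
  rsummable (fun nu : 'rV[int]_n => (\prod_i (1 + (nu 0 i)%:~R ^+ 2 : R))^-1).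
Proof.
have [+ _] := rsum_prod (fun i : 'I_n => @rsummable_inv_sqr R).
by congr rsummable; apply/funext => nu; rewrite prodfV.
Qed.

Lemma rsummable_gaussN n (t : R) (x : 'rV[R]_n) : 0 < t ->
  rsummable (fun nu : 'rV[int]_n => expR (- ((4 * t)^-1 * enorm (x - (2 * pi) *: ivec R nu) ^+ 2))) /\
  rsum (fun nu : 'rV[int]_n => expR (- ((4 * t)^-1 * enorm (x - (2 * pi) *: ivec R nu) ^+ 2)))
  = \prod_i gsum1 t (x 0 i).
Proof.
move=> t0; have [] := rsum_prod (fun i : 'I_n => rsummable_gsum1 t0 (x 0 i)).
have E : (fun nu : 'rV[int]_n => \prod_i gauss (4 * t)^-1 (x 0 i - 2 * pi * (nu 0 i)%:~R)) =
   (fun nu : 'rV[int]_n => expR (- ((4 * t)^-1 * enorm (x - (2 * pi) *: ivec R nu) ^+ 2))).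
  apply/funext => nu; rewrite gauss_prod; apply: eq_bigr => i _; congr gauss.
  by rewrite !mxE.
by rewrite E.
Qed.

Lemma rsum_odd n (u : 'rV[int]_n -> R) : rsummable u -> (forall nu, u (- nu) = - u nu) ->
  rsum u = 0.
Proof.
move=> su uN; have bN : bijective (-%R : 'rV[int]_n -> 'rV[int]_n).
  by exists -%R; exact: opprK.
have : rsum u = - rsum u.
  rewrite {1}(rsum_reindex u bN) -rsumN//; congr rsum.
  by apply/funext => nu; rewrite /= uN.
lra.
Qed.

Lemma rsum_odd1 (u : int -> R) : rsummable u -> (forall k, u (- k) = - u k) ->
  rsum u = 0.
Proof.
move=> su uN; have bN : bijective (-%R : int -> int) by exists -%R; exact: opprK.
have : rsum u = - rsum u.
  rewrite {1}(rsum_reindex u bN) -rsumN//; congr rsum.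
  by apply/funext => k; rewrite /= uN.
lra.
Qed.

Lemma ivecN n (nu : 'rV[int]_n) : ivec R (- nu) = - ivec R nu.
Proof. by apply/rowP => i; rewrite !mxE mulrNz. Qed.

Lemma dotNl n (x y : 'rV[R]_n) : dot (- x) y = - dot x y.
Proof. by rewrite /dot -sumrN; apply: eq_bigr => i _; rewrite mxE mulNr. Qed.

Lemma dotNr n (x y : 'rV[R]_n) : dot x (- y) = - dot x y.
Proof. by rewrite /dot -sumrN; apply: eq_bigr => i _; rewrite mxE mulrN. Qed.

Lemma dotDl n (x y z : 'rV[R]_n) : dot (x + y) z = dot x z + dot y z.
Proof. by rewrite /dot -big_split/=; apply: eq_bigr => i _; rewrite mxE mulrDl. Qed.

Lemma dotDr n (x y z : 'rV[R]_n) : dot z (x + y) = dot z x + dot z y.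
Proof. by rewrite /dot -big_split/=; apply: eq_bigr => i _; rewrite mxE mulrDr. Qed.

Lemma dotZr n (c : R) (x y : 'rV[R]_n) : dot x (c *: y) = c * dot x y.
Proof. by rewrite /dot mulr_sumr; apply: eq_bigr => i _; rewrite mxE mulrCA. Qed.

Lemma enormN n (x : 'rV[R]_n) : enorm (- x) = enorm x.
Proof. by rewrite /enorm dotNl dotNr opprK. Qed.

Lemma cosDpi2_ivec n (nu mu : 'rV[int]_n) (y : R) :
  cos (y + dot (ivec R nu) ((2 * pi) *: ivec R mu)) = cos y.
Proof.
rewrite dotZr -[RHS](cosDpi2z y (\sum_i nu 0 i * mu 0 i)); congr (cos (_ + _ * _)).
by rewrite /dot rmorph_sum; apply: eq_bigr => i _; rewrite rmorphM !mxE.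
Qed.

Lemma norm_heat_cos_le n (t theta : R) (nu : 'rV[int]_n) x :
  `|expR (- (t * enorm (ivec R nu) ^+ 2)) * cos (dot (ivec R nu) x + theta)| <=
  expR (- (t * enorm (ivec R nu) ^+ 2)).
Proof.
rewrite normrM ger0_norm ?expR_ge0// ler_piMr ?expR_ge0//.
by rewrite ler_norml cos_geN1 cos_le1.
Qed.

Lemma heat_kernel_rsum n (t : R) (x : 'rV[R]_n) : heat_kernel t x =
  ((2 * pi) ^+ n)^-1 *
  rsum (fun nu : 'rV[int]_n => expR (- (t * enorm (ivec R nu) ^+ 2)) * cos (dot (ivec R nu) x)).
Proof.
rewrite /heat_kernel /= mul0r subr0; congr (_ * rsum _); apply/funext => nu /=.
by rewrite mul0r subr0.
Qed.

(** Induction on the dimension: the addition formula splits off one coordinate, and the product of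
    sines drops out because the one-dimensional sine series is odd. *)
Lemma theta_prod n (t : R) (x : 'rV[R]_n) : 0 < t ->
  rsum (fun nu : 'rV[int]_n => expR (- (t * enorm (ivec R nu) ^+ 2)) * cos (dot (ivec R nu) x)) =
  \prod_i theta1 t (x 0 i).
Proof.
move=> t0; elim: n x => [|n IH] x.
  rewrite big_ord0 -[RHS](rsum_pick (0 : 'rV[int]_0)).
  congr rsum; apply/funext => nu; rewrite (thinmx0 nu) eqxx /dot big_ord0 cos0 mulr1.
  by rewrite enorm_sqr big_ord0 mulr0 oppr0 expR0.
pose f (nu : 'rV[int]_n.+1) :=
  expR (- (t * enorm (ivec R nu) ^+ 2)) * cos (dot (ivec R nu) x).
rewrite -/f (rsum_reindex f consv_bij).
pose e1 (k : int) := expR (- (t * k%:~R ^+ 2)) : R.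
pose e (nu : 'rV[int]_n) := expR (- (t * enorm (ivec R nu) ^+ 2)) : R.
have fE : f \o (fun p : int * 'rV[int]_n => consv p.1 p.2) =
    (fun p => (e1 p.1 * cos (p.1%:~R * x 0 ord0)) * (e p.2 * cos (dot (ivec R p.2) (tailv x))) -
     (e1 p.1 * sin (p.1%:~R * x 0 ord0)) * (e p.2 * sin (dot (ivec R p.2) (tailv x)))).
  apply/funext => -[k nu] /=; rewrite /f !enorm_sqr [dot _ x]dotE !big_ord_recl.
  rewrite (_ : ivec R (consv k nu) 0 ord0 = k%:~R); last by rewrite mxE consv0.
  rewrite (_ : \sum_i ivec R (consv k nu) 0 (lift ord0 i) ^+ 2 = \sum_i ivec R nu 0 i ^+ 2); last first.
    by apply: eq_bigr => i _; rewrite mxE consvS mxE.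
  rewrite (_ : \sum_i ivec R (consv k nu) 0 (lift ord0 i) * x 0 (lift ord0 i) =
     dot (ivec R nu) (tailv x)); last first.
    by apply: eq_bigr => i _; rewrite !mxE liftK.
  rewrite mulrDr opprD expRD cosD -enorm_sqr /e1 /e; ring.
have s1 := rsummable_gauss t0; have sn := @rsummable_heat n t t0.
have s1c : rsummable (fun k : int => e1 k * cos (k%:~R * x 0 ord0)).
  by apply: le_rsummable s1 => k; exact: theta1_le.
have s1s : rsummable (fun k : int => e1 k * sin (k%:~R * x 0 ord0)).
  apply: le_rsummable s1 => k; rewrite normrM ger0_norm ?expR_ge0// ler_piMr ?expR_ge0//.
  by rewrite ler_norml sin_geN1 sin_le1.
have snc : rsummable (fun nu => e nu * cos (dot (ivec R nu) (tailv x))).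
  by apply: le_rsummable sn => nu; have := norm_heat_cos_le t 0 nu (tailv x); rewrite addr0.
have sns : rsummable (fun nu => e nu * sin (dot (ivec R nu) (tailv x))).
  apply: le_rsummable sn => k; rewrite normrM ger0_norm ?expR_ge0// ler_piMr ?expR_ge0//.
  by rewrite ler_norml sin_geN1 sin_le1.
rewrite fE rsumB; [|exact: (rsummableM s1c snc)|exact: (rsummableM s1s sns)].
rewrite (rsumM s1c snc) (rsumM s1s sns) [X in _ - X * _](rsum_odd1 s1s); last first.
  by move=> k; rewrite /e1 mulrNz sqrrN mulNr sinN mulrN.
rewrite mul0r subr0 IH big_ord_recl; congr (_ * _).
by apply: eq_bigr => i _; rewrite mxE.
Qed.

(** The factor raised to the power [n] is [(4 * pi * t)^(-1/2)]. *)
Lemma heat_kernel_gauss n (t : R) (x : 'rV[R]_n) : 0 < t ->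
  heat_kernel t x = (((2 * pi)^-1 * Num.sqrt (pi / t)) ^+ n) *
  rsum (fun nu : 'rV[int]_n => expR (- ((4 * t)^-1 * enorm (x - (2 * pi) *: ivec R nu) ^+ 2))).
Proof.
move=> t0; rewrite heat_kernel_rsum theta_prod//.
have [_ ->] := rsummable_gaussN x t0.
under eq_bigr do rewrite poisson1//.
by rewrite big_split/= prodr_const card_ord [in RHS]exprMn exprVn mulrA.
Qed.

(** Positivity is invisible in the Fourier series; it is read off the Gaussian form. *)
Lemma heat_kernel_ge0 n (t : R) (x : 'rV[R]_n) : 0 < t -> 0 <= heat_kernel t x.
Proof.
move=> t0; rewrite heat_kernel_gauss// mulr_ge0//.
  by rewrite exprn_ge0// mulr_ge0 ?invr_ge0 ?mulr_ge0 ?pi_ge0.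
by apply: rsum_ge0 => nu; exact: expR_ge0.
Qed.

Lemma heat_kernelN n (t : R) (x : 'rV[R]_n) : heat_kernel t (- x) = heat_kernel t x.
Proof.
rewrite !heat_kernel_rsum; congr (_ * rsum _); apply/funext => nu.
by rewrite dotNr cosN.
Qed.

Lemma continuous_dot n (v : 'rV[R]_n) : continuous (dot v).
Proof.
move=> x; rewrite /dot.
have H : forall s : seq 'I_n, continuous (fun y : 'rV[R]_n => \sum_(i <- s) v 0 i * y 0 i).
  elim=> [|i s IH].
    by under eq_fun do rewrite big_nil; exact: contC.
  under eq_fun do rewrite big_cons.
  apply: contD => //; apply: contM; first exact: contC.
  exact: coord_continuous.
exact: H.
Qed.

Lemma continuous_cos_dot n (v : 'rV[R]_n) (theta : R) : continuous (fun x => cos (dot v x + theta)).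
Proof.
apply: (cont_comp _ (@continuous_cos R)).
by apply: contD; [exact: continuous_dot|exact: contC].
Qed.

Lemma Rn_int_cos n (kappa : 'rV[int]_n) (theta : R) :
  Rn_int Q (fun x : 'rV[R]_n => cos (dot (ivec R kappa) x + theta)) =
  if kappa == 0 then (2 * pi) ^+ n * cos theta else 0.
Proof.
case: eqP => [->|/eqP k0].
  transitivity (Rn_int (Q : set 'rV[R]_n) (fun=> cos theta)).
    congr Rn_int; apply/funext => x; congr cos.
    by rewrite /dot big1 ?add0r// => i _; rewrite !mxE mul0r.
  rewrite /Rn_int Rintegral_cst; last exact: measurable_Qt.
  by rewrite [X in fine X]lebesgue_tuple_Qt mulrC.
have [i ki] : exists i, kappa 0 i != 0.
  apply/existsP; apply: contraNT k0; rewrite negb_exists => /forallP H.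
  by apply/eqP/rowP => i; rewrite mxE; apply/eqP; rewrite -[_ == _]negbK H.
pose f (x : 'rV[R]_n) := cos (dot (ivec R kappa) x + theta).
(* Translation by half a period along a coordinate where [kappa] does not vanish changes the sign of
   the integrand. *)
pose a : 'rV[R]_n := (pi / (kappa 0 i)%:~R) *: delta_mx 0 i.
have cf : continuous f := continuous_cos_dot (v := ivec R kappa) (theta := theta).
have mf := continuous_mfunR cf.
have pf : Defs.periodic f.
  by move=> x nu; rewrite /f dotDr addrAC cosDpi2_ivec.
have := Rn_int_shift a pf mf.
have -> : (fun x => f (x + a)) = (fun x => - f x).
  apply/funext => x; rewrite /f dotDr addrAC.
  have -> : dot (ivec R kappa) a = pi.
    rewrite /a dotZr /dot (bigD1 i)//= big1 ?addr0; last first.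
      by move=> j ji; rewrite !mxE (negbTE ji) andbF mulr0.
    by rewrite !mxE !eqxx mulr1 divfK// intr_eq0.
  by rewrite cosDpi.
have fi : Rn_integrable Q f.
  by apply: (bounded_Rn_integrable (c := 1) mf) => x _; rewrite ler_norml cos_geN1 cos_le1.
have -> : Rn_int Q (fun x => - f x) = - Rn_int Q f.
  rewrite /Rn_int -mulN1r -RintegralZl//; last exact: measurable_Qt.
  by apply: eq_Rintegral => u _; rewrite mulN1r.
by rewrite -/f; lra.
Qed.

Lemma Rn_int_heat_cos n (t : R) (nu : 'rV[int]_n) : 0 < t ->
  Rn_int Q (fun x : 'rV[R]_n => heat_kernel t x * cos (dot (ivec R nu) x)) =
  expR (- (t * enorm (ivec R nu) ^+ 2)).
Proof.
move=> t0; have mQ := @measurable_Qt R n.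
pose c : R := ((2 * pi) ^+ n)^-1.
pose e (mu : 'rV[int]_n) := expR (- (t * enorm (ivec R mu) ^+ 2)) : R.
have se : rsummable e := @rsummable_heat n t t0.
have c0 : 0 <= c by rewrite invr_ge0 exprn_ge0// mulr_ge0// pi_ge0.
have E x : heat_kernel t x * cos (dot (ivec R nu) x) =
    rsum (fun mu => c * e mu * cos (dot (ivec R mu) x) * cos (dot (ivec R nu) x)).
  rewrite heat_kernel_rsum -/c mulrAC -rsumZ.
    by congr rsum; apply/funext => mu; rewrite /e; ring.
  by apply: le_rsummable se => mu; have := norm_heat_cos_le t 0 mu x; rewrite addr0.
rewrite /Rn_int; under eq_Rintegral do rewrite E.
have cosb (y : R) : `|cos y| <= 1 by rewrite ler_norml cos_geN1 cos_le1.
have ccd v : continuous (fun x : 'rV[R]_n => cos (dot v x)).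
  by have := @continuous_cos_dot n v 0; under eq_fun do rewrite addr0.
rewrite (Rintegral_rsum (M := fun mu => c * e mu))//; last 4 first.
- exact: lebesgue_tuple_Qt_lty.
- move=> mu; apply: measurable_funTS.
  apply: (@continuous_mfunR R n (fun x => c * e mu * cos (dot (ivec R mu) x) * cos (dot (ivec R nu) x))).
  by apply: contM; [apply: contM; [exact: contC|exact: ccd]|exact: ccd].
- move=> mu x; rewrite 2!normrM (ger0_norm (mulr_ge0 c0 (expR_ge0 _))) -mulrA.
  by rewrite ler_piMr ?mulr_ge0 ?expR_ge0// -[leRHS]mulr1 ler_pM.
- exact: rsummableZ.
have -> : (fun mu => \int[lebesgue_tuple R n]_(x in row_of (n:=n) @^-1` Q)
    (c * e mu * cos (dot (ivec R mu) (row_of x)) * cos (dot (ivec R nu) (row_of x)))) =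
  (fun mu => (if mu == nu then e nu / 2 else 0) + (if mu == - nu then e nu / 2 else 0)).
  apply/funext => mu.
  have fi v th : Rn_integrable Q (fun x : 'rV[R]_n => cos (dot (ivec R v) x + th)).
    by apply: (bounded_Rn_integrable (c := 1)) => //; apply: continuous_mfunR; exact: continuous_cos_dot.
  transitivity (c * e mu / 2 * (Rn_int Q (fun x : 'rV[R]_n => cos (dot (ivec R (mu - nu)) x + 0)) +
     Rn_int Q (fun x : 'rV[R]_n => cos (dot (ivec R (mu + nu)) x + 0)))).
    rewrite /Rn_int -RintegralD//; [|exact: fi|exact: fi].
    rewrite -RintegralZl//; last by apply: integrableRD => //; exact: fi.
    apply: eq_Rintegral => u _; rewrite -[LHS]mulrA cos_mulD !addr0.
    have -> : ivec R (mu - nu) = ivec R mu - ivec R nu by apply/rowP => i; rewrite !mxE intrD mulrNz.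
    have -> : ivec R (mu + nu) = ivec R mu + ivec R nu by apply/rowP => i; rewrite !mxE intrD.
    by rewrite !dotDl dotNl; ring.
  have pn0 : (2 * pi : R) ^+ n != 0 by rewrite expf_neq0// mulf_neq0// gt_eqF// pi_gt0.
  rewrite !Rn_int_cos subr_eq0 addr_eq0 cos0 /c.
  case: eqP => [->|_]; case: eqP => [E1|_]; rewrite ?addr0 ?add0r ?mulr0//.
  - by field.
  - by field.
  - have -> : e mu = e nu by rewrite E1 /e ivecN enormN.
    by field.
rewrite rsumD; [|exact: rsummable_pick|exact: rsummable_pick].
by rewrite !rsum_pick -/(e nu); field.
Qed.

End lattice_products.

(** * Gamma integrals and the kernel *)

Section gamma.
Context {R : realType}.
Local Notation mu := (@lebesgue_measure R).
Local Notation I0 := (`]0, +oo[%classic : set R).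
Implicit Types (b c s t x y u q lambda : R).

Lemma ge0_integralZlR d (T : measurableType d) (nu : {measure set T -> \bar R}) (D : set T)
    (k : R) (f : T -> R) :
  measurable D -> measurable_fun D f -> (forall x : T, D x -> 0 <= f x) -> 0 <= k ->
  (\int[nu]_(x in D) (k * f x)%:E = k%:E * \int[nu]_(x in D) (f x)%:E)%E.
Proof.
move=> mD mf f0 k0; under eq_integral do rewrite EFinM.
rewrite (@ge0_integralZl _ _ _ nu D mD (fun x : T => (f x)%:E)).
- by [].
- exact/measurable_EFinP.
- by move=> x Dx; rewrite lee_fin f0.
- by rewrite lee_fin.
Qed.

Lemma integral_if (D P : set R) (p : pred R) (f : R -> \bar R) :
  (forall x, D x -> P x <-> p x) -> P `<=` D ->
  (\int[mu]_(x in D) (if p x then f x else 0) = \int[mu]_(x in P) f x)%E.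
Proof.
move=> Pp PD; rewrite -[in RHS](setIidr PD) integral_mkcondr.
apply: eq_integral => x /set_mem Dx; rewrite patchE.
case: ifPn => [/(Pp _ Dx) Px|npx]; first by rewrite mem_set.
by rewrite memNset// => /(Pp _ Dx); exact/negP.
Qed.

(** Tonelli on the region [g x < y], whose section at height [y] is [B y]. With one factor written
    as an integral of its derivative, it replaces integration by parts and changes of variables in
    the Gamma integrals below. *)
Lemma integral_layer (p r g : R -> R) (B : R -> set R) :
  measurable_fun setT p -> measurable_fun setT r -> measurable_fun setT g ->
  (forall x, 0 <= p x) -> (forall x, 0 <= r x) -> (forall x, 0 < x -> 0 <= g x) ->
  (forall x y, 0 < y -> 0 < x -> B y x <-> g x < y) -> (forall y, B y `<=` I0) ->
  (forall y, measurable (B y)) ->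
  (\int[mu]_(x in I0) ((p x)%:E * \int[mu]_(y in `]g x, +oo[) (r y)%:E) =
   \int[mu]_(y in I0) ((r y)%:E * \int[mu]_(x in B y) (p x)%:E))%E.
Proof.
move=> mp mr mg p0 r0 g0 Bg BI mB.
pose f (z : R * R) : \bar R := (if g z.1 < z.2 then (p z.1 * r z.2)%:E else 0%E).
have mf : measurable_fun (I0 `*` I0) f.
  apply: measurable_funTS; apply: measurable_fun_ifT => //.
    apply: measurable_fun_ltr => //.
    exact: measurableT_comp mg measurable_fst.
  apply/measurable_EFinP; apply: measurable_funM.
    exact: measurableT_comp mp measurable_fst.
  exact: measurableT_comp mr measurable_snd.
have f0 x y : (0 <= f (x, y))%E by rewrite /f/=; case: ifP => // _; rewrite lee_fin mulr_ge0.
have tm := @tonelli_on _ _ _ _ R (@lebesgue_measure R) (@lebesgue_measure R) I0 I0 (measurable_itv _) (measurable_itv _) f mf (fun x y _ _ => f0 x y).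
transitivity (\int[mu]_(x in I0) \int[mu]_(y in I0) f (x, y))%E.
  apply: eq_integral => x; rewrite inE/= in_itv/= andbT => x0.
  rewrite (@integral_if _ (`]g x, +oo[%classic)); first last.
  - by move=> y /=; rewrite !in_itv/= !andbT; apply: le_lt_trans; exact: g0.
  - by move=> y _; rewrite /mkset/= in_itv/= andbT.
  rewrite -ge0_integralZlR; last 4 first.
  - exact: measurable_itv.
  - exact: measurable_funTS.
  - by move=> y _; exact: r0.
  - exact: p0.
  by [].
rewrite tm; apply: eq_integral => y; rewrite inE/= in_itv/= andbT => y0.
rewrite (@integral_if _ (B y)); last 2 first.
- by move=> x /=; rewrite in_itv/= andbT => x0; exact: Bg.
- exact: BI.
rewrite -ge0_integralZlR; last 4 first.
- exact: mB.
- exact: measurable_funTS.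
- by move=> x _; exact: p0.
- exact: r0.
by apply: eq_integral => x _; rewrite /= mulrC.
Qed.

Lemma der_powR b x : 0 < x -> is_derive x (1 : R) (fun t => t `^ b) (b * x `^ (b - 1)).
Proof. by move=> x0; exact: is_derive1_powR. Qed.

Lemma continuous_powR_gt0 b x : 0 < x -> {for x, continuous (fun t => t `^ b)}.
Proof.
move=> x0; apply: differentiable_continuous; apply/derivable1_diffP.
by have [] := der_powR b x0.
Qed.

Lemma integral_powR_itvcy b c : 0 < b -> 0 < c ->
  (\int[mu]_(t in `]c, +oo[) (t `^ (- b - 1))%:E = (b^-1 * c `^ (- b))%:E)%E.
Proof.
move=> b0 c0.
rewrite integral_itv_obnd_cbnd; last first.
  by apply/measurable_EFinP; apply: measurable_funTS; exact: measurable_powR.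
rewrite (@ge0_continuous_FTC2y _ _ (fun t => - (b^-1 * t `^ (- b))) c 0).
- by rewrite sub0e EFinN oppeK.
- by move=> x _; exact: powR_ge0.
- apply: continuous_in_subspaceT => x; rewrite inE/= in_itv/= andbT => cx.
  by apply: continuous_powR_gt0; exact: lt_le_trans cx.
- rewrite -oppr0; apply: cvgN; rewrite -(mulr0 b^-1); apply: cvgMr.
  apply/cvgrPdist_lt => e e0.
  near=> t.
  have tg : e `^ (- b^-1) < t by near: t; exact: nbhs_pinfty_gt.
  have t0 : 0 < t by apply: le_lt_trans tg; exact: powR_ge0.
  rewrite sub0r normrN ger0_norm ?powR_ge0// powRN invf_plt ?posrE ?powR_gt0//.
  have := gt0_ltr_powR b0 (powR_ge0 _ _) (ltW t0) tg.
  by rewrite -powRrM mulNr mulVf ?gt_eqF// powR_inv1 ?ltW.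
- move=> x cx; have x0 := lt_trans c0 cx.
  by have [] := derN (derM (der_cst x b^-1) (der_powR (- b) x0)).
- apply: cvg_at_right_filter; apply: cvgN; apply: cvgMr; exact: continuous_powR_gt0.
- move=> x; rewrite in_itv/= andbT => cx; have x0 := lt_trans c0 cx.
  have [_] := derN (derM (der_cst x b^-1) (der_powR (- b) x0)).
  by rewrite derive1E => ->; rewrite mul0r add0r; field; rewrite gt_eqF.
Unshelve. all: by end_near. Qed.

Lemma integral_expRN_itvcy c :
  (\int[mu]_(t in `]c, +oo[) (expR (- t))%:E = (expR (- c))%:E)%E.
Proof.
rewrite integral_itv_obnd_cbnd; last first.
  apply/measurable_EFinP; apply: measurable_funTS; apply: measurableT_comp => //.
have d x : is_derive x (1 : R) (fun t => - expR (- t)) (expR (- x)).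
  have := derN (der_comp (is_derive_expR (- x)) (derN (der_id x))).
  by rewrite mulrN1 opprK.
have dc : continuous (fun t : R => expR (- t)).
  move=> x; apply: continuous_comp; [exact: opp_continuous|exact: continuous_expR].
rewrite (@ge0_continuous_FTC2y _ _ (fun t => - expR (- t)) c 0).
- by rewrite sub0e EFinN oppeK.
- by move=> x _; exact: expR_ge0.
- exact: continuous_subspaceT.
- by rewrite -oppr0; apply: cvgN; exact: cvgr_expR.
- by move=> x _; have [] := d x.
- by apply: cvg_at_right_filter; apply: cvgN; exact: dc.
- by move=> x _; have [_] := d x; rewrite derive1E.
Qed.

Lemma integral_powR_itv0 b c : 0 < b -> 0 < c ->
  (\int[mu]_(t in `]0%R, c[) (t `^ (b - 1))%:E = (b^-1 * c `^ b)%:E)%E.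
Proof.
move=> b0 c0.
have mf (D : set R) : measurable D -> measurable_fun D (fun t : R => (t `^ (b - 1))%:E).
  by move=> mD; apply/measurable_EFinP; apply: measurable_funTS; exact: measurable_powR.
rewrite integral_itv_bndo_bndc//; last exact: mf.
(* The integrand may blow up at [0], so the interval is exhausted from the right; the offset 2 makes
   the left end smaller than [c] already for [k = 0]. *)
pose F (k : nat) : set (measurableTypeR R) := `[c * k.+2%:R^-1, c]%classic.
have k2 (k : nat) : 0 < (k.+2%:R : R)^-1 < 1.
  by rewrite invr_gt0 ltr0n/= invf_lt1// ltr1n.
have FE : \bigcup_k F k = `]0, c]%classic.
  apply/seteqP; split => [x [k _]|x]; rewrite /F/= !in_itv/=.
    move=> /andP[h ->]; rewrite andbT (lt_le_trans _ h)// mulr_gt0//.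
  move=> /andP[x0 xc]; exists (Num.truncn (c / x)) => //=; rewrite in_itv/= xc andbT.
  rewrite ler_pdivrMr ?ltr0n// mulrC -ler_pdivrMr//.
  by apply/ltW; apply: lt_le_trans (truncnS_gt _) _; rewrite ler_nat.
have cv := @ge0_nondecreasing_set_cvg_integral _ _ R F (fun t => (t `^ (b - 1))%:E) (@lebesgue_measure R).
rewrite FE in cv.
apply: (cvg_unique _ (cv _ _ _ _)) => //.
- apply/nondecreasing_seqP => k; apply/subsetPset => x; rewrite /F/= !in_itv/=.
  move=> /andP[h ->]; rewrite andbT (le_trans _ h)// ler_pM2l//.
  by rewrite lef_pV2 ?posrE ?ltr0n// ler_nat.
- by move=> k; exact: measurable_itv.
- by move=> k; apply: mf; exact: measurable_itv.
- by move=> k x _; rewrite lee_fin powR_ge0.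
have E k : (\int[mu]_(x in F k) (x `^ (b - 1))%:E =
    (b^-1 * c `^ b - b^-1 * (c * k.+2%:R^-1) `^ b)%:E)%E.
  have /andP[k0 k1] := k2 k.
  have ck0 : 0 < c * k.+2%:R^-1 by rewrite mulr_gt0.
  have d x : 0 < x -> is_derive x (1 : R) (fun t => b^-1 * t `^ b) (x `^ (b - 1)).
    move=> x0; have := derM (der_cst x b^-1) (der_powR b x0).
    by rewrite mul0r add0r mulKf// gt_eqF.
  rewrite (@continuous_FTC2 _ _ (fun t => b^-1 * t `^ b)) -?EFinB//.
  - by rewrite gtr_pMr.
  - apply: continuous_in_subspaceT => x; rewrite inE/= in_itv/= => /andP[h _].
    by apply: continuous_powR_gt0; exact: lt_le_trans h.
  - split.
    + move=> x; rewrite in_itv/= => /andP[h _].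
      by have [] := d x (lt_trans ck0 h).
    + by apply: cvg_at_right_filter; apply: cvgMr; exact: continuous_powR_gt0.
    + by apply: cvg_at_left_filter; apply: cvgMr; exact: continuous_powR_gt0.
  - move=> x; rewrite in_itv/= => /andP[h _].
    by have [_] := d x (lt_trans ck0 h); rewrite derive1E.
rewrite /= (_ : (fun i => _) = fun k => (b^-1 * c `^ b - b^-1 * (c * k.+2%:R^-1) `^ b)%:E); last first.
  by apply/funext => k; exact: E.
apply: cvg_EFin; first exact: nearW.
rewrite -[X in _ --> X]subr0 -(mulr0 b^-1); apply: cvgB; first exact: cvg_cst.
apply: cvgMr.
have /cvg_at_rightP := powR_cvg0 b0; apply; split.
  by move=> k; rewrite mulr_gt0//; have /andP[] := k2 k.
rewrite -(mulr0 c); apply: cvgMr.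
have := @cvg_harmonic R; rewrite -(cvg_shiftS (@harmonic R)).
exact.
Qed.

(** Euler's integral with extended values, so that it can be manipulated before its finiteness is
    known. *)
Definition egamma b : \bar R := (\int[mu]_(t in I0) (t `^ (b - 1) * expR (- t))%:E)%E.

Lemma measurable_expRN : measurable_fun setT (fun t : R => expR (- t)).
Proof. exact: measurableT_comp. Qed.

(** The functional equation: [exp (- t)] is the integral of [exp (- y)] over [y > t], and exchanging
    the order leaves the integral of [t^(b - 1)] over []0, y[]. *)
Lemma egammaD1 b : 0 < b -> egamma b = (b^-1%:E * egamma (b + 1))%E.
Proof.
move=> b0.
have := @integral_layer (fun t => t `^ (b - 1)) (fun t => expR (- t)) id
  (fun y => `]0, y[%classic) (@measurable_powR _ _) measurable_expRN (@measurable_id _ _ _)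
  (fun _ => powR_ge0 _ _) (fun _ => expR_ge0 _) (fun x => @ltW _ _ 0 x).
move=> /(_ _ _ _)/=; rewrite /egamma.
under eq_integral do rewrite integral_expRN_itvcy -EFinM.
move=> ->.
- rewrite -ge0_integralZlR; first last.
  + by rewrite invr_ge0 ltW.
  + by move=> x _; rewrite mulr_ge0// ?powR_ge0 ?expR_ge0.
  + apply: measurable_funTS; apply: measurable_funM.
      exact: measurable_powR.
    exact: measurable_expRN.
  + exact: measurable_itv.
  apply: eq_integral => y; rewrite inE/= in_itv/= andbT => y0.
  by rewrite integral_powR_itv0// -!EFinM addrK; congr EFin; ring.
- by move=> x y y0 x0; rewrite in_itv/= x0.
- by move=> y x; rewrite /= !in_itv/= andbT => /andP[].
- by move=> y; exact: measurable_itv.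
Qed.

Lemma powR_expRN_le b : exists M : R, forall t, 1 <= t -> t `^ b * expR (- t) <= M.
Proof.
pose m := (Num.truncn b).+1.
have m0 : 0 < m%:R :> R by rewrite ltr0n.
(* Since [m > b], it suffices to bound [t^m * exp (- t)], and [t <= m * exp (t / m)] raised to the
   power [m] does so. *)
exists (m%:R ^+ m) => t t1; have t0 : 0 < t := lt_le_trans ltr01 t1.
rewrite expRN ler_pdivrMr ?expR_gt0//.
apply: (@le_trans _ _ (t ^+ m)).
  by rewrite -powR_mulrn ?ler_powR// ltW// truncnS_gt.
rewrite -[X in expR X](mulfVK (lt0r_neq0 m0)) [_ / _ * _]mulrC expRM_natl -exprMn.
apply: lerXn2r; rewrite ?nnegrE ?ltW ?mulr_gt0 ?expR_gt0//.
rewrite mulrC -ltr_pdivrMr//.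
by apply: lt_le_trans (expR_ge1Dx _); rewrite ltrDr.
Qed.

Lemma egamma_lty b : 0 < b -> (egamma b < +oo)%E.
Proof.
(* Applied to [b + 1 = (b - 1) + 2], this bounds the integrand by [M * t^(-2)] beyond [1]; below [1]
   it is at most [t^(b - 1)]. *)
move=> b0; have [M HM] := powR_expRN_le (b + 1).
have mf (D : set R) : measurable D -> measurable_fun D (fun t : R => (t `^ (b - 1) * expR (- t))%:E).
  move=> mD; apply/measurable_EFinP; apply: measurable_funTS; apply: measurable_funM.
    exact: measurable_powR.
  exact: measurable_expRN.
have M0 : 0 <= M by apply: le_trans (HM 1 (lexx _)); rewrite mulr_ge0 ?powR_ge0 ?expR_ge0.
have I0E : I0 = `]0, 1[ `|` `[1, +oo[.
  apply/seteqP; split => x; rewrite /= !in_itv/= ?andbT.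
    by move=> x0; case: (ltP x 1) => x1; [left|right]; rewrite ?x0.
  by move=> [/andP[]//|]; exact: lt_le_trans.
rewrite /egamma I0E ge0_integral_setU//=; last 3 first.
- by apply: mf; exact: measurableU.
- by move=> x _; rewrite lee_fin mulr_ge0 ?powR_ge0 ?expR_ge0.
- rewrite disj_set2E; apply/eqP/seteqP; split => // x []/=; rewrite !in_itv/= andbT.
  by move=> /andP[_ /lt_geF ->].
rewrite lte_add_pinfty//.
  apply: (@le_lt_trans _ _ (b^-1 * 1 `^ b)%:E); last exact: ltry.
  rewrite -integral_powR_itv0//; apply: ge0_le_integral => //.
  - by move=> x _; rewrite lee_fin mulr_ge0 ?powR_ge0 ?expR_ge0.
  - exact: mf.
  - by apply/measurable_EFinP; apply: measurable_funTS; exact: measurable_powR.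
  - move=> x /=; rewrite in_itv/= => /andP[x0 _].
    by rewrite lee_fin ler_piMr ?powR_ge0// -expR0 ler_expR oppr_le0 ltW.
rewrite -integral_itv_obnd_cbnd; last by apply: mf.
apply: (@le_lt_trans _ _ (M%:E * (1^-1 * 1 `^ (- 1))%:E)%E); last exact: ltry.
rewrite -integral_powR_itvcy// -ge0_integralZlR; last 4 first.
- exact: measurable_itv.
- by apply: measurable_funTS; exact: measurable_powR.
- by move=> x _; rewrite powR_ge0.
- exact: M0.
apply: ge0_le_integral => //.
- by move=> x _; rewrite lee_fin mulr_ge0 ?powR_ge0 ?expR_ge0.
- exact: mf.
- apply/measurable_EFinP; apply: measurable_funTS; apply: measurable_funM => //.
- move=> x /=; rewrite in_itv/= andbT => x1; rewrite lee_fin.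
  have x0 : 0 < x := lt_trans ltr01 x1.
  have := HM x (ltW x1); rewrite (_ : b + 1 = (b - 1) + 2); last by ring.
  rewrite powRD; last by rewrite (gt_eqF x0) implybT.
  rewrite (_ : -1 - 1 = - 2 :> R); last by ring.
  by rewrite powRN ler_pdivlMr ?powR_gt0// mulrAC.
Qed.

Lemma egamma_gt0 b : 0 < b -> (0 < egamma b)%E.
Proof.
move=> b0.
have mf (D : set R) : measurable D -> measurable_fun D (fun t : R => (t `^ (b - 1) * expR (- t))%:E).
  move=> mD; apply/measurable_EFinP; apply: measurable_funTS; apply: measurable_funM.
    exact: measurable_powR.
  exact: measurable_expRN.
apply: (@lt_le_trans _ _ (\int[mu]_(t in `[1%R, 2%R]) (2^-1 * expR (- 2))%:E)%E).
  rewrite integral_cst//= lebesgue_measure_itv/= lte_fin ltr1n -EFinB -EFinM lte_fin.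
  by rewrite !mulr_gt0 ?expR_gt0 ?invr_gt0// subr_gt0 ltr1n.
apply: (@le_trans _ _ (\int[mu]_(t in `[1%R, 2%R]) (t `^ (b - 1) * expR (- t))%:E)%E).
  apply: ge0_le_integral => //; first exact: mf.
  move=> x /=; rewrite in_itv/= => /andP[x1 x2]; rewrite lee_fin.
  have x0 : 0 < x := lt_le_trans ltr01 x1.
  apply: ler_pM; rewrite ?invr_ge0 ?expR_ge0 ?ler_expR ?lerN2//.
  apply: (@le_trans _ _ (x `^ (-1))); last by rewrite ler_powR// lerBrDr addNr ltW.
  by rewrite powR_inv1 ?(ltW x0)// lef_pV2 ?posrE.
apply: ge0_subset_integral => //; first exact: mf.
  by move=> x _; rewrite lee_fin mulr_ge0 ?powR_ge0 ?expR_ge0.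
by move=> x /=; rewrite !in_itv/= andbT => /andP[x1 _]; exact: lt_le_trans x1.
Qed.

Lemma GammaE b : 0 < b -> (Gamma b)%:E = egamma b.
Proof.
move=> b0; rewrite /Gamma b0 big_ord0 addr0 divr1 /euler_integral /Rintegral fineK//.
by rewrite fin_numElt egamma_lty// (lt_trans (ltNyr 0) (egamma_gt0 b0)).
Qed.

Lemma Gamma_gt0 b : 0 < b -> 0 < Gamma b.
Proof. by move=> b0; rewrite -lte_fin GammaE// egamma_gt0. Qed.

Lemma normr_GammaN s : 0 < s < 1 -> `|Gamma (- s)| = Gamma (1 - s) / s.
Proof.
move=> /andP[s0 s1]; rewrite /Gamma oppr_gt0 (lt_gtF s0) opprK.
(* So the continuation of [Gamma] to [- s] takes exactly one step of the functional equation. *)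
have -> : Num.truncn s = 0%N by apply/truncn0Pn; rewrite -ltNge.
rewrite subr_gt0 s1 !big_ord0 !addr0 divr1 big_ord_recl big_ord0 mulr1 addr0.
rewrite normrM normfV normrN (gtr0_norm s0) [- s + _]addrC; congr (_ / _).
have := @Gamma_gt0 (1 - s); rewrite /Gamma subr_gt0 s1 big_ord0 addr0 divr1.
by move=> /(_ isT) /gtr0_norm.
Qed.

(** Write [exp (- (q / t))] as the integral of [exp (- y)] over [y > q / t] and exchange: the inner
    integral over [t > q / y] is [b^-1 * (q / y)^(- b)], and the functional equation finishes. *)
Lemma integral_inverse_gauss b q : 0 < b -> 0 < q ->
  (\int[mu]_(t in I0) (t `^ (- b - 1) * expR (- (q / t)))%:E = (q `^ (- b) * Gamma b)%:E)%E.
Proof.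
move=> b0 q0.
have := @integral_layer (fun t => t `^ (- b - 1)) (fun t => expR (- t)) (fun t => q * t `^ (-1))
  (fun y => I0 `&` `]q / y, +oo[%classic) (@measurable_powR _ _) measurable_expRN _
  (fun _ => powR_ge0 _ _) (fun _ => expR_ge0 _).
move=> /(_ _ _ _ _ _)/=.
move=> L.
transitivity (\int[mu]_(x in I0)
  ((x `^ (- b - 1))%:E * \int[mu]_(y in `](q * x `^ (-1))%R, +oo[) (expR (- y))%:E))%E.
  apply: eq_integral => y; rewrite inE/= in_itv/= andbT => y0.
  by rewrite integral_expRN_itvcy -EFinM powR_inv1// ltW.
rewrite {}L.
- rewrite EFinM GammaE// egammaD1// muleA -EFinM -ge0_integralZlR; last 4 first.
  + exact: measurable_itv.
  + apply: measurable_funTS; apply: measurable_funM.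
      exact: measurable_powR.
    exact: measurable_expRN.
  + by move=> x _; rewrite mulr_ge0// ?powR_ge0 ?expR_ge0.
  + by rewrite mulr_ge0 ?powR_ge0 ?invr_ge0 ?ltW.
  apply: eq_integral => y; rewrite inE/= in_itv/= andbT => y0.
  rewrite [X in integral _ X _](_ : _ = `]q / y, +oo[%classic); last first.
    apply/setIidr => x /=; rewrite !in_itv/= !andbT; apply: lt_trans.
    exact: divr_gt0.
  rewrite integral_powR_itvcy ?divr_gt0// -!EFinM addrK.
  rewrite powRM ?invr_ge0 ?ltW// -(powR_inv1 (ltW y0)) -powRrM mulrN mulN1r opprK.
  by congr EFin; ring.
- by apply: measurable_funM => //; exact: measurable_powR.
- by move=> x x0; rewrite mulr_ge0 ?powR_ge0 ?ltW.
- move=> x y y0 x0; rewrite powR_inv1 ?(ltW x0)// !in_itv/= x0/= andbT.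
  by rewrite !ltr_pdivrMr// [y * x]mulrC; split => // -[].
- by move=> y x [].
- by move=> y; apply: measurableI; exact: measurable_itv.
Qed.

Lemma integral_expRN_itv0 c : 0 < c ->
  (\int[mu]_(t in `]0%R, c[) (expR (- t))%:E = (1 - expR (- c))%:E)%E.
Proof.
move=> c0.
have mf (D : set R) : measurable D -> measurable_fun D (fun t : R => (expR (- t))%:E).
  by move=> mD; apply/measurable_EFinP; apply: measurable_funTS; exact: measurable_expRN.
rewrite integral_itv_bndo_bndc; last exact: mf.
rewrite integral_itv_obnd_cbnd; last exact: mf.
have d x : is_derive x (1 : R) (fun t => - expR (- t)) (expR (- x)).
  have := derN (der_comp (is_derive_expR (- x)) (derN (der_id x))).
  by rewrite mulrN1 opprK.
have dc : continuous (fun t : R => expR (- t)).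
  move=> x; apply: continuous_comp; [exact: opp_continuous|exact: continuous_expR].
rewrite (@continuous_FTC2 _ _ (fun t => - expR (- t)))//.
- by rewrite -EFinB opprK oppr0 expR0 addrC.
- exact: continuous_subspaceT.
- split.
  + by move=> x _; have [] := d x.
  + by apply: cvg_at_right_filter; apply: cvgN; exact: dc.
  + by apply: cvg_at_left_filter; apply: cvgN; exact: dc.
- by move=> x _; have [_] := d x; rewrite derive1E.
Qed.

(** Write [1 - exp (- lambda * t)] as the integral of [exp (- x)] over []0, lambda * t[] and
    exchange. The result has the factor [Gamma (1 - s) / s], which is [|Gamma (- s)|]. *)
Lemma integral_1BexpR s lambda : 0 < s < 1 -> 0 <= lambda ->
  (\int[mu]_(t in I0) ((1 - expR (- (lambda * t))) * t `^ (- s - 1))%:E =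
   (lambda `^ s * `|Gamma (- s)|)%:E)%E.
Proof.
move=> s01; have /andP[s0 s1] := s01; rewrite le_eqVlt => /predU1P[<-|l0].
  rewrite powR0 ?gt_eqF// mul0r; apply: integral0_eq => t _.
  by rewrite mul0r oppr0 expR0 subrr mul0r.
have := @integral_layer (fun t => expR (- t)) (fun t => t `^ (- s - 1)) (fun t => t / lambda)
  (fun y => `]0, lambda * y[%classic) measurable_expRN (@measurable_powR _ _) _
  (fun _ => expR_ge0 _) (fun _ => powR_ge0 _ _).
move=> /(_ _ _ _ _ _)/= L.
rewrite normr_GammaN// mulrCA mulrC.
rewrite [RHS]EFinM GammaE ?subr_gt0// muleC.
rewrite [RHS]muleC.
rewrite /egamma -ge0_integralZlR; last 4 first.
  + exact: measurable_itv.
  + apply: measurable_funTS; apply: measurable_funM.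
      exact: measurable_powR.
    exact: measurable_expRN.
  + by move=> x _; rewrite mulr_ge0// ?powR_ge0 ?expR_ge0.
  + by rewrite mulr_ge0 ?powR_ge0 ?invr_ge0 ?ltW.
transitivity (\int[mu]_(y in I0) ((y `^ (- s - 1))%:E * \int[mu]_(x in `]0%R, (lambda * y)%R[) (expR (- x))%:E))%E.
  apply: eq_integral => y; rewrite inE/= in_itv/= andbT => y0.
  by rewrite integral_expRN_itv0 ?mulr_gt0// -EFinM mulrC.
rewrite -{}L.
- apply: eq_integral => y; rewrite inE/= in_itv/= andbT => y0.
  rewrite integral_powR_itvcy ?divr_gt0// -!EFinM.
  rewrite powRM ?invr_ge0 ?ltW// -(powR_inv1 (ltW l0)) -powRrM mulrN mulN1r opprK.
  by rewrite [1 - s - 1]addrC addKr; congr EFin; ring.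
- by apply: measurable_funM.
- by move=> x x0; rewrite divr_ge0// ltW.
- by move=> x y y0 x0; rewrite in_itv/= x0 ltr_pdivrMr// mulrC.
- by move=> y x; rewrite /= !in_itv/= andbT => /andP[].
- by move=> y; exact: measurable_itv.
Qed.

End gamma.

(** * Heat kernel bounds for small and large times, and the lattice formula *)

Section heat_bounds.
Context {R : realType} {n : nat}.
Local Notation mu := (@lebesgue_measure R).
Local Notation I0 := (`]0, +oo[%classic : set R).
Implicit Types (x z : 'rV[R]_n) (t sigma : R) (nu : 'rV[int]_n).

Lemma measurable_heat d (T : measurableType d) (D : set T) (tau : T -> R) (rho : T -> 'rV[R]_n) :
  measurable D -> measurable_fun D tau ->
  (forall i, measurable_fun D (fun w => rho w 0 i)) ->
  measurable_fun D (fun w => heat_kernel (tau w) (rho w)).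
Proof.
move=> mD mt mr; under eq_fun do rewrite heat_kernel_rsum.
apply: measurable_funM => //; apply: measurable_fun_rsum => // nu.
apply: measurable_funM.
  apply: measurableT_comp => //; apply: measurableT_comp => //.
  exact: measurable_funM.
have := measurable_continuous mD mr (@continuous_cos_dot R n (ivec R nu) 0).
by apply: eq_measurable_fun => w _; rewrite /= addr0.
Qed.

Lemma frac_integrandE sigma x t : 0 < t ->
  frac_integrand sigma x t = heat_kernel t x * t `^ (- (sigma / 2) - 1).
Proof. by move=> t0; rewrite /frac_integrand -powRN opprD addrC. Qed.

Lemma frac_integrand_ge0 sigma x t : 0 < t -> 0 <= frac_integrand sigma x t.
Proof. by move=> t0; rewrite divr_ge0 ?heat_kernel_ge0 ?powR_ge0. Qed.

Lemma measurable_frac_integrand sigma x :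
  measurable_fun I0 (frac_integrand sigma x).
Proof.
apply: (eq_measurable_fun (fun t => heat_kernel t x * t `^ (- (sigma / 2) - 1))).
  by move=> t; rewrite inE/= in_itv/= andbT => t0; rewrite frac_integrandE.
apply: measurable_funM.
  apply: measurable_heat => //.
by apply: measurable_funTS; exact: measurable_powR.
Qed.

Lemma enorm_ge0 x : 0 <= enorm x.
Proof. exact: sqrtr_ge0. Qed.

Lemma enorm_eq0 x : (enorm x == 0) = (x == 0).
Proof.
apply/eqP/eqP => [x0|->].
  apply/rowP => i; rewrite mxE; apply/eqP; rewrite -sqrf_eq0 eq_le sqr_ge0 andbT.
  have <- : \sum_i x 0 i ^+ 2 = 0 by rewrite -enorm_sqr x0 expr0n.
  rewrite (bigD1 i)//=.
  by rewrite lerDl sumr_ge0// => j _; exact: sqr_ge0.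
rewrite /enorm /dot big1 ?sqrtr0// => i _; by rewrite mxE mul0r.
Qed.

Lemma enorm_gt0 x : (0 < enorm x) = (x != 0).
Proof. by rewrite lt_neqAle enorm_ge0 andbT eq_sym enorm_eq0. Qed.

(** In each coordinate, [0] is a nearest point of [2 * pi * Z] to a point of the cell. *)
Lemma enorm_lattice_ge x nu : Q x -> enorm x ^+ 2 <= enorm (x - (2 * pi) *: ivec R nu) ^+ 2.
Proof.
move=> Qx; rewrite !enorm_sqr; apply: ler_sum => i _; rewrite !mxE.
have /andP[xl xu] := Qx i; have p0 := @pi_gt0 R.
have [->|k0] := eqVneq (nu 0 i) 0; first by rewrite mulr0 subr0.
have [kp|kn|k00] := ltgtP (nu 0 i) 0; last by rewrite k00 eqxx in k0.
- have : (nu 0 i)%:~R <= (- 1) :> R by rewrite -[leRHS]/((-1)%:~R) ler_int -ltzD1 addNr.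
  move: (_%:~R) => k k1; rewrite -subr_ge0.
  rewrite (_ : _ - _ = (- (4 * k * pi)) * (x 0 i - k * pi)); last by ring.
  apply: mulr_ge0; nra.
- have : 1 <= (nu 0 i)%:~R :> R by rewrite -[leLHS]/(1%:~R) ler_int -gtz0_ge1.
  move: (_%:~R) => k k1; rewrite -subr_ge0.
  rewrite (_ : _ - _ = (4 * k * pi) * (k * pi - x 0 i)); last by ring.
  apply: mulr_ge0; nra.
Qed.

Lemma powRD_gt0 (u a b : R) : 0 < u -> u `^ (a + b) = u `^ a * u `^ b.
Proof. by move=> u0; rewrite powRD// (gt_eqF u0) implybT. Qed.

Lemma heat_kernel_bounded s : 0 < s -> exists2 C : R, 0 <= C &
  forall t, s <= t -> forall x, heat_kernel t x <= C.
Proof.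
move=> s0.
have c0 : 0 <= ((2 * pi) ^+ n)^-1 :> R by rewrite invr_ge0 exprn_ge0// mulr_ge0 ?pi_ge0.
exists (((2 * pi) ^+ n)^-1 * rsum (fun nu : 'rV[int]_n => expR (- (s * enorm (ivec R nu) ^+ 2)))).
  by rewrite mulr_ge0// rsum_ge0// => nu; rewrite expR_ge0.
move=> t st x; rewrite heat_kernel_rsum ler_wpM2l//.
apply: le_trans (ler_norm _) _; apply: ler_norm_rsum; last exact: rsummable_heat.
move=> nu; have := norm_heat_cos_le t 0 nu x; rewrite addr0 => /le_trans; apply.
by rewrite ler_expR lerN2 ler_wpM2r ?sqr_ge0.
Qed.

Lemma sqrt_pi_div t : 0 < t ->
  ((2 * pi)^-1 * Num.sqrt (pi / t)) ^+ n =
  ((2 * pi)^-1 * Num.sqrt pi) ^+ n * t `^ (- (n%:R / 2)) :> R.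
Proof.
move=> t0; rewrite sqrtrM ?pi_ge0// mulrA exprMn; congr (_ * _).
rewrite sqrtrV ?ltW// exprVn -powR12_sqrt ?ltW// -powR_mulrn ?powR_ge0//.
by rewrite -powRrM mulrC powRN.
Qed.

(** Each Gaussian exponent is split in half. One half is at least [|x|^2 / (8 * t)] by
    [enorm_lattice_ge]; since [t <= 1], the other is at least the exponent at time 2, where the sum
    is a finite constant. *)
Lemma heat_kernel_le0 x : Q x -> exists2 C : R, 0 <= C &
  forall t, 0 < t <= 1 ->
  heat_kernel t x <= C * (t `^ (- (n%:R / 2)) * expR (- (enorm x ^+ 2 / 8 / t))).
Proof.
move=> Qx.
have [sS _] := @rsummable_gaussN R n 2 x ltac:(by []).
set u := fun _ => _ in sS.
have k0 : 0 <= ((2 * pi)^-1 * Num.sqrt pi) ^+ n :> R.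
  by rewrite exprn_ge0// mulr_ge0 ?sqrtr_ge0// invr_ge0 mulr_ge0 ?pi_ge0.
exists (((2 * pi)^-1 * Num.sqrt pi) ^+ n * rsum u).
  by rewrite mulr_ge0// rsum_ge0// => nu; rewrite expR_ge0.
move=> t /andP[t0 t1]; rewrite heat_kernel_gauss// sqrt_pi_div//.
rewrite (_ : _ * rsum u * _ = ((2 * pi)^-1 * Num.sqrt pi) ^+ n * t `^ (- (n%:R / 2)) *
  (expR (- (enorm x ^+ 2 / 8 / t)) * rsum u)); last by ring.
rewrite ler_wpM2l ?mulr_ge0 ?powR_ge0// -rsumZ//; apply: le_trans (ler_norm _) _.
apply: ler_norm_rsum; last exact: rsummableZ.
move=> nu; rewrite ger0_norm ?expR_ge0// /u -expRD ler_expR.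
have AB := enorm_lattice_ge nu Qx; have A0 := sqr_ge0 (enorm x).
set A := enorm x ^+ 2 in A0 AB *; set B := enorm _ ^+ 2 in AB *.
have : 1 <= t^-1 by rewrite invf_ge1.
rewrite !invfM; move: t^-1 => w w1.
have h1 : 0 <= w * (B - A) by rewrite mulr_ge0 ?subr_ge0 ?(le_trans ler01).
have h2 : 0 <= (w - 1) * B by apply: mulr_ge0; [rewrite subr_ge0|exact: le_trans AB].
nra.
Qed.

Lemma ge0_fin_integrable d (T : measurableType d) (nu : {measure set T -> \bar R}) (D : set T) (f : T -> R) :
  measurable D -> measurable_fun D f -> (forall x : T, D x -> 0 <= f x) ->
  (\int[nu]_(x in D) (f x)%:E < +oo)%E -> nu.-integrable D (EFin \o f).
Proof.
move=> mD mf f0 If; apply/integrableP; split; first exact/measurable_EFinP.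
rewrite (eq_integral (fun x : T => (f x)%:E))// => x /set_mem Dx.
by rewrite /= ger0_norm ?f0.
Qed.

Lemma integral_inverse_gauss_lty (b q : R) : 0 < b -> 0 < q ->
  mu.-integrable I0 (EFin \o (fun t => t `^ (- b - 1) * expR (- (q / t)))).
Proof.
move=> b0 q0; apply: ge0_fin_integrable.
- exact: measurable_itv.
- apply: (eq_measurable_fun (fun t => t `^ (- b - 1) * expR (- (q * t `^ (-1))))).
    by move=> t; rewrite inE/= in_itv/= andbT => t0; rewrite powR_inv1// ltW.
  apply: measurable_funTS; apply: measurable_funM; first exact: measurable_powR.
  apply: measurableT_comp => //; apply: measurableT_comp => //.
  by apply: measurable_funM => //; exact: measurable_powR.
- by move=> t _; rewrite mulr_ge0 ?powR_ge0 ?expR_ge0.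
- by rewrite integral_inverse_gauss// ltry.
Qed.

Lemma frac_integrand_integrable sigma x : 0 < sigma -> Q x -> x != 0 ->
  mu.-integrable I0 (EFin \o frac_integrand sigma x).
Proof.
move=> s0 Qx x0.
have [C1 C10 H1] := heat_kernel_bounded ltr01; have [C0 C00 H0] := heat_kernel_le0 Qx.
have ex0 : 0 < enorm x ^+ 2 / 8 by rewrite divr_gt0// exprn_gt0// enorm_gt0.
have b0 : 0 < (n%:R + sigma) / 2 by rewrite divr_gt0// ltr_wpDl.
have i1 := integral_inverse_gauss_lty b0 ex0.
(* Beyond time 1 the heat kernel is bounded and [exp (- (1 / t))] is at least [exp (- 1)], so an
   inverse Gaussian integral also majorizes this range, at the cost of a factor [expR 1]. *)
have i2 := @integral_inverse_gauss_lty (sigma / 2) 1 ltac:(by rewrite divr_gt0) ltr01.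
have mI : measurable (I0 : set (measurableTypeR R)) by exact: measurable_itv.
have ig := integrableRD mI (integrableRZ mI C0 i1) (integrableRZ mI (C1 * expR 1) i2).
apply: (le_integrableR mI (measurable_frac_integrand _ _) ig).
move=> t; rewrite /= in_itv/= andbT => t0; rewrite ger0_norm ?frac_integrand_ge0//.
rewrite frac_integrandE//; have [t1|/ltW t1] := leP t 1.
  apply: (@le_trans _ _ (C0 * (t `^ (- ((n%:R + sigma) / 2) - 1) *
      expR (- (enorm x ^+ 2 / 8 / t))))); last first.
    by rewrite lerDl !mulr_ge0 ?powR_ge0 ?expR_ge0.
  apply: (@le_trans _ _ (C0 * (t `^ (- (n%:R / 2)) * expR (- (enorm x ^+ 2 / 8 / t)))
      * t `^ (- (sigma / 2) - 1))).
    by rewrite ler_wpM2r ?powR_ge0// H0// t0.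
  rewrite (_ : - ((n%:R + sigma) / 2) - 1 = - (n%:R / 2) + (- (sigma / 2) - 1)); last by field.
  rewrite (powRD_gt0 (- (n%:R / 2)) _ t0).
  by rewrite le_eqVlt; apply/orP; left; apply/eqP; ring.
apply: (@le_trans _ _ (C1 * expR 1 * (t `^ (- (sigma / 2) - 1) * expR (- (1 / t))))); last first.
  by rewrite lerDr !mulr_ge0 ?powR_ge0 ?expR_ge0.
apply: (@le_trans _ _ (C1 * t `^ (- (sigma / 2) - 1))).
  by rewrite ler_wpM2r ?powR_ge0// H1.
have -> : C1 * expR 1 * (t `^ (- (sigma / 2) - 1) * expR (- (1 / t))) =
  C1 * t `^ (- (sigma / 2) - 1) * (expR 1 * expR (- (1 / t))) by ring.
rewrite ler_peMr ?mulr_ge0 ?powR_ge0// -expRD -[leLHS]expR0 ler_expR subr_ge0.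
by rewrite div1r invf_le1// (lt_le_trans ltr01).
Qed.

Lemma frac_kernelE sigma x : 0 < sigma -> Q x -> x != 0 ->
  ((frac_kernel sigma x)%:E =
   `|Gamma (- (sigma / 2))|^-1%:E * \int[mu]_(t in I0) (frac_integrand sigma x t)%:E)%E.
Proof.
move=> s0 Qx x0; rewrite /frac_kernel EFinM /Rintegral fineK//.
exact: integrable_fin_num (frac_integrand_integrable s0 Qx x0).
Qed.

Lemma lattice_gt0 x nu : Q x -> x != 0 -> 0 < enorm (x - (2 * pi) *: ivec R nu).
Proof.
move=> Qx x0; rewrite -(ltr_pXn2r (ltn0Sn 1)) ?nnegrE ?enorm_ge0// expr0n/=.
by apply: lt_le_trans (enorm_lattice_ge nu Qx); rewrite exprn_gt0// enorm_gt0.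
Qed.

(** With [b = (n + sigma) / 2] and [q nu] a quarter of the squared distance to a lattice point, each
    term is [integral_inverse_gauss], and [q nu^(- b)] produces the power of the distance and the
    factor [2^(n + sigma)]. *)
Lemma integral_frac_integrand sigma x : 0 < sigma -> Q x -> x != 0 ->
  (\int[mu]_(t in I0) (frac_integrand sigma x t)%:E =
   (((2 * pi)^-1 * Num.sqrt pi) ^+ n * Gamma ((n%:R + sigma) / 2) * 2 `^ (n%:R + sigma))%:E *
   \esum_(nu in [set: 'rV[int]_n])
     (1 / enorm (x - (2 * pi) *: ivec R nu) `^ (n%:R + sigma))%:E)%E.
Proof.
move=> s0 Qx x0; set b := (n%:R + sigma) / 2; set k := ((2 * pi)^-1 * Num.sqrt pi) ^+ n.
have b0 : 0 < b by rewrite divr_gt0// ltr_wpDl.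
have b2 : b * 2 = n%:R + sigma by rewrite /b; field.
have k0 : 0 <= k by rewrite exprn_ge0// mulr_ge0 ?sqrtr_ge0// invr_ge0 mulr_ge0 ?pi_ge0.
pose q nu : R := enorm (x - (2 * pi) *: ivec R nu) ^+ 2 / 4.
have q0 nu : 0 < q nu by rewrite divr_gt0// exprn_gt0// lattice_gt0.
have G0 := Gamma_gt0 b0.
transitivity (\int[mu]_(t in I0) \esum_(nu in [set: 'rV[int]_n])
   (k * (t `^ (- b - 1) * expR (- (q nu / t))))%:E)%E.
  apply: eq_integral => t; rewrite inE/= in_itv/= andbT => t0.
  have [sg _] := rsummable_gaussN x t0.
  rewrite frac_integrandE// heat_kernel_gauss// sqrt_pi_div// -/k.
  transitivity ((k * t `^ (- b - 1)) *
    rsum (fun nu : 'rV[int]_n => expR (- ((4 * t)^-1 * enorm (x - (2 * pi) *: ivec R nu) ^+ 2))))%:E.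
    rewrite (_ : - b - 1 = - (n%:R / 2) + (- (sigma / 2) - 1)); last by rewrite /b; field.
    by rewrite [t `^ (_ + (_ - _))]powRD ?(gt_eqF t0) ?implybT//; congr EFin; ring.
  rewrite EFinM rsum_ge0EFin//.
  rewrite -esumZl_EFin ?mulr_ge0 ?powR_ge0//.
  apply: eq_esum => nu _; rewrite -mulrA; congr (_ * (_ * expR (- _)))%:E.
  by rewrite /q invfM mulrC mulrA.
rewrite ge0_integral_esum; last 3 first.
- exact: measurable_itv.
- move=> nu; apply/measurable_EFinP; apply: measurable_funM => //.
  by have /measurable_int/measurable_EFinP := integral_inverse_gauss_lty b0 (q0 nu).
- by move=> nu t; rewrite lee_fin !mulr_ge0 ?powR_ge0 ?expR_ge0.
rewrite -esumZl_EFin; last 2 first.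
- by rewrite mulr_ge0 ?powR_ge0// mulr_ge0// ltW.
- by move=> nu; rewrite div1r invr_ge0 powR_ge0.
apply: eq_esum => nu _; rewrite ge0_integralZlR; last 4 first.
- exact: measurable_itv.
- by have /measurable_int/measurable_EFinP := integral_inverse_gauss_lty b0 (q0 nu).
- by move=> t _; rewrite mulr_ge0 ?powR_ge0 ?expR_ge0.
- exact: k0.
rewrite integral_inverse_gauss// -EFinM; congr EFin.
rewrite /q powRM ?exprn_ge0 ?enorm_ge0 ?invr_ge0//.
rewrite -powR_mulrn ?enorm_ge0// -powRrM mulrN (mulrC _ b) b2 powRN.
rewrite (_ : (4^-1 : R) = 2 `^ (- 2)); last first.
  by rewrite powRN powR_mulrn// -natrX.
by rewrite -powRN -powRrM mulNr mulrN opprK (mulrC _ b) b2 powRN div1r; ring.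
Qed.

Lemma frac_kernel_esum sigma x : 0 < sigma -> Q x -> x != 0 ->
  ((frac_kernel sigma x)%:E =
    (2 `^ sigma * Gamma ((n%:R + sigma) / 2)
      / (`|Gamma (- (sigma / 2))| * pi `^ (n%:R / 2)))%:E *
     \esum_(nu in [set: 'rV[int]_n])
       (1 / enorm (x - (2 * pi) *: ivec R nu) `^ (n%:R + sigma))%:E)%E.
Proof.
move=> s0 Qx x0; rewrite frac_kernelE// integral_frac_integrand// muleA -EFinM.
congr (_%:E * _)%E.
have p0 : 0 < pi :> R := pi_gt0 R.
have -> : ((2 * pi)^-1 * Num.sqrt pi) ^+ n = 2 `^ (- n%:R) * (pi `^ (n%:R / 2))^-1 :> R.
  have s0' : Num.sqrt pi != 0 :> R by rewrite sqrtr_eq0 -ltNge.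
  have -> : (2 * pi)^-1 * Num.sqrt pi = (2 * Num.sqrt pi)^-1 :> R.
    by rewrite -{1}(sqr_sqrtr (ltW p0)); field.
  rewrite exprVn exprMn invfM powRN powR_mulrn//; congr (_ * _^-1).
  by rewrite -powR_mulrn ?sqrtr_ge0// -powR12_sqrt ?ltW// -powRrM mulrC.
rewrite [2 `^ (_ + _)]powRD ?implybT//; last by rewrite pnatr_eq0 implybT.
rewrite powRN invfM.
have : 2 `^ n%:R != 0 :> R by rewrite gt_eqF// powR_gt0.
move: (2 `^ n%:R) => w w0; move: `|_|^-1 (pi `^ _)^-1 => u v; by field.
Qed.

Lemma frac_kernel_gt0 sigma x : 0 < sigma < 2 -> Q x -> x != 0 -> 0 < frac_kernel sigma x.
Proof.
move=> /andP[s0 s2] Qx x0; rewrite -lte_fin frac_kernel_esum// mule_gt0//.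
  rewrite lte_fin divr_gt0// mulr_gt0 ?powR_gt0 ?pi_gt0//.
    by apply: Gamma_gt0; rewrite divr_gt0// ltr_wpDl.
  rewrite normr_GammaN; last by rewrite divr_gt0// ltr_pdivrMr// mul1r.
  by rewrite divr_gt0 ?Gamma_gt0 ?subr_gt0 ?divr_gt0// ltr_pdivrMr// mul1r.
apply: (@lt_le_trans _ _ (\esum_(nu in [set (0 : 'rV[int]_n)%R])
       (1 / enorm (x - (2 * pi) *: ivec R nu) `^ (n%:R + sigma))%:E)%E).
  rewrite esum_set1; last by rewrite lee_fin div1r invr_ge0 powR_ge0.
  by rewrite lte_fin divr_gt0// powR_gt0// lattice_gt0.
rewrite [leRHS](esumID [set 0]); last first.
  by move=> nu _; rewrite lee_fin div1r invr_ge0 powR_ge0.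
rewrite setTI leeDl// esum_ge0// => nu _.
by rewrite lee_fin div1r invr_ge0 powR_ge0.
Qed.

End heat_bounds.

Section torus_integral_theory.
Context {R : realType} {n : nat}.
Local Notation lam := (lebesgue_tuple R n).
Implicit Types (f g : 'rV[R]_n -> R) (x : 'rV[R]_n).

Lemma eq_Rn_int D f g : (forall x, D x -> f x = g x) -> Rn_int D f = Rn_int D g.
Proof. by move=> fg; apply: eq_Rintegral => w /set_mem Dw; exact: fg. Qed.

Lemma Rn_intD f g : Rn_integrable Q f -> Rn_integrable Q g ->
  Rn_int Q (fun x => f x + g x) = Rn_int Q f + Rn_int Q g.
Proof. by move=> If Ig; rewrite /Rn_int (@RintegralD _ _ _ lam)//; exact: measurable_Qt. Qed.

Lemma Rn_intB f g : Rn_integrable Q f -> Rn_integrable Q g ->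
  Rn_int Q (fun x => f x - g x) = Rn_int Q f - Rn_int Q g.
Proof. by move=> If Ig; rewrite /Rn_int (@RintegralB _ _ _ lam)//; exact: measurable_Qt. Qed.

Lemma Rn_intZ c f : Rn_integrable Q f -> Rn_int Q (fun x => c * f x) = c * Rn_int Q f.
Proof. by move=> If; rewrite /Rn_int (@RintegralZl _ _ _ lam)//; exact: measurable_Qt. Qed.

Lemma Rn_integrableD f g : Rn_integrable Q f -> Rn_integrable Q g ->
  Rn_integrable Q (fun x => f x + g x).
Proof. by apply: (integrableRD (mu := lam)); exact: measurable_Qt. Qed.

Lemma Rn_integrableB f g : Rn_integrable Q f -> Rn_integrable Q g ->
  Rn_integrable Q (fun x => f x - g x).
Proof. by apply: (integrableRB (mu := lam)); exact: measurable_Qt. Qed.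

Lemma Rn_integrableZ c f : Rn_integrable Q f -> Rn_integrable Q (fun x => c * f x).
Proof. by apply: (integrableRZ (mu := lam)); exact: measurable_Qt. Qed.

Lemma le_Rn_integrable f g : mfunR f -> Rn_integrable Q g ->
  (forall x, Q x -> `|f x| <= g x) -> Rn_integrable Q f.
Proof.
move=> mf Ig fg; apply: (le_integrableR (mu := lam) (@measurable_Qt R n) _ Ig).
  exact: measurable_funTS.
by move=> w; exact: fg.
Qed.

Lemma le_Rn_int f g : Rn_integrable Q f -> Rn_integrable Q g ->
  (forall x, Q x -> f x <= g x) -> Rn_int Q f <= Rn_int Q g.
Proof.
move=> If Ig fg; apply: (@le_Rintegral _ _ _ lam) => //; first exact: measurable_Qt.
by move=> w; exact: fg.
Qed.

Lemma norm_Rn_int_le f g : Rn_integrable Q f -> Rn_integrable Q g ->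
  (forall x, Q x -> `|f x| <= g x) -> `|Rn_int Q f| <= Rn_int Q g.
Proof.
move=> If Ig fg; apply: le_trans (le_normr_Rintegral _ If) _; first exact: measurable_Qt.
have In : Rn_integrable Q (fun x => `|f x|).
  have := @integrable_norm _ _ _ lam (@Qt R n) (f \o @row_of R n).
  exact.
exact: (le_Rn_int In Ig).
Qed.

Lemma Rn_int_EFin f : Rn_integrable Q f ->
  (\int[lam]_(w in @Qt R n) (f (row_of w))%:E = (Rn_int Q f)%:E)%E.
Proof.
move=> If; rewrite /Rn_int /Rintegral fineK//.
have F := integrable_fin_num (@measurable_Qt R n) If.
exact: F.
Qed.

Lemma ge0_Rn_integrable f : mfunR f -> (forall x, Q x -> 0 <= f x) ->
  (\int[lam]_(w in @Qt R n) (f (row_of w))%:E < +oo)%E -> Rn_integrable Q f.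
Proof.
move=> mf f0; apply: ge0_fin_integrable; first exact: measurable_Qt.
  exact: measurable_funTS.
by move=> w; exact: f0.
Qed.

End torus_integral_theory.

Section kernel.
Context {R : realType} {n : nat}.
Local Notation RT := (measurableTypeR R).
Local Notation mu := (@lebesgue_measure R).
Local Notation lam := (lebesgue_tuple R n).
Local Notation I0 := (`]0, +oo[%classic : set R).
Implicit Types (x z : 'rV[R]_n) (t sigma : R) (nu : 'rV[int]_n) (h : 'rV[R]_n -> R).

Lemma frac_kernel_ge0 sigma x : 0 <= frac_kernel sigma x.
Proof.
rewrite mulr_ge0 ?invr_ge0//; apply: Rintegral_ge0 => t.
by rewrite /= in_itv/= andbT => t0; exact: frac_integrand_ge0.
Qed.

Lemma frac_kernelN sigma x : frac_kernel sigma (- x) = frac_kernel sigma x.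
Proof.
have E : frac_integrand sigma (- x) = frac_integrand sigma x.
  by apply/funext => t; rewrite /frac_integrand heat_kernelN.
by rewrite /frac_kernel E.
Qed.

Lemma measurable_frac_integrand2 sigma :
  measurable_fun (setT `*` I0) (fun p : n.-tuple RT * RT => frac_integrand sigma (row_of p.1) p.2).
Proof.
apply: (eq_measurable_fun (fun p : n.-tuple RT * RT =>
    heat_kernel p.2 (row_of p.1) * p.2 `^ (- (sigma / 2) - 1))).
  by move=> [w t]; rewrite inE => -[_]; rewrite /= in_itv/= andbT => t0; rewrite frac_integrandE.
apply: measurable_funTS; apply: measurable_funM.
  apply: measurable_heat => // i.
  exact: measurableT_comp (measurable_row_of i) measurable_fst.
exact: measurableT_comp (@measurable_powR _ _) measurable_snd.
Qed.

Lemma mfunR_frac_kernel sigma : mfunR (@frac_kernel R n sigma).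
Proof.
apply: measurable_funM => //.
apply: measurableT_comp; first exact: fine_measurable.
apply: (@measurable_fun_tonelli_on _ _ _ _ R mu setT I0 measurableT (measurable_itv _)
  (fun p : n.-tuple RT * RT => (frac_integrand sigma (row_of p.1) p.2)%:E)).
  by apply/measurable_EFinP; exact: measurable_frac_integrand2.
move=> w t _; rewrite /= in_itv/= andbT => t0.
by rewrite lee_fin frac_integrand_ge0.
Qed.

(** Where the kernel is infinite, [frac_kernel] has the junk value [0]; the hypothesis [h 0 = 0]
    makes this harmless. *)
Lemma integral_kernel sigma h : 0 < sigma -> mfunR h -> (forall z, 0 <= h z) -> h 0 = 0 ->
  (\int[lam]_(w in @Qt R n) (h (row_of w) * frac_kernel sigma (row_of w))%:E =
   \int[mu]_(t in I0) ((`|Gamma (- (sigma / 2))|^-1 * t `^ (- (sigma / 2) - 1))%:E *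
     \int[lam]_(w in @Qt R n) (h (row_of w) * heat_kernel t (row_of w))%:E))%E.
Proof.
move=> s0 mh h0 h00.
set c := `|_|^-1; have c0 : 0 <= c by rewrite invr_ge0.
pose F (p : n.-tuple RT * RT) : \bar R := ((c * h (row_of p.1)) * frac_integrand sigma (row_of p.1) p.2)%:E.
have mI : measurable (I0 : set RT) by exact: measurable_itv.
have mF : measurable_fun (@Qt R n `*` I0) F.
  apply/measurable_EFinP; apply: measurable_funM.
    apply: measurable_funM => //; apply: measurable_funTS.
    exact: measurableT_comp mh measurable_fst.
  apply: measurable_funS (measurable_frac_integrand2 sigma); first exact: measurableX.
  by move=> p [].
have F0 w t : Qt w -> I0 t -> (0 <= F (w, t))%E.
  rewrite /= in_itv/= andbT => _ t0.
  by rewrite /F lee_fin; apply: mulr_ge0; [exact: mulr_ge0|exact: frac_integrand_ge0].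
transitivity (\int[lam]_(w in @Qt R n) \int[mu]_(t in I0) F (w, t))%E.
  apply: eq_integral => w /set_mem Qw; have [w0|w0] := eqVneq (row_of w) 0.
    rewrite w0 h00 mul0r integral0_eq// => t _.
    by rewrite /F/= w0 h00 mulr0 mul0r.
  rewrite /F/= ge0_integralZlR; last 4 first.
  - exact: mI.
  - exact: measurable_frac_integrand.
  - by move=> t /=; rewrite in_itv/= andbT => t0; exact: frac_integrand_ge0.
  - exact: mulr_ge0.
  by rewrite EFinM (@frac_kernelE _ _ sigma (row_of w))// muleCA EFinM muleA.
rewrite (tonelli_on _ _ (measurable_Qt (n := n)) mI mF F0)//.
apply: eq_integral => t; rewrite inE/= in_itv/= andbT => t0.
rewrite -ge0_integralZlR; last 4 first.
- exact: measurable_Qt.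
- apply: measurable_funTS; apply: measurable_funM => //.
  apply: measurable_heat => // i; exact: measurable_row_of.
- by move=> w _; rewrite mulr_ge0 ?heat_kernel_ge0.
- by rewrite mulr_ge0 ?powR_ge0.
apply: eq_integral => w _; rewrite /F/= frac_integrandE//; congr EFin; ring.
Qed.

Lemma mfunR_heat t : mfunR (@heat_kernel R n t).
Proof. by apply: measurable_heat => // i; exact: measurable_row_of. Qed.

Lemma heat_integrable t h (B : R) : 0 < t -> mfunR h -> (forall z, Q z -> `|h z| <= B) ->
  Rn_integrable Q (fun z => h z * heat_kernel t z).
Proof.
move=> t0 mh hB; have [C C0 HC] := @heat_kernel_bounded R n t t0; have hC := HC t (lexx t).
have B0 : 0 <= `|B| by [].
apply: (@bounded_Rn_integrable _ _ _ (`|B| * C)).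
  exact: measurable_funM mh (mfunR_heat t).
move=> z Qz; rewrite normrM ler_pM// ?(ger0_norm (heat_kernel_ge0 _ _))//.
by apply: le_trans (hB _ Qz) _; exact: ler_norm.
Qed.

Lemma integral_heat t h (B : R) : 0 < t -> mfunR h -> (forall z, Q z -> `|h z| <= B) ->
  (\int[lam]_(w in @Qt R n) (h (row_of w) * heat_kernel t (row_of w))%:E =
   (Rn_int Q (fun z => h z * heat_kernel t z))%:E)%E.
Proof.
by move=> t0 mh hB; rewrite -Rn_int_EFin//; exact: heat_integrable hB.
Qed.

Lemma Rn_int_heat_1Bcos t nu : 0 < t ->
  Rn_int Q (fun z => (1 - cos (dot (ivec R nu) z)) * heat_kernel t z) =
  1 - expR (- (t * enorm (ivec R nu) ^+ 2)).
Proof.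
move=> t0; have E nu' := Rn_int_heat_cos nu' t0.
have i nu' : Rn_integrable Q (fun z => heat_kernel t z * cos (dot (ivec R nu') z)).
  have := @heat_integrable t (fun z => cos (dot (ivec R nu') z)) 1 t0.
  under [X in _ -> _ -> Rn_integrable _ X]eq_fun do rewrite mulrC.
  apply; last by move=> z _; exact: cos_max.
  apply: continuous_mfunR; have := @continuous_cos_dot R n (ivec R nu') 0.
  by under eq_fun do rewrite addr0.
have E0 : Rn_int Q (fun z : 'rV[R]_n => heat_kernel t z * cos (dot (ivec R (0 : 'rV[int]_n)) z)) = 1.
  rewrite E (_ : enorm _ = 0) ?expr0n ?mulr0 ?oppr0 ?expR0//.
  by apply/eqP; rewrite enorm_eq0; apply/eqP/rowP => k; rewrite !mxE.
transitivity (Rn_int Q (fun z : 'rV[R]_n => heat_kernel t z * cos (dot (ivec R (0 : 'rV[int]_n)) z)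
    - heat_kernel t z * cos (dot (ivec R nu) z))); last by rewrite Rn_intB// E0 E.
apply: eq_Rn_int => z _; rewrite (_ : dot (ivec R 0) z = 0) ?cos0; first by ring.
by rewrite /dot big1// => k _; rewrite !mxE mul0r.
Qed.

Lemma Rn_int_kernel_1Bcos sigma nu : 0 < sigma < 2 ->
  (\int[lam]_(w in @Qt R n) ((1 - cos (dot (ivec R nu) (row_of w))) * frac_kernel sigma (row_of w))%:E
   = (enorm (ivec R nu) `^ sigma)%:E)%E.
Proof.
move=> /andP[s0 s2].
have s01 : 0 < sigma / 2 < 1 by rewrite divr_gt0//= ltr_pdivrMr// mul1r.
have mh : mfunR (fun z => 1 - cos (dot (ivec R nu) z)).
  apply: continuous_mfunR; apply: contB; first exact: contC.
  have := @continuous_cos_dot R n (ivec R nu) 0.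
  by under eq_fun do rewrite addr0.
rewrite (@integral_kernel sigma (fun z => 1 - cos (dot (ivec R nu) z)))//; last first.
  by rewrite /dot big1 ?cos0 ?subrr// => i _; rewrite !mxE mulr0.
have G0 : 0 < `|Gamma (- (sigma / 2))|.
  rewrite normr_GammaN//; have /andP[? ?] := s01.
  by rewrite divr_gt0// Gamma_gt0// subr_gt0.
transitivity (\int[mu]_(t in I0) (`|Gamma (- (sigma / 2))|^-1 *
   ((1 - expR (- (enorm (ivec R nu) ^+ 2 * t))) * t `^ (- (sigma / 2) - 1)))%:E)%E.
  apply: eq_integral => t; rewrite inE/= in_itv/= andbT => t0.
  rewrite (@integral_heat t (fun z => 1 - cos (dot (ivec R nu) z)) 2)//; last first.
    move=> z _; rewrite ger0_norm ?subr_ge0 ?cos_le1//.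
    by rewrite lerBlDr -lerBlDl (le_trans _ (cos_geN1 _))//; lra.
  by rewrite Rn_int_heat_1Bcos// -EFinM; congr EFin; rewrite (mulrC t); ring.
rewrite ge0_integralZlR; last 4 first.
- exact: measurable_itv.
- apply: measurable_funTS; apply: measurable_funM; last exact: measurable_powR.
  by apply: measurable_funB => //; apply: measurableT_comp => //; apply: measurableT_comp => //; exact: measurable_funM.
- move=> t /=; rewrite in_itv/= andbT => t0; rewrite mulr_ge0 ?powR_ge0// subr_ge0.
  by rewrite -expR0 ler_expR oppr_le0 mulr_ge0 ?sqr_ge0 ?ltW.
- by rewrite invr_ge0.
rewrite integral_1BexpR ?sqr_ge0// -EFinM mulrCA mulVf ?gt_eqF// mulr1.
rewrite -powR_mulrn ?enorm_ge0// -powRrM; congr (_ `^ _)%:E; by field.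
Qed.

(** It bounds second moments by integrals of [1 - cos]. The mean value theorem gives
    [sin y >= k * y] up to [pi / 4], monotonicity gives half that slope up to [pi / 2], and
    [1 - cos y = 2 * sin (y / 2)^2] yields the constant [8 / k^2]. *)
Lemma sqr_le_1Bcos : exists2 C : R, 0 < C &
  forall x : R, - pi <= x <= pi -> x ^+ 2 <= C * (1 - cos x).
Proof.
have p0 := @pi_gt0 R.
have k0 : 0 < cos (pi / 4) :> R by apply: cos_gt0_pihalf; apply/andP; split; lra.
set k := cos (pi / 4) in k0.
have k1 : k <= 1 := cos_le1 _.
have sin_ge (y : R) : 0 <= y <= pi / 4 -> k * y <= sin y.
  move=> /andP[y0 y4].
  have [|c + ] := @MVT_segment R sin cos 0 y y0.
  - by apply: continuous_subspaceT; exact: continuous_sin.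
  rewrite in_itv/= sin0 !subr0 => /andP[c0 cy] ->.
  rewrite ler_wpM2r// /k leNgt ltr_cos -?leNgt ?in_itv/=; last 2 first.
  - by apply/andP; split; lra.
  - by apply/andP; split; lra.
  exact: le_trans cy y4.
have sin_ge2 (y : R) : 0 <= y <= pi / 2 -> k / 2 * y <= sin y.
  move=> /andP[y0 y2]; have [y4|/ltW y4] := leP y (pi / 4).
    by apply: le_trans (sin_ge _ _); rewrite ?y0//; nra.
  apply: (@le_trans _ _ (sin (pi / 4))).
    by apply: le_trans (sin_ge _ _); [nra|apply/andP; split; lra].
  rewrite leNgt ltr_sin -?leNgt// in_itv/=; apply/andP; split; lra.
have pos (y : R) : 0 <= y <= pi -> y ^+ 2 <= (8 / k ^+ 2) * (1 - cos y).
  move=> /andP[y0 yp]; have h2 : 0 <= y / 2 <= pi / 2 by apply/andP; split; lra.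
  have := sin_ge2 _ h2; have -> : 1 - cos y = sin (y / 2) ^+ 2 *+ 2.
    rewrite -[y in cos y](_ : (y / 2) *+ 2 = y); last by rewrite mulr2n; lra.
    by rewrite cos_mulr2n cos2sin2; ring.
  move: (sin _) => s hs.
  have : (k / 2 * (y / 2)) ^+ 2 <= s ^+ 2.
    have h0 : 0 <= k / 2 * (y / 2) by rewrite mulr_ge0; nra.
    by rewrite ler_sqr ?nnegrE// (le_trans h0).
  rewrite -subr_ge0 => h; rewrite -subr_ge0.
  rewrite (_ : _ - _ = 16 / k ^+ 2 * (s ^+ 2 - (k / 2 * (y / 2)) ^+ 2)); last first.
    by field; rewrite gt_eqF.
  by apply: mulr_ge0 => //; apply: divr_ge0 => //; exact: sqr_ge0.
exists (8 / k ^+ 2); first by rewrite divr_gt0// exprn_gt0.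
move=> x /andP[xl xu]; have [x0|/ltW x0] := leP 0 x; first by apply: pos; rewrite x0.
by have := pos (- x); rewrite sqrrN cosN; apply; apply/andP; split; lra.
Qed.

Lemma Rn_int_sum (I : Type) (s : seq I) (F : I -> 'rV[R]_n -> R) :
  (forall i, Rn_integrable Q (F i)) ->
  Rn_integrable Q (fun x => \sum_(i <- s) F i x) /\
  Rn_int Q (fun x => \sum_(i <- s) F i x) = \sum_(i <- s) Rn_int Q (F i).
Proof.
move=> iF; elim: s => [|i s [IH1 IH2]].
  under [fun x => _]eq_fun do rewrite big_nil; rewrite big_nil; split.
    by apply: (bounded_Rn_integrable (c := 0)) => [|x _]; [exact: measurable_cst|rewrite normr0].
  rewrite /Rn_int Rintegral_cst ?mul0r//; exact: measurable_Qt.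
under [fun x => _]eq_fun do rewrite big_cons; rewrite big_cons; split.
  exact: Rn_integrableD.
by rewrite Rn_intD// IH2.
Qed.

Lemma continuous_enorm : continuous (@enorm R n).
Proof.
apply: (cont_comp _ (@sqrt_continuous R)); move=> x; rewrite /dot.
have ct : forall s : seq 'I_n, continuous (fun y : 'rV[R]_n => \sum_(i <- s) y 0 i * y 0 i).
  elim=> [|i s IH].
    by under eq_fun do rewrite big_nil; exact: contC.
  under eq_fun do rewrite big_cons.
  by apply: contD => //; apply: contM; exact: coord_continuous.
exact: ct.
Qed.

Lemma mfunR_enorm_powR a : mfunR (fun z : 'rV[R]_n => enorm z `^ a).
Proof.
exact: measurableT_comp (@measurable_powR R a) (continuous_mfunR continuous_enorm).
Qed.

Lemma enorm_sqr_le z : Q z -> enorm z ^+ 2 <= n%:R * pi ^+ 2.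
Proof.
move=> Qz; rewrite enorm_sqr (le_trans (ler_sum _ (G := fun _ => pi ^+ 2) _))//.
  move=> i _; have /andP[zl zu] := Qz i.
  rewrite -subr_ge0 subr_sqr mulr_ge0//; lra.
by rewrite sumr_const card_ord mulr_natl.
Qed.

Lemma enorm_powR_le a z : 0 <= a <= 2 -> enorm z `^ a <= 1 + enorm z ^+ 2.
Proof.
move=> /andP[a0 a2]; have e0 := enorm_ge0 z.
have [z1|/ltW z1] := leP (enorm z) 1.
  apply: (@le_trans _ _ 1); last by rewrite lerDl sqr_ge0.
  by have := ge0_ler_powR a0 e0 (ler01 : 1 \in Num.nneg) z1; rewrite powR1.
apply: (@le_trans _ _ (enorm z `^ 2)); first by rewrite ler_powR.
by rewrite powR_mulrn// lerDr.
Qed.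

Lemma heat_moment_integrable t a : 0 < t -> 0 <= a <= 2 ->
  Rn_integrable Q (fun z : 'rV[R]_n => enorm z `^ a * heat_kernel t z).
Proof.
move=> t0 a2; apply: (@heat_integrable _ _ (1 + n%:R * pi ^+ 2)) => //.
  exact: mfunR_enorm_powR.
move=> z Qz; rewrite ger0_norm ?powR_ge0//.
by apply: le_trans (enorm_powR_le _ a2) _; rewrite lerD2l enorm_sqr_le.
Qed.

Lemma Rn_int_heat t : 0 < t -> Rn_int Q (@heat_kernel R n t) = 1.
Proof.
move=> t0; have := Rn_int_heat_cos (0 : 'rV[int]_n) t0.
rewrite (_ : enorm _ = 0) ?expr0n ?mulr0 ?oppr0 ?expR0; last first.
  by apply/eqP; rewrite enorm_eq0; apply/eqP/rowP => k; rewrite !mxE.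
move=> <-; apply: eq_Rn_int => z _.
rewrite (_ : dot (ivec R 0) z = 0) ?cos0 ?mulr1//.
by rewrite /dot big1// => k _; rewrite !mxE mul0r.
Qed.

(** By [sqr_le_1Bcos] each squared coordinate is at most [C * (1 - cos z_i)], whose integral against
    the heat kernel is [C * (1 - exp (- t)) <= C * t]. *)
Lemma heat_second_moment : exists2 C : R, 0 <= C & forall t, 0 < t ->
  Rn_int Q (fun z : 'rV[R]_n => enorm z `^ 2 * heat_kernel t z) <= C * t.
Proof.
have [C C0 HC] := sqr_le_1Bcos.
exists (n%:R * C); first by rewrite mulr_ge0// ltW.
move=> t t0; pose e (i : 'I_n) : 'rV[int]_n := delta_mx 0 i.
have de i z : dot (ivec R (e i)) z = z 0 i.
  rewrite /dot (bigD1 i)//= !mxE !eqxx mul1r big1 ?addr0// => j ji.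
  by rewrite !mxE (negbTE ji) andbF mul0r.
have ee i : enorm (ivec R (e i)) ^+ 2 = 1.
  rewrite enorm_sqr (bigD1 i)//= !mxE !eqxx expr1n big1 ?addr0// => j ji.
  by rewrite !mxE (negbTE ji) andbF expr0n.
pose F i z := C * ((1 - cos (dot (ivec R (e i)) z)) * heat_kernel t z).
have iF0 i : Rn_integrable Q (fun z => (1 - cos (dot (ivec R (e i)) z)) * heat_kernel t z).
  apply: (@heat_integrable _ (fun z => 1 - cos (dot (ivec R (e i)) z)) 2) => //.
    apply: continuous_mfunR; apply: contB; first exact: contC.
    have := @continuous_cos_dot R n (ivec R (e i)) 0.
    by under eq_fun do rewrite addr0.
  move=> z _; rewrite ger0_norm ?subr_ge0 ?cos_le1//.
  by rewrite lerBlDr -lerBlDl (le_trans _ (cos_geN1 _))//; lra.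
have iF i : Rn_integrable Q (F i) by exact: Rn_integrableZ.
have [I1 I2] := Rn_int_sum (index_enum 'I_n) iF.
apply: (@le_trans _ _ (\sum_(i < n) Rn_int Q (F i))).
  rewrite -I2; apply: le_Rn_int I1 _; first by apply: heat_moment_integrable => //; rewrite lexx ler0n.
  move=> z Qz; rewrite powR_mulrn ?enorm_ge0// enorm_sqr mulr_suml; apply: ler_sum => i _.
  rewrite /F mulrA ler_wpM2r ?heat_kernel_ge0// de; apply: HC.
  by have /andP[zl zu] := Qz i; rewrite ltW.
apply: (@le_trans _ _ (\sum_(i < n) C * t)).
  apply: ler_sum => i _; rewrite /F Rn_intZ// ler_wpM2l ?(ltW C0)// Rn_int_heat_1Bcos// ee mulr1.
  by have := expR_ge1Dx (- t); lra.
by rewrite sumr_const card_ord -[leLHS]mulr_natl mulrA.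
Qed.

(** The first bound interpolates between orders 0 and 2: with [y = |z|^2 / t], [y^(a / 2) <= 1 + y].
    The second uses that the cell is bounded and the kernel has mass 1. *)
Lemma heat_moment a : 0 < a <= 2 -> exists2 M : R, 0 <= M & forall t, 0 < t ->
  Rn_int Q (fun z : 'rV[R]_n => enorm z `^ a * heat_kernel t z) <= M * t `^ (a / 2) /\
  Rn_int Q (fun z : 'rV[R]_n => enorm z `^ a * heat_kernel t z) <= M.
Proof.
move=> /andP[a0 a2]; have [C C0 HC] := heat_second_moment.
have P0 : 0 <= n%:R * pi ^+ 2 :> R by rewrite mulr_ge0 ?sqr_ge0.
exists (1 + C + n%:R * pi ^+ 2); first by rewrite !addr_ge0.
move=> t t0.
have iW : Rn_integrable Q (@heat_kernel R n t).
  have [C1 C10 hC1] := @heat_kernel_bounded R n t t0; have HC1 := hC1 t (lexx t).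
  apply: (bounded_Rn_integrable (c := C1)) => [|z _]; first exact: mfunR_heat.
  by rewrite ger0_norm ?heat_kernel_ge0.
have ia : Rn_integrable Q (fun z : 'rV[R]_n => enorm z `^ a * heat_kernel t z).
  by apply: heat_moment_integrable; rewrite ?(ltW a0).
have i2 : Rn_integrable Q (fun z : 'rV[R]_n => enorm z `^ 2 * heat_kernel t z).
  by apply: heat_moment_integrable; rewrite ?ler0n//=.
split.
  have ta : 0 < t `^ (a / 2) by rewrite powR_gt0.
  apply: (@le_trans _ _ (Rn_int Q (fun z : 'rV[R]_n => t `^ (a / 2) * heat_kernel t z +
      t `^ (a / 2) / t * (enorm z `^ 2 * heat_kernel t z)))).
    apply: le_Rn_int => //; first by apply: Rn_integrableD; exact: Rn_integrableZ.
    move=> z Qz; rewrite mulrA -mulrDl ler_wpM2r ?heat_kernel_ge0//.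
    have y0 : 0 <= enorm z ^+ 2 / t by rewrite divr_ge0 ?sqr_ge0 ?ltW.
    have -> : enorm z `^ a = t `^ (a / 2) * (enorm z ^+ 2 / t) `^ (a / 2).
      rewrite -powRM ?(ltW t0)// mulrC divfK ?gt_eqF//.
      rewrite -powR_mulrn ?enorm_ge0// -powRrM; congr (_ `^ _); by field.
    rewrite -mulrA -[X in _ <= X + _]mulr1 -mulrDr ler_wpM2l ?(ltW ta)//.
    rewrite powR_mulrn ?enorm_ge0// [t^-1 * _]mulrC.
    move: (_ / t) y0 => y y0; have [y1|/ltW y1] := leP y 1.
      apply: (@le_trans _ _ 1); last by rewrite lerDl.
      have := ge0_ler_powR (ltW (divr_gt0 a0 (ltr0n R 2))) y0 (ler01 : 1 \in Num.nneg) y1.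
      by rewrite powR1.
    apply: (@le_trans _ _ (y `^ 1)); last by rewrite powRr1// lerDr.
    by rewrite ler_powR// ler_pdivrMr// mul1r.
  rewrite Rn_intD; [|exact: Rn_integrableZ..].
  rewrite !Rn_intZ// Rn_int_heat// mulr1 mulrDl mulrDl mul1r -addrA lerD2l.
  rewrite -[leLHS]addr0; apply: lerD; last by rewrite mulr_ge0// ltW.
  rewrite -mulrA [leRHS]mulrC ler_wpM2l ?(ltW ta)//.
  by rewrite mulrC ler_pdivrMr// HC.
apply: (@le_trans _ _ (Rn_int Q (fun z : 'rV[R]_n => (1 + n%:R * pi ^+ 2) * heat_kernel t z))).
  apply: le_Rn_int => //; first exact: Rn_integrableZ.
  move=> z Qz; rewrite ler_wpM2r ?heat_kernel_ge0//.
  apply: le_trans (enorm_powR_le _ _) _; first by rewrite ltW.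
  by rewrite lerD2l enorm_sqr_le.
by rewrite Rn_intZ// Rn_int_heat// mulr1 lerD2r lerDl.
Qed.

Lemma kernel_moment sigma a : 0 < sigma < 2 -> sigma < a <= 2 ->
  Rn_integrable Q (fun z : 'rV[R]_n => enorm z `^ a * frac_kernel sigma z).
Proof.
move=> /andP[s0 s2] /andP[sa a2]; have a0 : 0 < a := lt_trans s0 sa.
have [M M0 HM] := @heat_moment a ltac:(by rewrite a0).
apply: ge0_Rn_integrable.
- exact: measurable_funM (mfunR_enorm_powR a) (mfunR_frac_kernel sigma).
- by move=> z _; rewrite mulr_ge0 ?powR_ge0 ?frac_kernel_ge0.
rewrite (@integral_kernel sigma (fun z => enorm z `^ a)); last 4 first.
- exact: s0.
- exact: mfunR_enorm_powR.
- by move=> z; exact: powR_ge0.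
- rewrite (_ : enorm 0 = 0) ?powR0 ?gt_eqF//.
  by apply/eqP; rewrite enorm_eq0.
set c := `|_|^-1; have c0 : 0 <= c by rewrite invr_ge0.
pose b := (a - sigma) / 2.
have b0 : 0 < b by rewrite divr_gt0// subr_gt0.
have sg0 : 0 < sigma / 2 by rewrite divr_gt0.
have i1 := integral_inverse_gauss_lty sg0 ltr01.
have i2 : mu.-integrable I0 (EFin \o (fun t : R => t `^ (b - 1) * expR (- t))).
  apply: ge0_fin_integrable.
  - exact: measurable_itv.
  - apply: measurable_funTS; apply: measurable_funM; first exact: measurable_powR.
    exact: measurable_expRN.
  - by move=> t _; rewrite mulr_ge0 ?powR_ge0 ?expR_ge0.
  - exact: egamma_lty.
have mI : measurable (I0 : set RT) by exact: measurable_itv.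
(* Up to time 1 the moment bound leaves [t^(b - 1)], integrable at [0] because [sigma < a]; beyond
   it, [t^(- (sigma / 2) - 1)]. The exponentials turn both into convergent integrals over the
   half-line and cost only [expR 1]. *)
pose G (t : R) : R := (c * M * expR 1) * (t `^ (- (sigma / 2) - 1) * expR (- (1 / t))) +
   (c * M * expR 1) * (t `^ (b - 1) * expR (- t)).
have iG : mu.-integrable I0 (EFin \o G).
  have := integrableRD mI (integrableRZ mI (c * M * expR 1) i1) (integrableRZ mI (c * M * expR 1) i2).
  exact.
apply: (@le_lt_trans _ _ (\int[mu]_(t in I0) (G t)%:E)%E); last first.
  by have /fin_numPlt/andP[] := integrable_fin_num mI iG.
apply: ge0_le_integral => //.
- move=> t; rewrite /= in_itv/= andbT => t0; rewrite mule_ge0//.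
    by rewrite lee_fin mulr_ge0 ?powR_ge0.
  by apply: integral_ge0 => w _; rewrite lee_fin mulr_ge0 ?powR_ge0 ?heat_kernel_ge0.
- apply: emeasurable_funM.
    by apply/measurable_EFinP; apply: measurable_funTS; apply: measurable_funM.
  apply: (@measurable_fun_tonelli_on _ _ _ _ R lam I0 (@Qt R n) mI (measurable_Qt (n := n))
    (fun p : RT * n.-tuple RT => (enorm (row_of p.2) `^ a * heat_kernel p.1 (row_of p.2))%:E)).
    apply/measurable_EFinP; apply: measurable_funTS; apply: measurable_funM.
      exact: measurableT_comp (mfunR_enorm_powR a) measurable_snd.
    apply: measurable_heat => // i.
    exact: measurableT_comp (measurable_row_of i) measurable_snd.
  move=> t w; rewrite /= in_itv/= andbT => t0 _.
  by rewrite lee_fin mulr_ge0 ?powR_ge0 ?heat_kernel_ge0.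
- by have /measurable_int := iG.
move=> t; rewrite /= in_itv/= andbT => t0.
have [H1 H2] := HM t t0.
rewrite (Rn_int_EFin (heat_moment_integrable t0 _)) ?(ltW a0)// -EFinM lee_fin.
have e10 : 0 <= expR 1 :> R := expR_ge0 _.
have [t1|t1] := leP t 1.
  apply: (@le_trans _ _ ((c * M * expR 1) * (t `^ (b - 1) * expR (- t)))); last first.
    by rewrite lerDr !mulr_ge0 ?powR_ge0 ?expR_ge0.
  apply: (@le_trans _ _ (c * t `^ (- (sigma / 2) - 1) * (M * t `^ (a / 2)))).
    by rewrite ler_wpM2l// mulr_ge0 ?powR_ge0.
  have -> : b - 1 = (- (sigma / 2) - 1) + a / 2 by rewrite /b; field.
  rewrite (@powRD_gt0 _ t (- (sigma / 2) - 1) (a / 2))//.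
  have h : 1 <= expR 1 * expR (- t) by rewrite -expRD -[leLHS]expR0 ler_expR subr_ge0.
  rewrite [leRHS](_ : _ = c * t `^ (- (sigma / 2) - 1) * (M * t `^ (a / 2)) * (expR 1 * expR (- t))); last by ring.
  by rewrite ler_peMr// !mulr_ge0 ?powR_ge0.
apply: (@le_trans _ _ ((c * M * expR 1) * (t `^ (- (sigma / 2) - 1) * expR (- (1 / t))))); last first.
  by rewrite lerDl !mulr_ge0 ?powR_ge0 ?expR_ge0.
apply: (@le_trans _ _ (c * t `^ (- (sigma / 2) - 1) * M)).
  by rewrite ler_wpM2l// mulr_ge0 ?powR_ge0.
have h : 1 <= expR 1 * expR (- (1 / t)).
  rewrite -expRD -[leLHS]expR0 ler_expR subr_ge0 div1r invf_le1//; exact: ltW.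
rewrite [leRHS](_ : _ = c * t `^ (- (sigma / 2) - 1) * M * (expR 1 * expR (- (1 / t)))); last by ring.
by rewrite ler_peMr// !mulr_ge0 ?powR_ge0.
Qed.

End kernel.

(** * Fourier series of smooth functions *)

Section periodic_functions.
Context {R : realType} {n : nat}.
Local Notation lam := (lebesgue_tuple R n).
Implicit Types (f g u P : 'rV[R]_n -> R) (x y z : 'rV[R]_n) (i : 'I_n) (nu : 'rV[int]_n).

Definition wrap x : 'rV[R]_n := x + (2 * pi) *: ivec R (\row_i - cellrepz (x 0 i)).

Lemma wrap_Q x : Q (wrap x).
Proof.
move=> i; rewrite !mxE; have := cellrep_cell (x 0 i).
by rewrite /cell /cellrep /= in_itv/= mulrNz mulrN.
Qed.

Lemma periodic_bounded f : Defs.periodic f -> continuous f ->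
  exists2 B : R, 0 <= B & forall x, `|f x| <= B.
Proof.
move=> pf cf.
pose K : set 'rV[R]_n := [set v | forall i, (`[- pi, pi]%classic : set R) (v ord0 i)].
have cK : compact K.
  exact: (@rV_compact R n (fun=> `[- pi, pi]%classic) (fun=> @segment_compact R _ _)).
have KQ x : Q x -> K x.
  by move=> Qx i; have /andP[xl xu] := Qx i; rewrite /= in_itv/= ltW.
have cn : continuous (fun x => `|f x|) by apply: (cont_comp cf); exact: norm_continuous.
have K0 : K !=set0 by exists (wrap 0); apply: KQ; exact: wrap_Q.
have [c _ Hc] := compact_EVT_max K0 cK (continuous_subspaceT cn).
exists `|f c| => // x; have <- : f (wrap x) = f x by exact: pf.
by apply: Hc; rewrite inE; apply: KQ; exact: wrap_Q.
Qed.

Lemma line_derive f x (v : 'rV[R]_n) (s : R) : derivable f (x + s *: v) v ->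
  is_derive s (1 : R) (fun s => f (x + s *: v)) ('D_v f (x + s *: v)).
Proof.
move=> df.
have E : (fun h : R => h^-1 *: (((fun s => f (x + s *: v)) \o shift s) (h *: 1) - f (x + s *: v))) =
    (fun h : R => h^-1 *: ((f \o shift (x + s *: v)) (h *: v) - f (x + s *: v))).
  apply/funext => h /=; rewrite /shift; congr (_ *: (f _ - _)).
  by rewrite scalerDl addrCA -scalerA scale1r.
by apply: DeriveDef; rewrite /derivable /derive E.
Qed.

(** A partial derivative expressed as an ordinary derivative along a coordinate line, so that the
    product rule and the mean value theorem of one variable apply. *)
Definition partial_is i P P' := forall x,
  is_derive (0 : R) (1 : R) (fun s => P (x + s *: Defs.basis R i)) (P' x).

Lemma partial_is_at i P P' x (s : R) : partial_is i P P' ->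
  is_derive s (1 : R) (fun s => P (x + s *: Defs.basis R i)) (P' (x + s *: Defs.basis R i)).
Proof.
move=> pP; have h := pP (x + s *: Defs.basis R i).
have h2 : is_derive s (1 : R) (fun r : R => r - s) 1.
  have := derD (der_id s) (derN (der_cst s s)); rewrite oppr0 addr0; exact.
rewrite -(subrr s) in h.
have := @der_comp R (fun r => P (x + s *: Defs.basis R i + r *: Defs.basis R i)) (fun r : R => r - s) s _ _ h h2.
rewrite mulr1.
congr is_derive; apply/funext => r.
by rewrite -addrA -scalerDl addrCA subrr addr0.
Qed.

Lemma partial_is_derive i f : (forall x, derivable f x (Defs.basis R i)) ->
  partial_is i f (fun x => 'D_(Defs.basis R i) f x).
Proof.
move=> df x; have := @line_derive f x (Defs.basis R i) 0.
by rewrite scale0r addr0; apply; exact: df.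
Qed.

Lemma partial_isM i f f' g g' : partial_is i f f' -> partial_is i g g' ->
  partial_is i (fun x => f x * g x) (fun x => f' x * g x + f x * g' x).
Proof. by move=> pf pg x; have := derM (pf x) (pg x); rewrite scale0r addr0. Qed.

Lemma dot_basis (v : 'rV[R]_n) i : dot v (Defs.basis R i) = v 0 i.
Proof.
rewrite /dot (bigD1 i)//= !mxE !eqxx mulr1 big1 ?addr0// => j ji.
by rewrite !mxE (negbTE ji) andbF mulr0.
Qed.

Lemma partial_is_cos i (v : 'rV[R]_n) (theta : R) :
  partial_is i (fun y => cos (theta - dot v y)) (fun y => v 0 i * sin (theta - dot v y)).
Proof.
move=> x.
have d : is_derive (0 : R) (1 : R) (fun s => theta - dot v (x + s *: Defs.basis R i)) (- v 0 i).
  have -> : (fun s => theta - dot v (x + s *: Defs.basis R i)) = fun s => (theta - dot v x) + - (s * v 0 i).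
    by apply/funext => s; rewrite dotDr dotZr dot_basis opprD addrA.
  have := derD (der_cst (0 : R) (theta - dot v x)) (derN (derM (der_id 0) (der_cst 0 (v 0 i)))).
  by rewrite add0r mulr0 addr0 mul1r.
have := @der_comp R cos _ _ _ _ (is_derive_cos _) d.
by rewrite scale0r addr0 mulrN mulNr opprK mulrC.
Qed.

Lemma partial_is_mvt i P P' x (h : R) : 0 <= h -> partial_is i P P' ->
  exists2 c, 0 <= c <= h & P (x + h *: Defs.basis R i) - P x = P' (x + c *: Defs.basis R i) * h.
Proof.
move=> h0 pP.
have d s : is_derive s (1 : R) (fun s => P (x + s *: Defs.basis R i)) (P' (x + s *: Defs.basis R i)).
  exact: partial_is_at.
have [|c + ] := MVT_segment h0 (fun s _ => d s).
  by apply: continuous_subspaceT; exact: der_continuous d.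
by rewrite in_itv/= scale0r addr0 subr0; exists c.
Qed.

Lemma Rn_int_cvg (F : nat -> 'rV[R]_n -> R) f g : (forall k, mfunR (F k)) -> mfunR f ->
  Rn_integrable Q g -> (forall k x, Q x -> `|F k x| <= g x) ->
  (forall x, Q x -> F ^~ x @ \oo --> f x) ->
  Rn_int Q (F k) @[k --> \oo] --> Rn_int Q f.
Proof.
move=> mF mf ig Fg Ff.
have iF k : Rn_integrable Q (F k) by apply: le_Rn_integrable ig (Fg k).
have [|||||i1 _ H] := @dominated_convergence _ _ _ lam (@Qt R n) (measurable_Qt (n := n))
    (fun k => EFin \o F k \o @row_of R n) (EFin \o f \o @row_of R n) (EFin \o g \o @row_of R n).
- by move=> k; apply/measurable_EFinP; exact: measurable_funTS (mF k).
- by apply/measurable_EFinP; exact: measurable_funTS mf.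
- by apply/aeW => w Qw; apply: cvg_EFin; [exact: nearW|exact: Ff].
- exact: ig.
- by apply/aeW => w k Qw /=; rewrite lee_fin; exact: Fg.
have H' : [sequence (\int[lam]_(w in @Qt R n) (F k (row_of w))%:E)%E]_k @ \oo --> (Rn_int Q f)%:E.
  by rewrite -(Rn_int_EFin i1); exact: H.
exact: fine_cvg H'.
Qed.

Lemma continuous_line f x (v : 'rV[R]_n) : continuous f -> continuous (fun s : R => f (x + s *: v)).
Proof.
move=> cf s; apply: (cvg_comp (fun s : R => x + s *: v) f _ (cf _)).
apply: cvgD; first exact: cvg_cst.
exact: scalel_continuous.
Qed.

(** Difference quotients of [P] have integral zero by translation invariance. They are values of
    [P'], hence bounded, and converge to [P']. *)
Lemma Rn_int_partial i P P' : Defs.periodic P -> continuous P -> Defs.periodic P' -> continuous P' ->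
  partial_is i P P' -> Rn_int Q P' = 0.
Proof.
move=> pP cP pP' cP' d; have [B B0 HB] := periodic_bounded pP' cP'.
pose h (k : nat) : R := k.+1%:R^-1.
have h0 k : 0 < h k by rewrite invr_gt0.
pose F k x := (h k)^-1 * (P (x + h k *: Defs.basis R i) - P x).
have cPs k : continuous (fun x => P (x + h k *: Defs.basis R i)).
  move=> x; apply: (@continuous_comp _ _ _ (fun x => x + h k *: Defs.basis R i) P); last exact: cP.
  exact: (continuousD (@cvg_id _ _) (@cvg_cst _ _ _ _ _)).
have cF k : continuous (F k) by apply: contM; [exact: contC|exact: contB].
have bP f : Defs.periodic f -> continuous f -> Rn_integrable Q f.
  move=> pf cf; have [C _ HC] := periodic_bounded pf cf.
  by apply: (bounded_Rn_integrable (c := C)) => //; exact: continuous_mfunR.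
have F0 k : Rn_int Q (F k) = 0.
  have p2 : Defs.periodic (fun x => P (x + h k *: Defs.basis R i)).
    by move=> x nu; rewrite addrAC pP.
  rewrite /F Rn_intZ; last by apply: Rn_integrableB; exact: bP.
  rewrite Rn_intB; [|exact: bP..].
  by rewrite Rn_int_shift ?subrr ?mulr0//; exact: continuous_mfunR.
have C : (fun k => Rn_int Q (F k)) @ \oo --> Rn_int Q P'; last first.
  have C0 : (fun k => Rn_int Q (F k)) @ \oo --> (0 : R).
    by under eq_fun do rewrite F0; exact: cvg_cst.
  exact: (cvg_unique _ C C0).
apply: (Rn_int_cvg (g := fun=> B)).
- by move=> k; exact: continuous_mfunR.
- exact: continuous_mfunR.
- apply: (bounded_Rn_integrable (c := B)) => [|x _]; first exact: measurable_cst.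
  by rewrite ger0_norm.
- move=> k x Qx; have [c c0 E] := partial_is_mvt x (ltW (h0 k)) d.
  by rewrite /F E mulrCA mulVf ?mulr1 ?HB// gt_eqF.
- move=> x Qx.
  have /choice[c Hc] k : exists c, 0 <= c <= h k /\ F k x = P' (x + c *: Defs.basis R i).
    have [c c0 E] := partial_is_mvt x (ltW (h0 k)) d.
    by exists c; split; rewrite // /F E mulrCA mulVf ?mulr1// gt_eqF.
  rewrite (_ : F ^~ x = fun k => P' (x + c k *: Defs.basis R i)); last first.
    by apply/funext => k; have [] := Hc k.
  have c00 : c @ \oo --> (0 : R).
    apply: (@squeeze_cvgr _ _ _ _ (cst 0) h); last 2 first.
    - exact: cvg_cst.
    - exact: (@cvg_harmonic R).
    by apply: nearW => k; have [] := Hc k.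
  have ct := @continuous_line P' x (Defs.basis R i) cP' 0; rewrite -[x in P' x](addr0 x) -(scale0r (Defs.basis R i)).
  exact: (cvg_comp _ _ c00 ct).
Qed.

Lemma periodic_partial i f : Defs.periodic f -> Defs.periodic (fun x => 'D_(Defs.basis R i) f x).
Proof.
move=> pf x nu; rewrite /derive.
set F := fun h => _; set G := fun h => _; suff -> : F = G by [].
by apply/funext => h; rewrite /F /G/= /shift/= addrA !pf.
Qed.

Lemma le_enorm y z : (forall j, `|y 0 j| <= `|z 0 j|) -> enorm y <= enorm z.
Proof.
move=> yz; rewrite -(@ler_pXn2r _ 2)// ?nnegrE ?enorm_ge0// !enorm_sqr.
by apply: ler_sum => j _; rewrite -[leLHS]real_normK ?num_real// -[leRHS]real_normK ?num_real// lerXn2r ?nnegrE.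
Qed.

(** Only derivatives in coordinate directions are given, so the mean value theorem is applied along
    a staircase from [x] to [x - z]. The points of the staircase differ from [x] by at most [|z_j|]
    in each coordinate. *)
Lemma telescope_coords f x z : (forall i x, derivable f x (Defs.basis R i)) ->
  exists xi : 'I_n -> 'rV[R]_n, (forall i, enorm (x - xi i) <= enorm z) /\
  f x - f (x - z) = \sum_i z 0 i * 'D_(Defs.basis R i) f (xi i).
Proof.
move=> df.
pose y (k : nat) : 'rV[R]_n := x - \row_j (if (j < k)%N then z 0 j else 0).
have y0 : y 0%N = x by rewrite /y (_ : \row_j _ = 0) ?subr0//; apply/rowP => j; rewrite !mxE.
have yn : y n = x - z by congr (_ - _); apply/rowP => j; rewrite !mxE ltn_ord.
have yS (i : 'I_n) : y i = y i.+1 + z 0 i *: Defs.basis R i.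
  rewrite /y; apply/rowP => j; rewrite !mxE ltnS eqxx/=.
  have [->|ji] := eqVneq j i; first by rewrite ltnn leqnn mulr1 subr0 subrK.
  by rewrite mulr0 addr0 [(j <= i)%N]leq_eqVlt val_eqE (negbTE ji).
have step i : exists xi, enorm (x - xi) <= enorm z /\
    f (y i) - f (y i.+1) = z 0 i * 'D_(Defs.basis R i) f xi.
  have pi := partial_is_derive (df i).
  suff [c cz E] : exists2 c, `|z 0 i - c| <= `|z 0 i| & f (y i) - f (y i.+1) =
      z 0 i * 'D_(Defs.basis R i) f (y i.+1 + c *: Defs.basis R i).
    exists (y i.+1 + c *: Defs.basis R i); split => //.
    apply: le_enorm => j; rewrite /y !mxE eqxx/= ltnS.
    have [->|ji] := eqVneq j i.
      by rewrite leqnn mulr1 (_ : _ - _ = z 0 i - c)//; ring.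
    rewrite mulr0 addr0 opprB addrC subrK.
    by case: ifP; rewrite ?normr0.
  (* The mean value theorem is stated for forward steps, so the segment is traversed from its other
     end when [z 0 i] is negative. *)
  have [z0|/ltW z0] := leP 0 (z 0 i).
    have [c /andP[c0 cz] E] := partial_is_mvt (y i.+1) z0 pi.
    exists c; last by rewrite yS E mulrC.
    by rewrite !ger0_norm ?subr_ge0// lerBlDr lerDl.
  have [|c /andP[c0 cz] E] := @partial_is_mvt i f _ (y i) (- z 0 i) _ pi; first by rewrite oppr_ge0.
  exists (z 0 i + c).
    by rewrite opprD addrA subrr sub0r normrN ger0_norm// ler0_norm.
  rewrite scalerDl addrA -yS.
  have -> : y i.+1 = y i + - z 0 i *: Defs.basis R i by rewrite yS scaleNr addrK.
  by rewrite -opprB E mulrN opprK mulrC.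
have [xi Hxi] := choice step.
exists xi; split; first by move=> i; have [] := Hxi i.
rewrite -yn -[x in f x - _]y0.
under eq_bigr do rewrite -(proj2 (Hxi _)).
rewrite -(big_mkord xpredT (fun k => f (y k) - f (y k.+1))).
under eq_bigr do rewrite -opprB.
by rewrite sumrN telescope_sumr// opprB.
Qed.

Definition smooth u := Defs.periodic u /\ forall k, Ck k u.

Lemma partials_cat (s t : seq 'I_n) f : partials (s ++ t) f = partials s (partials t f).
Proof. by elim: s => //= i s ->. Qed.

Lemma smooth_partial i u : smooth u -> smooth (fun x => 'D_(Defs.basis R i) u x).
Proof.
move=> [pu su]; split; first exact: periodic_partial.
move=> k; have [d c] := su k.+1; split => s sk.
  move=> j x; have := d (s ++ [:: i]); rewrite partials_cat/=.
  by apply; rewrite size_cat addn1 ltnS.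
have := c (s ++ [:: i]); rewrite partials_cat/=.
by apply; rewrite size_cat addn1 ltnS.
Qed.

Lemma smooth_continuous u : smooth u -> continuous u.
Proof. by move=> [_ su]; have [_ c] := su 0%N; exact: (c [::]). Qed.

Lemma smooth_partial_is i u : smooth u -> partial_is i u (fun x => 'D_(Defs.basis R i) u x).
Proof. by move=> [_ su]; apply: partial_is_derive => x; have [d _] := su 1%N; exact: (d [::]). Qed.

Lemma smooth_bounded u : smooth u -> exists2 B : R, 0 <= B & forall x, `|u x| <= B.
Proof. by move=> su; apply: periodic_bounded; [case: su|exact: smooth_continuous]. Qed.

Lemma cosBpi2_ivec nu mu (y : R) :
  cos (y - dot (ivec R nu) ((2 * pi) *: ivec R mu)) = cos y.
Proof. by rewrite -dotNl -ivecN cosDpi2_ivec. Qed.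

Lemma continuous_cosB (v : 'rV[R]_n) (theta : R) : continuous (fun y => cos (theta - dot v y)).
Proof.
apply: (cont_comp _ (@continuous_cos R)).
by apply: contB; [exact: contC|exact: continuous_dot].
Qed.

Lemma sin_cosB (y : R) : sin y = cos (y - pi / 2).
Proof. by rewrite cosB cos_pihalf sin_pihalf mulr0 add0r mulr1. Qed.

Definition osc nu u (theta : R) := Rn_int Q (fun y => u y * cos (theta - dot (ivec R nu) y)).

Lemma osc_integrable nu u theta : Defs.periodic u -> continuous u ->
  Rn_integrable Q (fun y => u y * cos (theta - dot (ivec R nu) y)).
Proof.
move=> pu cu; have [B B0 HB] := periodic_bounded pu cu.
apply: (bounded_Rn_integrable (c := B)) => [|y _].
  by apply: continuous_mfunR; apply: contM => //; exact: continuous_cosB.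
by rewrite normrM -[leRHS]mulr1 ler_pM ?cos_max.
Qed.

(** Integration by parts on the torus. A phase shift by [pi / 2] writes the resulting sine as a
    cosine, so that the class of integrals [osc] is closed under differentiation. *)
Lemma osc_partial nu u theta i : smooth u ->
  osc nu (fun x => 'D_(Defs.basis R i) u x) theta = - (nu 0 i)%:~R * osc nu u (theta - pi / 2).
Proof.
move=> su; have sd := smooth_partial i su.
have [pu cu] : Defs.periodic u /\ continuous u by split; [case: su|exact: smooth_continuous].
have [pd cd] : Defs.periodic (fun x => 'D_(Defs.basis R i) u x) /\ continuous (fun x => 'D_(Defs.basis R i) u x).
  by split; [case: sd|exact: smooth_continuous].
have sE y : ivec R nu 0 i * sin (theta - dot (ivec R nu) y) =
    (nu 0 i)%:~R * cos (theta - pi / 2 - dot (ivec R nu) y).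
  by rewrite mxE sin_cosB addrAC.
have pc th : Defs.periodic (fun y => cos (th - dot (ivec R nu) y)).
  by move=> y mu; rewrite dotDr opprD addrA cosBpi2_ivec.
have ps : Defs.periodic (fun y => ivec R nu 0 i * sin (theta - dot (ivec R nu) y)).
  by move=> y mu; rewrite !sE pc.
have cs : continuous (fun y => ivec R nu 0 i * sin (theta - dot (ivec R nu) y)).
  by under eq_fun do rewrite sE; apply: contM; [exact: contC|exact: continuous_cosB].
apply/eqP; rewrite mulNr -addr_eq0 /osc -Rn_intZ; last exact: osc_integrable.
rewrite -Rn_intD; last 2 first.
- exact: osc_integrable.
- by apply: Rn_integrableZ; exact: osc_integrable.
apply/eqP; transitivity (Rn_int Q (fun y => 'D_(Defs.basis R i) u y * cos (theta - dot (ivec R nu) y) +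
    u y * (ivec R nu 0 i * sin (theta - dot (ivec R nu) y)))).
  by apply: eq_Rn_int => y _; rewrite sE; ring.
apply: (Rn_int_partial _ _ _ _ (partial_isM (smooth_partial_is i su) (partial_is_cos i (ivec R nu) theta))).
- by move=> x mu; rewrite pu pc.
- by apply: contM => //; exact: continuous_cosB.
- by move=> x mu; rewrite pd pu pc ps.
- by apply: contD; apply: contM => //; exact: continuous_cosB.
Qed.

Lemma osc_partial2 nu u theta i : smooth u ->
  (nu 0 i)%:~R ^+ 2 * osc nu u theta =
  - osc nu (fun x => 'D_(Defs.basis R i) (fun y => 'D_(Defs.basis R i) u y) x) theta.
Proof.
move=> su; rewrite osc_partial; last exact: smooth_partial.
rewrite osc_partial//.
have -> : osc nu u (theta - pi / 2 - pi / 2) = - osc nu u theta.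
  transitivity (Rn_int Q (fun y => - 1 * (u y * cos (theta - dot (ivec R nu) y)))); last first.
    rewrite Rn_intZ ?mulN1r//.
    by apply: osc_integrable; [case: su|exact: smooth_continuous].
  apply: eq_Rn_int => y _.
  have -> : theta - pi / 2 - pi / 2 - dot (ivec R nu) y = (theta - dot (ivec R nu) y) - pi by field.
  by rewrite cosB cospi sinpi; ring.
ring.
Qed.

Lemma osc_le u : smooth u -> exists2 C : R, 0 <= C & forall nu theta, `|osc nu u theta| <= C.
Proof.
move=> su; have [B B0 HB] := smooth_bounded su.
have ic : Rn_integrable Q (fun _ : 'rV[R]_n => B).
  apply: (bounded_Rn_integrable (c := B)) => [|x _]; first exact: measurable_cst.
  by rewrite ger0_norm.
exists (Rn_int Q (fun _ : 'rV[R]_n => B)); first by apply: Rintegral_ge0.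
move=> nu theta; apply: norm_Rn_int_le => //.
  by apply: osc_integrable; [case: su|exact: smooth_continuous].
move=> x _; rewrite normrM -[leRHS]mulr1 ler_pM ?cos_max//.
Qed.

(** Each entry of [L], repetitions included, gains a factor [1 + nu_i^2] for two derivatives of [u]
    in direction [i]. *)
Lemma osc_decay (L : seq 'I_n) u : smooth u -> exists2 C : R, 0 <= C &
  forall nu theta, \prod_(i <- L) (1 + (nu 0 i)%:~R ^+ 2) * `|osc nu u theta| <= C.
Proof.
elim: L u => [|i L IH] u su.
  by have [C C0 HC] := osc_le su; exists C => // nu theta; rewrite big_nil mul1r.
have [C C0 HC] := IH u su.
have [C' C'0 HC'] := IH _ (smooth_partial i (smooth_partial i su)).
exists (C + C'); first exact: addr_ge0.
move=> nu theta; rewrite big_cons.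
have -> : (1 + (nu 0 i)%:~R ^+ 2) * \prod_(j <- L) (1 + (nu 0 j)%:~R ^+ 2) * `|osc nu u theta| =
  \prod_(j <- L) (1 + (nu 0 j)%:~R ^+ 2) * `|osc nu u theta| +
  \prod_(j <- L) (1 + (nu 0 j)%:~R ^+ 2) * ((nu 0 i)%:~R ^+ 2 * `|osc nu u theta|) by ring.
apply: lerD => //.
rewrite -[X in X * `|_|]ger0_norm ?sqr_ge0// -normrM osc_partial2// normrN.
exact: HC'.
Qed.

End periodic_functions.

(** * Fourier components, inversion for smooth functions, and Fubini on the torus *)

Section fourier_inversion.
Context {R : realType} {n : nat}.
Local Notation RT := (measurableTypeR R).
Local Notation lam := (lebesgue_tuple R n).
Implicit Types (f g u : 'rV[R]_n -> R) (x y z : 'rV[R]_n) (i : 'I_n) (nu : 'rV[int]_n).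

(** The real part of [c_nu(u) * exp (i * nu . x)]; the imaginary parts cancel between [nu] and
    [- nu] in the series. *)
Definition fcomp nu u x : R := ((2 * pi) ^+ n)^-1 * osc nu u (dot (ivec R nu) x).

Let cc0 : 0 <= ((2 * pi) ^+ n)^-1 :> R.
Proof. by rewrite invr_ge0 exprn_ge0// mulr_ge0 ?pi_ge0. Qed.

Lemma prod1D_ge (I : Type) (s : seq I) (a : I -> R) : (forall k, 0 <= a k) ->
  1 + \sum_(i <- s) a i <= \prod_(i <- s) (1 + a i).
Proof.
move=> a0; elim: s => [|i s IH]; first by rewrite !big_nil addr0.
rewrite !big_cons; apply: (@le_trans _ _ ((1 + a i) * (1 + \sum_(j <- s) a j))).
  have := a0 i; have : 0 <= \sum_(j <- s) a j by rewrite sumr_ge0.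
  move: (\sum_(j <- s) a j) (a i) => p q; nra.
by rewrite ler_wpM2l// addr_ge0.
Qed.

Lemma osc_bound u : smooth u -> exists M : 'rV[int]_n -> R, [/\ forall nu, 0 <= M nu, rsummable M &
  forall nu theta, (1 + enorm (ivec R nu) ^+ 2) * `|((2 * pi) ^+ n)^-1 * osc nu u theta| <= M nu].
Proof.
(* Every coordinate is taken twice: one product makes the bound summable, the other absorbs
   [1 + |nu|^2], which will dominate [|nu|^sigma]. *)
move=> su; have [C C0 HC] := osc_decay (index_enum 'I_n ++ index_enum 'I_n) su.
pose p nu : R := \prod_i (1 + (nu 0 i)%:~R ^+ 2).
have p0 nu : 0 < p nu by apply: prodr_gt0 => i _; rewrite ltr_pwDl ?sqr_ge0.
exists (fun nu => (((2 * pi) ^+ n)^-1 * C) * (p nu)^-1); split.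
- by move=> nu; rewrite mulr_ge0 ?mulr_ge0// invr_ge0 ltW.
- by apply: rsummableZ; exact: rsummable_prod_inv_sqr.
move=> nu theta; rewrite ler_pdivlMr//.
have h : 1 + enorm (ivec R nu) ^+ 2 <= p nu.
  rewrite enorm_sqr; apply: le_trans (prod1D_ge _ _); last by move=> i; rewrite sqr_ge0.
  by rewrite lerD2l; apply: ler_sum => i _; rewrite mxE.
have := HC nu theta; rewrite big_cat/= -/(p nu) => {}HC.
rewrite normrM (ger0_norm cc0) -!mulrA mulrCA ler_wpM2l//.
apply: le_trans HC; rewrite (_ : p nu * p nu * _ = p nu * (`|osc nu u theta| * p nu)); last by ring.
by rewrite ler_wpM2r// mulr_ge0// ltW.
Qed.

Lemma continuous_subl x u : continuous u -> continuous (fun z => u (x - z)).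
Proof.
move=> cu z; apply: (@continuous_comp _ _ _ (fun z => x - z) u); last exact: cu.
exact: (continuousB (@cvg_cst _ _ _ _ _) (@cvg_id _ _)).
Qed.

Lemma heat_kernel_periodic t : Defs.periodic (@heat_kernel R n t).
Proof.
move=> x mu; rewrite !heat_kernel_rsum; congr (_ * rsum _).
by apply/funext => nu; rewrite dotDr cosDpi2_ivec.
Qed.

Lemma heat_conv t u x : 0 < t -> Defs.periodic u -> continuous u ->
  Rn_int Q (fun z => u (x - z) * heat_kernel t z) =
  rsum (fun nu => expR (- (t * enorm (ivec R nu) ^+ 2)) * fcomp nu u x).
Proof.
move=> t0 pu cu; have [B B0 HB] := periodic_bounded pu cu.
have cux := continuous_subl (x := x) cu.
have pux : Defs.periodic (fun z => u (x - z)).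
  by move=> z nu; rewrite opprD addrA -scalerN -ivecN pu.
rewrite -(@Rn_int_subl _ _ _ x); last 2 first.
- by move=> z nu; rewrite pux heat_kernel_periodic.
- exact: measurable_funM (continuous_mfunR cux) (mfunR_heat t).
pose F nu (w : n.-tuple RT) : R := ((2 * pi) ^+ n)^-1 * expR (- (t * enorm (ivec R nu) ^+ 2)) *
   (u (row_of w) * cos (dot (ivec R nu) x - dot (ivec R nu) (row_of w))).
transitivity (\int[lam]_(w in @Qt R n) rsum (F^~ w)).
  have heat_summable y : rsummable (fun nu => expR (- (t * enorm (ivec R nu) ^+ 2)) * cos (dot (ivec R nu) y)).
    apply: le_rsummable (rsummable_heat n t0) => nu.
    by have := norm_heat_cos_le t 0 nu y; rewrite addr0.
  apply: eq_Rintegral => w _; rewrite subKr heat_kernel_rsum mulrCA -!rsumZ.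
  - by congr rsum; apply/funext => nu; rewrite /F dotDr dotNr; ring.
  - exact: rsummableZ.
  - exact: heat_summable.
rewrite (@Rintegral_rsum _ _ _ _ _ _ F (fun nu => ((2 * pi) ^+ n)^-1 * B *
    expR (- (t * enorm (ivec R nu) ^+ 2)))).
- congr rsum; apply/funext => nu; rewrite /F /fcomp /osc -Rn_intZ.
    rewrite -Rn_intZ; last by apply: Rn_integrableZ; exact: osc_integrable.
    by apply: eq_Rintegral => w _; ring.
  exact: osc_integrable.
- exact: measurable_Qt.
- exact: lebesgue_tuple_Qt_lty.
- move=> nu; apply: measurable_funTS; apply: measurable_funM => //.
  exact: (continuous_mfunR (contM cu (@continuous_cosB _ _ _ _))).
- move=> nu w; rewrite /F !normrM (ger0_norm cc0) (ger0_norm (expR_ge0 _)).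
  rewrite -!mulrA ler_wpM2l// mulrC ler_wpM2r ?expR_ge0//.
  by rewrite -[leRHS]mulr1 ler_pM ?cos_max.
- by apply: rsummableZ; exact: rsummable_heat.
Qed.

Lemma coord_le_enorm z i : `|z 0 i| <= enorm z.
Proof.
rewrite -(@ler_pXn2r _ 2)// ?nnegrE ?enorm_ge0// enorm_sqr real_normK ?num_real//.
by rewrite (bigD1 i)//= lerDl sumr_ge0// => j _; exact: sqr_ge0.
Qed.

Lemma smooth_lipschitz u : smooth u -> exists2 K : R, 0 <= K &
  forall x z, `|u x - u (x - z)| <= K * enorm z.
Proof.
move=> su.
have /choice[B HB] (i : 'I_n) : exists B : R, 0 <= B /\ forall x, `|'D_(Defs.basis R i) u x| <= B.
  by have [B B0 HB] := smooth_bounded (smooth_partial i su); exists B.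
exists (\sum_i B i); first by apply: sumr_ge0 => i _; have [] := HB i.
move=> x z; have [|xi [_ ->]] := @telescope_coords R n u x z.
  by move=> i y; have [_ {}su] := su; have [d _] := su 1%N; exact: (d [::]).
apply: le_trans (ler_norm_sum _ _ _) _; rewrite mulr_suml; apply: ler_sum => i _.
by rewrite normrM mulrC ler_pM ?coord_le_enorm//; have [_] := HB i; apply.
Qed.

(** Convolution with the heat kernel at time [h k] damps the Fourier series of [u]. The series
    converges to the undamped one by Tannery, while the convolution converges to [u x]: the error is
    at most a Lipschitz constant times the first moment, of order [h k^(1/2)]. *)
Lemma fourier_inversion u x : smooth u -> u x = rsum (fun nu => fcomp nu u x).
Proof.
move=> su; have [pu cu] : Defs.periodic u /\ continuous u by split; [case: su|exact: smooth_continuous].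
have [K K0 HK] := smooth_lipschitz su; have [M M0 HM] := @heat_moment R n 1 ltac:(by rewrite ltr01 ler1n).
have [N [N0 sN HN]] := osc_bound su.
have [B B0 HB] := periodic_bounded pu cu.
have bN nu : `|fcomp nu u x| <= N nu.
  by apply: le_trans (HN nu (dot (ivec R nu) x)); rewrite ler_peMl// lerDl sqr_ge0.
pose h (k : nat) : R := k.+1%:R^-1.
have h0 k : 0 < h k by rewrite invr_gt0.
have hc : h @ \oo --> (0 : R) := @cvg_harmonic R.
pose S k := rsum (fun nu => expR (- (h k * enorm (ivec R nu) ^+ 2)) * fcomp nu u x).
have cS : S @ \oo --> rsum (fun nu => fcomp nu u x).
  apply: (cvg_rsum _ sN).
  - move=> nu; rewrite -[X in _ --> X]mul1r; apply: cvgM; last exact: cvg_cst.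
    rewrite -[X in _ --> X](@expR0 R) -oppr0 -(mul0r (enorm (ivec R nu) ^+ 2)).
    have ch : (fun k => - (h k * enorm (ivec R nu) ^+ 2)) @ \oo --> - (0 * enorm (ivec R nu) ^+ 2).
      by apply: cvgN; apply: cvgM; [exact: hc|exact: cvg_cst].
    exact: (cvg_comp _ _ ch (@continuous_expR R _)).
  - apply: nearW => k nu; rewrite normrM ger0_norm ?expR_ge0//.
    apply: le_trans (bN nu); rewrite ler_piMl// -[leRHS]expR0 ler_expR oppr_le0.
    by rewrite mulr_ge0 ?sqr_ge0 ?ltW.
  - exact: bN.
have dS k : `|u x - S k| <= K * M * h k `^ (2^-1).
  rewrite /S -heat_conv//.
  have iW : Rn_integrable Q (@heat_kernel R n (h k)).
    have [C1 C10 hC1] := @heat_kernel_bounded R n (h k) (h0 k); have HC1 := hC1 (h k) (lexx (h k)).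
    apply: (bounded_Rn_integrable (c := C1)) => [|z _]; first exact: mfunR_heat.
    by rewrite ger0_norm ?heat_kernel_ge0.
  have cux := continuous_subl (x := x) cu.
  have iu : Rn_integrable Q (fun z => u (x - z) * heat_kernel (h k) z).
    by apply: (@heat_integrable _ _ (h k) (fun z => u (x - z)) B) => //; exact: continuous_mfunR.
  have E : Rn_int Q (fun z => u x * heat_kernel (h k) z) = u x.
    by rewrite Rn_intZ// Rn_int_heat// mulr1.
  rewrite -[X in X - _]E -Rn_intB//; last exact: Rn_integrableZ.
  have i1 : Rn_integrable Q (fun z : 'rV[R]_n => enorm z `^ 1 * heat_kernel (h k) z).
    by apply: heat_moment_integrable; rewrite ?ler01 ?ler1n.
  apply: (@le_trans _ _ (Rn_int Q (fun z : 'rV[R]_n => K * (enorm z `^ 1 * heat_kernel (h k) z)))).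
    apply: norm_Rn_int_le.
    - by apply: Rn_integrableB => //; exact: Rn_integrableZ.
    - exact: Rn_integrableZ.
    move=> z _; rewrite -mulrBl normrM (ger0_norm (heat_kernel_ge0 _ (h0 k))) mulrA.
    by rewrite ler_wpM2r ?heat_kernel_ge0// powRr1 ?enorm_ge0.
  rewrite Rn_intZ// -mulrA ler_wpM2l//.
  by have [+ _] := HM _ (h0 k); rewrite div1r.
have dS0 : (fun k => u x - S k) @ \oo --> (0 : R).
  apply/norm_cvg0P.
  apply: (@squeeze_cvgr _ _ _ _ (cst 0) (fun k => K * M * h k `^ (2^-1))).
  - by apply: nearW => k; rewrite normr_ge0 dS.
  - exact: cvg_cst.
  - rewrite -(mulr0 (K * M)); apply: cvgMr.
    have /cvg_at_rightP := @powR_cvg0 R 2^-1 ltac:(by rewrite invr_gt0); apply; split.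
      exact: h0.
    exact: hc.
have dS1 : (fun k => u x - S k) @ \oo --> u x - rsum (fun nu => fcomp nu u x).
  by apply: cvgB => //; exact: cvg_cst.
by apply/eqP; rewrite -subr_eq0; apply/eqP; exact: (cvg_unique _ dS1 dS0).
Qed.

(** A majorant that is independent of [y] makes all sections integrable, not only almost all, as
    [fubini_on] demands. *)
Lemma Rn_fubini (F : 'rV[R]_n -> 'rV[R]_n -> R) (G : 'rV[R]_n -> R) :
  measurable_fun setT (fun p : n.-tuple RT * n.-tuple RT => F (row_of p.1) (row_of p.2)) ->
  Rn_integrable Q G -> (forall y z, Q y -> Q z -> `|F y z| <= G z) ->
  Rn_int Q (fun y => Rn_int Q (fun z => F y z)) = Rn_int Q (fun z => Rn_int Q (fun y => F y z)).
Proof.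
move=> mF iG FG.
have mQ := @measurable_Qt R n.
have m1 w : measurable_fun setT (fun w' : n.-tuple RT => F (row_of w) (row_of w')).
  exact: (measurableT_comp mF (measurable_pair1 w)).
have m2 w' : measurable_fun setT (fun w : n.-tuple RT => F (row_of w) (row_of w')).
  exact: (measurableT_comp mF (measurable_pair2 w')).
apply: (@fubini_on _ _ _ _ R lam lam (@Qt R n) (@Qt R n) mQ mQ
  (fun w w' => F (row_of w) (row_of w'))).
- exact: measurable_funTS.
- apply: (@le_lt_trans _ _ (\int[lam]_(w in @Qt R n) (Rn_int Q G)%:E)%E); last first.
    rewrite integral_cst//= lte_mul_pinfty//; last exact: lebesgue_tuple_Qt_lty.
    rewrite lee_fin; apply: Rintegral_ge0 => w Qw.
    by apply: le_trans (FG _ _ Qw Qw); exact: normr_ge0.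
  apply: ge0_le_integral => //.
  + by move=> w _; apply: integral_ge0.
  + apply: (@measurable_fun_tonelli_on _ _ _ _ R lam (@Qt R n) (@Qt R n) mQ mQ
      (fun p => `|F (row_of p.1) (row_of p.2)|%:E)) => //.
    by apply/measurable_EFinP; apply: measurable_funTS; exact: measurableT_comp.
  + move=> w Qw; rewrite -Rn_int_EFin//; apply: ge0_le_integral => //.
    * by apply/measurable_EFinP; apply: measurable_funTS; exact: measurableT_comp.
    * by have /measurable_int := iG.
    * by move=> w' Qw'; rewrite lee_fin; exact: (FG _ _ Qw Qw').
- move=> w Qw; apply: (@le_Rn_integrable _ _ (F (row_of w)) G) => //.
    exact: m1.
  by move=> z Qz; exact: (FG _ _ Qw Qz).
- move=> w' Qw'; apply: (@bounded_Rn_integrable _ _ (fun y => F y (row_of w')) (G (row_of w'))).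
    exact: m2.
  by move=> y Qy; exact: (FG _ _ Qy Qw').
Qed.

End fourier_inversion.

(** * The singular integral and its Fourier components *)

Section singular_integral.
Context {R : realType} {n : nat}.
Local Notation RT := (measurableTypeR R).
Local Notation lam := (lebesgue_tuple R n).
Implicit Types (f g u : 'rV[R]_n -> R) (x y z : 'rV[R]_n) (i : 'I_n) (nu : 'rV[int]_n).
Variables (sigma a : R) (sigma0 : 0 < sigma) (sigma2 : sigma < 2) (sa : sigma < a) (a2 : a <= 2).
Variables (f : 'rV[R]_n -> R) (pf : Defs.periodic f) (cf : continuous f).

Definition diff2 x z : R := 2 * f x - f (x - z) - f (x + z).

Variables (C : R) (C0 : 0 <= C) (fC : forall x z, `|diff2 x z| <= C * enorm z `^ a).

Definition sing x : R := 2^-1 * Rn_int Q (fun z => diff2 x z * frac_kernel sigma z).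

Let dom z := C * (enorm z `^ a * frac_kernel sigma z).

Let idom : Rn_integrable Q dom.
Proof. by apply: Rn_integrableZ; apply: kernel_moment; rewrite ?sigma0 ?sa. Qed.

Let diff2_dom x z : `|diff2 x z * frac_kernel sigma z| <= dom z.
Proof.
by rewrite normrM (ger0_norm (frac_kernel_ge0 _ _)) /dom mulrA ler_wpM2r ?frac_kernel_ge0.
Qed.

Lemma measurable_diff2 d (T : measurableType d) (r1 r2 : T -> 'rV[R]_n) :
  (forall i, measurable_fun setT (fun w => r1 w 0 i)) ->
  (forall i, measurable_fun setT (fun w => r2 w 0 i)) ->
  measurable_fun setT (fun w => diff2 (r1 w) (r2 w)).
Proof.
move=> m1 m2; have mc (rho : T -> 'rV[R]_n) : (forall i, measurable_fun setT (fun w : T => rho w 0 i)) ->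
    measurable_fun setT (fun w => f (rho w)).
  by move=> mr; exact: (measurable_continuous measurableT mr cf).
apply: measurable_funB; [apply: measurable_funB|].
- by apply: measurable_funM => //; exact: mc.
- apply: (mc (fun w => r1 w - r2 w)) => i; under eq_fun do rewrite !mxE.
  exact: measurable_funB.
- apply: (mc (fun w => r1 w + r2 w)) => i; under eq_fun do rewrite !mxE.
  exact: measurable_funD.
Qed.

Lemma mfunR_diff2_kernel x : mfunR (fun z => diff2 x z * frac_kernel sigma z).
Proof.
apply: measurable_funM; last exact: mfunR_frac_kernel.
by apply: measurable_diff2 => // i; exact: measurable_row_of.
Qed.

Lemma diff2_kernel_integrable x : Rn_integrable Q (fun z => diff2 x z * frac_kernel sigma z).
Proof. by apply: le_Rn_integrable (mfunR_diff2_kernel x) idom _ => z _; exact: diff2_dom. Qed.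

Lemma sing_periodic : Defs.periodic sing.
Proof.
move=> x nu; rewrite /sing; congr (_ * Rn_int _ _); apply/funext => z.
rewrite /diff2 pf; set p := _ *: _; rewrite [x + p - z]addrAC [x + p + z]addrAC.
by rewrite /p !pf.
Qed.

(** Row vectors form a metric space, so continuity can be tested on sequences, where dominated
    convergence is available. *)
Lemma sequentially_continuous g :
  (forall x (xs : nat -> 'rV[R]_n), xs @ \oo --> x -> g (xs k) @[k --> \oo] --> g x) ->
  continuous g.
Proof.
move=> sg x; have [_] := @cvgrPdist_lt _ R^o _ (nbhs x) (nbhs_filter x) g (g x); apply => e e0.
apply: contrapT => nx.
have /choice[xs Hxs] (k : nat) : exists y, ball x k.+1%:R^-1 y /\ e <= `|g x - g y|.
  apply: contrapT => ny; apply: nx; apply/nbhs_ballP; exists k.+1%:R^-1 => /=; first by rewrite invr_gt0.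
  move=> y xy; rewrite /= ltNge; apply/negP => ge; apply: ny; exists y; split => //.
have cx : xs @ \oo --> x.
  apply/cvg_ballP => d d0; near=> k; have [h _] := Hxs k.
  apply: le_ball h; apply/ltW; near: k; exact: (near_infty_natSinv_lt (PosNum d0)).
have /cvgrPdist_lt/(_ e e0) := sg x xs cx.
move=> [N _ /(_ N (leqnn N))]; have [_ h] := Hxs N.
by rewrite /= ltNge h.
Unshelve. all: by end_near. Qed.

Lemma sing_continuous : continuous sing.
Proof.
apply: sequentially_continuous => x xs cxs; rewrite /sing.
apply: cvgMr; apply: (Rn_int_cvg (g := dom)) => //.
- by move=> k; exact: mfunR_diff2_kernel.
- exact: mfunR_diff2_kernel.
move=> z _; apply: cvgMl; rewrite /diff2.
have cfx (y : 'rV[R]_n) (ys : nat -> 'rV[R]_n) : ys @ \oo --> y -> (fun k => f (ys k)) @ \oo --> f y.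
  by move=> h; exact: (cvg_comp _ _ h (@cf y)).
apply: cvgB; [apply: cvgB|].
- by apply: cvgMr; exact: cfx.
- by apply: cfx; apply: cvgB => //; exact: cvg_cst.
- by apply: cfx; apply: cvgD => //; exact: cvg_cst.
Qed.

Lemma Rn_int_kernel_cos nu :
  Rn_integrable Q (fun z => (1 - cos (dot (ivec R nu) z)) * frac_kernel sigma z) /\
  Rn_int Q (fun z => (1 - cos (dot (ivec R nu) z)) * frac_kernel sigma z) = enorm (ivec R nu) `^ sigma.
Proof.
have E := @Rn_int_kernel_1Bcos R n sigma nu ltac:(by rewrite sigma0).
split; last by rewrite /Rn_int /Rintegral E.
apply: ge0_Rn_integrable; last by rewrite E ltry.
  apply: measurable_funM; last exact: mfunR_frac_kernel.
  apply: measurable_funB => //.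
  have := continuous_mfunR (@continuous_cos_dot R n (ivec R nu) 0).
  by apply: eq_measurable_fun => w _; rewrite /= addr0.
by move=> z _; rewrite mulr_ge0 ?frac_kernel_ge0// subr_ge0 cos_le1.
Qed.

Lemma osc_shift nu (z : 'rV[R]_n) (theta : R) :
  Rn_int Q (fun y => f (y - z) * cos (theta - dot (ivec R nu) y)) =
  osc nu f (theta - dot (ivec R nu) z).
Proof.
pose F y := f y * cos (theta - dot (ivec R nu) z - dot (ivec R nu) y).
have pF : Defs.periodic F.
  by move=> y mu; rewrite /F pf dotDr opprD addrA cosBpi2_ivec.
rewrite -[RHS](@Rn_int_shift _ _ F (- z))//; last first.
  by apply: continuous_mfunR; apply: contM => //; exact: continuous_cosB.
apply: eq_Rn_int => y _; rewrite /F dotDr dotNr; congr (_ * cos _); ring.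
Qed.

Lemma shift_periodic (z : 'rV[R]_n) : Defs.periodic (fun y => f (y - z)).
Proof. by move=> y nu; rewrite addrAC pf. Qed.

Lemma shift_continuous (z : 'rV[R]_n) : continuous (fun y => f (y - z)).
Proof.
move=> y; apply: (@continuous_comp _ _ _ (fun y => y - z) f); last exact: cf.
exact: (continuousB (@cvg_id _ _) (@cvg_cst _ _ _ _ _)).
Qed.

(** Translation by [z] shifts the phase by [nu . z]. In the sum over [z] and [- z] the sine terms
    cancel, leaving the multiplier [2 * (1 - cos (nu . z))]. *)
Lemma osc_diff2 nu z (theta : R) :
  Rn_int Q (fun y => diff2 y z * cos (theta - dot (ivec R nu) y)) =
  2 * (1 - cos (dot (ivec R nu) z)) * osc nu f theta.
Proof.
have i1 z' := @osc_integrable _ _ nu _ theta (@shift_periodic z') (@shift_continuous z').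
transitivity (Rn_int Q (fun y => 2 * (f y * cos (theta - dot (ivec R nu) y)) -
   f (y - z) * cos (theta - dot (ivec R nu) y) - f (y - (- z)) * cos (theta - dot (ivec R nu) y))).
  by apply: eq_Rn_int => y _; rewrite opprK /diff2; ring.
have i0 := @osc_integrable _ _ nu _ theta pf cf.
rewrite Rn_intB//; last by apply: Rn_integrableB => //; exact: Rn_integrableZ.
rewrite Rn_intB//; last exact: Rn_integrableZ.
rewrite Rn_intZ// !osc_shift dotNr opprK.
have -> : osc nu f (theta + dot (ivec R nu) z) =
    2 * cos (dot (ivec R nu) z) * osc nu f theta - osc nu f (theta - dot (ivec R nu) z).
  rewrite /osc -Rn_intZ// -Rn_intB//; [|exact: Rn_integrableZ|exact: osc_integrable].
  apply: eq_Rn_int => y _; set b := dot _ z; set c := dot _ y.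
  have -> : theta + b - c = (theta - c) + b by ring.
  have -> : theta - b - c = (theta - c) - b by ring.
  by set d := theta - c; rewrite cosD cosB; ring.
by rewrite /osc; ring.
Qed.

Lemma osc_sing nu (theta : R) : osc nu sing theta = enorm (ivec R nu) `^ sigma * osc nu f theta.
Proof.
have [ik Ek] := Rn_int_kernel_cos nu.
pose F y z := 2^-1 * (diff2 y z * frac_kernel sigma z) * cos (theta - dot (ivec R nu) y).
transitivity (Rn_int Q (fun y => Rn_int Q (F y))).
  apply: eq_Rn_int => y _; rewrite /sing -Rn_intZ; last exact: diff2_kernel_integrable.
  rewrite mulrC -Rn_intZ; last by apply: Rn_integrableZ; exact: diff2_kernel_integrable.
  by apply: eq_Rn_int => z _; rewrite mulrC.
rewrite (@Rn_fubini _ _ F dom).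
- transitivity (Rn_int Q (fun z => osc nu f theta * ((1 - cos (dot (ivec R nu) z)) * frac_kernel sigma z))).
    apply: eq_Rn_int => z _.
    transitivity (Rn_int Q (fun y => (2^-1 * frac_kernel sigma z) * (diff2 y z * cos (theta - dot (ivec R nu) y)))).
      by apply: eq_Rn_int => y _; rewrite /F; ring.
    rewrite Rn_intZ ?osc_diff2; first by field.
    apply: osc_integrable; last first.
      apply: contB; [apply: contB|]; [apply: contM => //; exact: contC|exact: shift_continuous|].
      by have := @shift_continuous (- z); under eq_fun do rewrite opprK.
    move=> y mu; rewrite /diff2 pf; set p := _ *: _.
    by rewrite [y + p - z]addrAC [y + p + z]addrAC /p !pf.
  by rewrite Rn_intZ// Ek mulrC.
- apply: measurable_funM; first apply: measurable_funM => //; first apply: measurable_funM.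
  + apply: measurable_diff2 => i.
      exact: measurableT_comp (measurable_row_of i) measurable_fst.
    exact: measurableT_comp (measurable_row_of i) measurable_snd.
  + exact: measurableT_comp (mfunR_frac_kernel sigma) measurable_snd.
  + exact: measurableT_comp (continuous_mfunR (@continuous_cosB _ _ (ivec R nu) theta)) measurable_fst.
- exact: idom.
- move=> y z _ _; rewrite normrM -[leRHS]mulr1 ler_pM ?cos_max// normrM -[leRHS]mul1r.
  by rewrite ler_pM// ger0_norm ?invf_le1 ?ler1n// invr_ge0.
Qed.

Lemma fcomp_sing nu x : fcomp nu sing x = enorm (ivec R nu) `^ sigma * fcomp nu f x.
Proof. by rewrite /fcomp osc_sing mulrCA. Qed.

End singular_integral.

(** * Symmetry of Fourier components and the passage to the distribution *)

Section duality.
Context {R : realType} {n : nat}.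
Local Notation RT := (measurableTypeR R).
Local Notation lam := (lebesgue_tuple R n).
Implicit Types (f g u : 'rV[R]_n -> R) (x y z : 'rV[R]_n) (i : 'I_n) (nu : 'rV[int]_n).

Lemma fcomp_continuous nu u : Defs.periodic u -> continuous u -> continuous (fcomp nu u).
Proof.
move=> pu cu.
(* The phase enters only through [cos th] and [sin th], which reduces continuity in [x] to that of
   these functions. *)
have oE : forall th : R, osc nu u th = cos th * osc nu u 0 + sin th * osc nu u (pi / 2).
  move=> th; rewrite /osc -!Rn_intZ; [|exact: osc_integrable..].
  rewrite -Rn_intD; [|by apply: Rn_integrableZ; exact: osc_integrable..].
  apply: eq_Rn_int => y _; rewrite !cosB cos0 sin0 cos_pihalf sin_pihalf; ring.
have co : continuous (osc nu u).
  rewrite (_ : osc nu u = fun th => cos th * osc nu u 0 + sin th * osc nu u (pi / 2)); last exact/funext.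
  by apply: contD; apply: contM; try exact: contC; [exact: continuous_cos|exact: continuous_sin].
apply: contM; first exact: contC.
exact: cont_comp (@continuous_dot R n (ivec R nu)) co.
Qed.

Lemma fcomp_le nu u (B : R) x : Defs.periodic u -> continuous u -> (forall x, `|u x| <= B) ->
  `|fcomp nu u x| <= B.
Proof.
move=> pu cu uB; have B0 : 0 <= B by apply: le_trans (uB 0).
have p0 : 0 < (2 * pi) ^+ n :> R by rewrite exprn_gt0// mulr_gt0 ?pi_gt0.
rewrite /fcomp normrM normfV (gtr0_norm p0) mulrC ler_pdivrMr//.
have ic : Rn_integrable Q (fun _ : 'rV[R]_n => B).
  apply: (bounded_Rn_integrable (c := B)) => [|y _]; first exact: measurable_cst.
  by rewrite ger0_norm.
apply: (@le_trans _ _ (Rn_int Q (fun _ : 'rV[R]_n => B))).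
  apply: norm_Rn_int_le => //; first exact: osc_integrable.
  by move=> y _; rewrite normrM -[leRHS]mulr1 ler_pM ?cos_max.
rewrite /Rn_int Rintegral_cst; last exact: measurable_Qt.
have E := @lebesgue_tuple_Qt R n; by rewrite [X in fine X]E.
Qed.

(** Both sides are double integrals with the kernel [cos (nu . x - nu . y)], which is symmetric in
    [x] and [y]. *)
Lemma fcomp_sym nu f u : Defs.periodic f -> continuous f -> Defs.periodic u -> continuous u ->
  Rn_int Q (fun x => f x * fcomp nu u x) = Rn_int Q (fun x => fcomp nu f x * u x).
Proof.
move=> pf cf pu cu; have [Bf Bf0 HBf] := periodic_bounded pf cf.
have [Bu Bu0 HBu] := periodic_bounded pu cu.
pose c : R := ((2 * pi) ^+ n)^-1.
pose F x y : R := c * (f x * (u y * cos (dot (ivec R nu) x - dot (ivec R nu) y))).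
transitivity (Rn_int Q (fun x => Rn_int Q (F x))).
  apply: eq_Rn_int => x _; rewrite /fcomp /osc -/c mulrCA -!Rn_intZ//.
  - by apply: Rn_integrableZ; exact: osc_integrable.
  - exact: osc_integrable.
have p0 : 0 <= c by rewrite invr_ge0 exprn_ge0// mulr_ge0 ?pi_ge0.
rewrite (@Rn_fubini _ _ F (fun=> c * (Bf * Bu))).
- apply: eq_Rn_int => y _; rewrite /fcomp /osc -/c.
  transitivity (Rn_int Q (fun x => (c * u y) * (f x * cos (dot (ivec R nu) y - dot (ivec R nu) x)))).
    by apply: eq_Rn_int => x _; rewrite /F -[X in cos X]opprB cosN; ring.
  by rewrite Rn_intZ; [ring|exact: osc_integrable].
- apply: measurable_funM => //; apply: measurable_funM; last apply: measurable_funM.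
  + exact: measurableT_comp (continuous_mfunR cf) measurable_fst.
  + exact: measurableT_comp (continuous_mfunR cu) measurable_snd.
  + apply: (measurableT_comp (f := @cos R)); first exact: (continuous_measurable_fun (@continuous_cos R)).
    apply: measurable_funB.
      exact: measurableT_comp (continuous_mfunR (@continuous_dot R n (ivec R nu))) measurable_fst.
    exact: measurableT_comp (continuous_mfunR (@continuous_dot R n (ivec R nu))) measurable_snd.
- apply: (bounded_Rn_integrable (c := c * (Bf * Bu))) => [|y _]; first exact: measurable_cst.
  by rewrite ger0_norm// !mulr_ge0.
move=> x y _ _; rewrite /F !normrM (ger0_norm p0) ler_wpM2l// ler_pM//.
by rewrite -[leRHS]mulr1 ler_pM ?cos_max.
Qed.

Variables (sigma : R) (sigma0 : 0 < sigma) (sigma2 : sigma < 2).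

Lemma fourier_multiplier_dual f g u : Defs.periodic f -> continuous f -> Defs.periodic g -> continuous g ->
  (forall nu x, fcomp nu g x = enorm (ivec R nu) `^ sigma * fcomp nu f x) -> smooth u ->
  Rn_int Q (fun x => f x * rsum (fun nu => enorm (ivec R nu) `^ sigma * fcomp nu u x)) =
  Rn_int Q (fun x => g x * u x).
Proof.
move=> pf cf pg cg fg su.
have [pu cu] : Defs.periodic u /\ continuous u by split; [case: su|exact: smooth_continuous].
have [Bf Bf0 HBf] := periodic_bounded pf cf; have [Bg Bg0 HBg] := periodic_bounded pg cg.
have [M [M0 sM HM]] := osc_bound su.
have bM nu x : `|fcomp nu u x| <= M nu.
  by apply: le_trans (HM nu (dot (ivec R nu) x)); rewrite ler_peMl// lerDl sqr_ge0.
have bsM nu x : `|enorm (ivec R nu) `^ sigma * fcomp nu u x| <= M nu.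
  rewrite normrM ger0_norm ?powR_ge0//; apply: le_trans (HM nu (dot (ivec R nu) x)).
  by rewrite ler_wpM2r//; apply: enorm_powR_le; rewrite !ltW.
have mQ := @measurable_Qt R n.
(* The exchange is needed twice: with [m nu = |nu|^sigma] for [f], and with [m = 1] for [g], where
   the series is [u] itself by inversion. *)
have exch (h : 'rV[R]_n -> R) (m : 'rV[int]_n -> R) (B : R) : Defs.periodic h -> continuous h -> 0 <= B ->
    (forall x, `|h x| <= B) -> (forall nu x, `|m nu * fcomp nu u x| <= M nu) ->
    Rn_int Q (fun x => h x * rsum (fun nu => m nu * fcomp nu u x)) =
    rsum (fun nu => m nu * Rn_int Q (fun x => h x * fcomp nu u x)).
  move=> ph ch B0 HB mM.
  pose F nu (w : n.-tuple RT) := h (row_of w) * (m nu * fcomp nu u (row_of w)).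
  transitivity (\int[lam]_(w in @Qt R n) rsum (F^~ w)).
    apply: eq_Rintegral => w _; rewrite -rsumZ//.
    exact: le_rsummable (fun nu => mM nu _) sM.
  rewrite (@Rintegral_rsum _ _ _ _ _ _ F (fun nu => B * M nu))//.
  - congr rsum; apply/funext => nu; rewrite -Rn_intZ.
      by apply: eq_Rintegral => w _; rewrite /F; ring.
    have [D D0 HD] : exists2 D : R, 0 <= D & forall x, `|fcomp nu u x| <= D by exists (M nu).
    apply: (bounded_Rn_integrable (c := B * D)) => [|x _].
      by apply: continuous_mfunR; apply: contM => //; exact: fcomp_continuous.
    by rewrite normrM ler_pM.
  - exact: lebesgue_tuple_Qt_lty.
  - move=> nu; apply: measurable_funTS; apply: measurable_funM; first exact: (continuous_mfunR ch).
    apply: measurable_funM => //.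
    exact: (continuous_mfunR (fcomp_continuous pu cu)).
  - by move=> nu w; rewrite /F normrM ler_pM.
  - exact: rsummableZ.
rewrite (exch _ _ Bf)//.
transitivity (Rn_int Q (fun x => g x * rsum (fun nu => 1 * fcomp nu u x))); last first.
  apply: eq_Rn_int => x _; congr (_ * _); rewrite [RHS]fourier_inversion//.
  by congr rsum; apply/funext => nu; rewrite mul1r.
rewrite (exch _ (fun=> 1) _ pg cg Bg0 HBg); last by move=> nu x; rewrite mul1r.
congr rsum; apply/funext => nu; rewrite mul1r !fcomp_sym// -Rn_intZ.
  by apply: eq_Rn_int => x _; rewrite fg mulrA.
have [Bu Bu0 HBu] := periodic_bounded pu cu.
apply: (bounded_Rn_integrable (c := Bf * Bu)) => [|x _].
  by apply: continuous_mfunR; apply: contM => //; exact: fcomp_continuous.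
by rewrite normrM ler_pM// fcomp_le.
Qed.

End duality.

Section smooth_multiplier.
Context {R : realType} {n : nat}.
Implicit Types (f g u v : 'rV[R]_n -> R) (x y z : 'rV[R]_n) (nu : 'rV[int]_n).
Implicit Types phi : 'rV[R]_n -> R[i].
Variables (sigma : R) (sigma0 : 0 < sigma) (sigma2 : sigma < 2).

Local Notation cn := (((2 * pi) ^+ n)^-1 : R).

(** With phase shifted by [- pi / 2] these are the imaginary parts of the complex Fourier terms of a
    real function; they are odd in [nu]. *)
Lemma rsum_osc_odd u x : smooth u ->
  rsummable (fun nu => enorm (ivec R nu) `^ sigma * (cn * osc nu u (dot (ivec R nu) x - pi / 2))) /\
  rsum (fun nu => enorm (ivec R nu) `^ sigma * (cn * osc nu u (dot (ivec R nu) x - pi / 2))) = 0.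
Proof.
move=> su; have [M [M0 sM HM]] := osc_bound su.
have [pu cu] : Defs.periodic u /\ continuous u by split; [case: su|exact: smooth_continuous].
have s : rsummable (fun nu => enorm (ivec R nu) `^ sigma * (cn * osc nu u (dot (ivec R nu) x - pi / 2))).
  apply: le_rsummable sM => nu; rewrite normrM ger0_norm ?powR_ge0//.
  apply: le_trans (HM nu (dot (ivec R nu) x - pi / 2)).
  by rewrite ler_wpM2r//; apply: enorm_powR_le; rewrite !ltW.
split=> //; apply: rsum_odd => // nu.
rewrite ivecN enormN dotNl -[RHS]mulrN; congr (_ * _); rewrite -[RHS]mulrN; congr (_ * _).
transitivity (Rn_int Q (fun y => - 1 * (u y * cos (dot (ivec R nu) x - pi / 2 - dot (ivec R nu) y)))).
  apply: eq_Rn_int => y _; rewrite ivecN dotNl opprK.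
  have -> : - dot (ivec R nu) x - pi / 2 + dot (ivec R nu) y =
    - (dot (ivec R nu) x - pi / 2 - dot (ivec R nu) y + pi) by field.
  by rewrite cosN cosDpi; ring.
by rewrite Rn_intZ ?mulN1r//; exact: osc_integrable.
Qed.

(** Splitting [phi] into real and imaginary parts leaves cross terms, a sine series of the other
    part in each component, which [rsum_osc_odd] eliminates. *)
Lemma frac_lap_smoothE phi x : Cinfty_torus phi ->
  frac_lap_smooth sigma phi x =
  Complex (rsum (fun nu => enorm (ivec R nu) `^ sigma * fcomp nu (fun x => complex.Re (phi x)) x))
          (rsum (fun nu => enorm (ivec R nu) `^ sigma * fcomp nu (fun x => complex.Im (phi x)) x)).
Proof.
move=> [pphi sphi]; set u := fun x => complex.Re (phi x); set v := fun x => complex.Im (phi x).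
have su : smooth u by split=> [y nu|k]; [rewrite /u pphi|have [] := sphi k].
have sv : smooth v by split=> [y nu|k]; [rewrite /v pphi|have [] := sphi k].
have [pu cu] : Defs.periodic u /\ continuous u by split; [case: su|exact: smooth_continuous].
have [pv cv] : Defs.periodic v /\ continuous v by split; [case: sv|exact: smooth_continuous].
have sfc (w : 'rV[R]_n -> R) : smooth w -> rsummable (fun nu => enorm (ivec R nu) `^ sigma * fcomp nu w x).
  move=> sw; have [M [M0 sM HM]] := osc_bound sw.
  apply: le_rsummable sM => nu; rewrite normrM ger0_norm ?powR_ge0//.
  apply: le_trans (HM nu (dot (ivec R nu) x)).
  by rewrite ler_wpM2r//; apply: enorm_powR_le; rewrite !ltW.
have [su1 su2] := rsum_osc_odd x su; have [sv1 sv2] := rsum_osc_odd x sv.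
have ic (w : 'rV[R]_n -> R) nu : Defs.periodic w -> continuous w ->
    Rn_integrable Q (fun y => w y * cos (dot (ivec R nu) y)) /\
    Rn_integrable Q (fun y => w y * sin (dot (ivec R nu) y)).
  move=> pw cw; have h := @osc_integrable _ _ nu w _ pw cw; split.
    by have := h 0; under eq_fun do rewrite sub0r cosN.
  have := h (pi / 2); under eq_fun do rewrite cosB cos_pihalf sin_pihalf mul0r add0r mul1r; exact.
have oscE (w : 'rV[R]_n -> R) nu (th : R) : Defs.periodic w -> continuous w -> osc nu w th =
    cos th * Rn_int Q (fun y => w y * cos (dot (ivec R nu) y)) +
    sin th * Rn_int Q (fun y => w y * sin (dot (ivec R nu) y)).
  move=> pw cw; have [i1 i2] := ic w nu pw cw.
  rewrite -!Rn_intZ// -Rn_intD; [|exact: Rn_integrableZ..].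
  by apply: eq_Rn_int => y _; rewrite cosB; ring.
have fc nu : fourier_coef phi nu = Complex
   (cn * (Rn_int Q (fun y => u y * cos (dot (ivec R nu) y)) + Rn_int Q (fun y => v y * sin (dot (ivec R nu) y))))
   (cn * (Rn_int Q (fun y => v y * cos (dot (ivec R nu) y)) - Rn_int Q (fun y => u y * sin (dot (ivec R nu) y)))).
  have [i1 i2] := ic u nu pu cu; have [i3 i4] := ic v nu pv cv.
  rewrite /fourier_coef /Rn_cint -Rn_intD// -Rn_intB// -[LHS]/(Complex _ _)/=.
  rewrite !mul0r subr0 addr0; congr Complex; congr (_ * _); apply: eq_Rn_int => y _.
    by rewrite /u /v; case: (phi y) => a b /=; rewrite cosN sinN; ring.
  by rewrite /u /v; case: (phi y) => a b /=; rewrite cosN sinN; ring.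
rewrite /frac_lap_smooth /csum; congr Complex.
  rewrite -[RHS]subr0 -sv2 -(rsumB (sfc u su) sv1).
  congr rsum; apply/funext => nu; rewrite fc /= /fcomp !oscE// cosB sinB cos_pihalf sin_pihalf.
  ring.
rewrite -[RHS]addr0 -su2 -(rsumD (sfc v sv) su1).
congr rsum; apply/funext => nu; rewrite fc /= /fcomp !oscE// cosB sinB cos_pihalf sin_pihalf.
ring.
Qed.

Lemma frac_lap_of_multiplier f g : Defs.periodic f -> continuous f -> Defs.periodic g -> continuous g ->
  (forall nu x, fcomp nu g x = enorm (ivec R nu) `^ sigma * fcomp nu f x) ->
  frac_lap_is_continuous_fun sigma f g.
Proof.
move=> pf cf pg cg fg; split=> // phi Cphi; have [pphi sphi] := Cphi.
rewrite /frac_lap_distribution /distribution_of /Rn_cint.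
have red (w : 'rV[R]_n -> R) (h : 'rV[R]_n -> R[i]) :
    Rn_int Q (fun x => complex.Re ((w x)%:C%C * h x)) = Rn_int Q (fun x => w x * complex.Re (h x)) /\
    Rn_int Q (fun x => complex.Im ((w x)%:C%C * h x)) = Rn_int Q (fun x => w x * complex.Im (h x)).
  by split; apply: eq_Rn_int => x _; case: (h x) => a b /=; ring.
have [-> ->] := red f (frac_lap_smooth sigma phi); have [-> ->] := red g phi.
congr Complex.
  rewrite -(fourier_multiplier_dual sigma0 sigma2 pf cf pg cg fg); last first.
    by split=> [y nu|k]; [rewrite pphi|have [] := sphi k].
  by apply: eq_Rn_int => x _; rewrite frac_lap_smoothE.
rewrite -(fourier_multiplier_dual sigma0 sigma2 pf cf pg cg fg); last first.
  by split=> [y nu|k]; [rewrite pphi|have [] := sphi k].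
by apply: eq_Rn_int => x _; rewrite frac_lap_smoothE.
Qed.

End smooth_multiplier.

Lemma Rn_int_sym {R : realType} {n : nat} (F : 'rV[R]_n -> R) : mfunR F -> Rn_integrable Q F ->
  Rn_integrable Q (fun z => F z + F (- z)) /\ Rn_int Q (fun z => F z + F (- z)) = 2 * Rn_int Q F.
Proof.
move=> mF iF; have iF' := Rn_integrable_opp mF iF; split; first exact: Rn_integrableD.
by rewrite Rn_intD// Rn_int_opp// mulr_natl mulr2n.
Qed.

(** * First-order differences and the principal value *)

Section one_sided.
Context {R : realType} {n : nat}.
Local Notation RT := (measurableTypeR R).
Local Notation lam := (lebesgue_tuple R n).
Implicit Types (x y z : 'rV[R]_n).
Variables (sigma a : R) (sigma0 : 0 < sigma) (sigma2 : sigma < 2) (sa : sigma < a) (a2 : a <= 2).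
Variables (f : 'rV[R]_n -> R) (pf : Defs.periodic f) (cf : continuous f).

Let s02 : 0 < sigma < 2. Proof. by rewrite sigma0. Qed.

(** Since the kernel is even, the integral of [F z + F (- z)] against it is twice that of [F]. It is
    applied to the first difference, and to the first difference minus the gradient term, which is
    odd in [z]. *)
Lemma sing_one_sided (C : R) x (F : 'rV[R]_n -> R) : continuous F ->
  (forall z, diff2 f x z = F z + F (- z)) -> (forall z, `|F z| <= C * enorm z `^ a) ->
  Rn_integrable Q (fun z => F z * frac_kernel sigma z) /\
  sing sigma f x = Rn_int Q (fun z => F z * frac_kernel sigma z).
Proof.
move=> cF dF FC.
have mF : mfunR (fun z => F z * frac_kernel sigma z).
  exact: measurable_funM (continuous_mfunR cF) (mfunR_frac_kernel sigma).
have iF : Rn_integrable Q (fun z => F z * frac_kernel sigma z).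
  apply: (le_Rn_integrable mF (g := fun z => C * (enorm z `^ a * frac_kernel sigma z))).
    by apply: Rn_integrableZ; apply: kernel_moment; rewrite ?sa.
  by move=> z _; rewrite normrM (ger0_norm (frac_kernel_ge0 _ _)) mulrA ler_wpM2r ?frac_kernel_ge0.
split=> //; rewrite /sing.
have -> : Rn_int Q (fun z => diff2 f x z * frac_kernel sigma z) =
    2 * Rn_int Q (fun z => F z * frac_kernel sigma z).
  have [_ <-] := Rn_int_sym mF iF.
  by apply: eq_Rn_int => z _; rewrite dF mulrDl frac_kernelN.
by rewrite mulKf// pnatr_eq0.
Qed.

Variables (C : R) (fC : forall x z, `|diff2 f x z| <= C * enorm z `^ a).

Let C0 : 0 <= C * (enorm (0 : 'rV[R]_n) `^ a).
Proof. by apply: le_trans (fC 0 0). Qed.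

Let D (delta : R) : set 'rV[R]_n := Q `&` [set z | delta <= enorm z].
Let G x z := (f x - f (x - z)) * frac_kernel sigma z.
(** With the truncation moved into the integrand, all integrals are over [Q], where invariance under
    reflection is available. *)
Let Gd (delta : R) x z := if delta <= enorm z then G x z else 0.

Let mG x : mfunR (G x).
Proof.
apply: measurable_funM (mfunR_frac_kernel sigma).
apply: (continuous_mfunR (f := fun z => f x - f (x - z))).
by apply: contB; [exact: contC|exact: continuous_subl].
Qed.

Let mGd delta x : mfunR (Gd delta x).
Proof.
apply: measurable_fun_ifT; [|exact: mG|exact: measurable_cst].
by apply: measurable_fun_ler => //; exact: (continuous_mfunR (@continuous_enorm R n)).
Qed.

(** On [|z| >= delta] the bounded difference is at most a constant times [|z|^2 / delta^2], and the
    kernel has a finite second moment because [sigma < 2]. *)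
Let iGd delta x : 0 < delta -> Rn_integrable Q (Gd delta x).
Proof.
move=> d0; have [B B0 HB] := periodic_bounded pf cf.
apply: (le_Rn_integrable (mGd delta x) (g := fun z => (2 * B / delta ^+ 2) * (enorm z `^ 2 * frac_kernel sigma z))).
  by apply: Rn_integrableZ; apply: kernel_moment s02 _; rewrite sigma2 lexx.
move=> z _; rewrite /Gd; case: ifPn => dz; last first.
  have c0 : 0 <= 2 * B / delta ^+ 2 by apply: divr_ge0; [exact: mulr_ge0|exact: sqr_ge0].
  have k0 : 0 <= enorm z `^ 2 * frac_kernel sigma z.
    by apply: mulr_ge0; [exact: powR_ge0|exact: frac_kernel_ge0].
  by rewrite normr0 mulr_ge0.
rewrite /G normrM (ger0_norm (frac_kernel_ge0 _ _)) mulrA.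
apply: ler_wpM2r; first exact: frac_kernel_ge0.
apply: (@le_trans _ _ (2 * B)).
  apply: le_trans (ler_normB _ _) _; have := HB x; have := HB (x - z); lra.
have B2 : 0 <= 2 * B by exact: mulr_ge0.
rewrite -mulrA; apply: ler_peMr B2 _.
rewrite mulrC powR_mulrn ?enorm_ge0// ler_pdivlMr ?exprn_gt0// mul1r.
by rewrite lerXn2r ?nnegrE ?enorm_ge0// ltW.
Qed.

Let mD delta : measurable (@row_of R n @^-1` [set z | delta <= enorm z]).
Proof.
rewrite -[X in measurable X]setTI.
rewrite (_ : @row_of R n @^-1` _ = (@enorm R n \o @row_of R n) @^-1` `[delta, +oo[%classic).
  exact: (continuous_mfunR (@continuous_enorm R n)).
by apply/seteqP; split => w /=; rewrite in_itv/= andbT.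
Qed.

Lemma truncated_integrable delta x : 0 < delta -> Rn_integrable (D delta) (G x).
Proof.
move=> d0.
have mDQ : measurable (@row_of R n @^-1` D delta).
  by rewrite preimage_setI; apply: measurableI; [exact: measurable_Qt|exact: mD].
have sub : @row_of R n @^-1` D delta `<=` @Qt R n by move=> w [].
have := @integrableS _ _ _ lam _ _ _ (@measurable_Qt R n) mDQ sub (iGd x d0).
apply: eq_integrable => // w /set_mem [_ /= dw].
by rewrite /Gd dw.
Qed.

Lemma truncated_int delta x : Rn_int (D delta) (G x) = Rn_int Q (Gd delta x).
Proof.
rewrite /Rn_int preimage_setI Rintegral_mkcondr; apply: eq_Rintegral => w _.
rewrite patchE /Gd; case: ifPn => [/set_mem /= ->//|].
by rewrite notin_setE /= => /negP/negbTE ->.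
Qed.

Lemma sing_principal_value x : Rn_int (D delta) (G x) @[delta --> 0^'+] --> sing sigma f x.
Proof.
under eq_fun do rewrite truncated_int.
(* An exponent strictly between [sigma] and [a]: on [|z| < delta], [|z|^a <= delta^(a - b) * |z|^b],
   and the kernel still has a finite moment of order [b]. This gives the rate [delta^(a - b)]. *)
pose b := (a + sigma) / 2; have sb : sigma < b <= 2.
  by rewrite /b; have := sa; have := a2; have := sigma2 => h1 h2 h3; apply/andP; split; lra.
have Cp : 0 <= `|C| by [].
pose I := Rn_int Q (fun z : 'rV[R]_n => enorm z `^ b * frac_kernel sigma z).
have iI := @kernel_moment R n sigma b s02 sb.
have id2 := @diff2_kernel_integrable R n sigma a sigma0 sigma2 sa a2 f cf C fC x.
have bound delta : 0 < delta -> `|sing sigma f x - Rn_int Q (Gd delta x)| <= (`|C| * I) * delta `^ (a - b).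
  move=> d0.
  have [i2 e2] := Rn_int_sym (mGd delta x) (iGd x d0).
  pose H z := if delta <= enorm z then diff2 f x z * frac_kernel sigma z else 0.
  have HE : (fun z => Gd delta x z + Gd delta x (- z)) = H.
    apply/funext => z; rewrite /Gd /H (enormN z).
    case: (delta <= enorm z); last by rewrite addr0.
    by rewrite /G (frac_kernelN sigma z) opprK -mulrDl; congr (_ * _); rewrite /diff2; ring.
  rewrite HE in i2 e2.
  have E : Rn_int Q (Gd delta x) = 2^-1 * Rn_int Q H by rewrite e2 mulKf// pnatr_eq0.
  rewrite E /sing -mulrBr -Rn_intB// normrM.
  rewrite -[leRHS]mul1r; apply: ler_pM => //; first by rewrite ger0_norm ?invf_le1 ?ler1n// invr_ge0.
  rewrite mulrAC -Rn_intZ//; apply: norm_Rn_int_le; [exact: Rn_integrableB|exact: Rn_integrableZ|].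
  move=> z _; rewrite /H; case: ifPn => [_|]; first rewrite subrr normr0.
    by apply: mulr_ge0; apply: mulr_ge0; rewrite ?powR_ge0 ?frac_kernel_ge0.
  rewrite -ltNge subr0 normrM (ger0_norm (frac_kernel_ge0 _ _)) mulrA => zd.
  apply: ler_wpM2r; first exact: frac_kernel_ge0.
  apply: le_trans (fC x z) _.
  apply: (@le_trans _ _ (`|C| * enorm z `^ a)); first by rewrite ler_wpM2r ?powR_ge0// ler_norm.
  rewrite -mulrA; apply: (ler_wpM2l Cp).
  have [z0|z0] := eqVneq (enorm z) 0.
    rewrite z0 !powR0 ?mulr0// gt_eqF//.
      by have /andP[? _] := sb; rewrite (lt_trans sigma0).
    exact: lt_trans sa.
  have zp : 0 < enorm z by rewrite lt_neqAle eq_sym z0 enorm_ge0.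
  have -> : enorm z `^ a = enorm z `^ (a - b) * enorm z `^ b by rewrite -powRD_gt0// subrK.
  apply: ler_wpM2r; first exact: powR_ge0.
  by apply: ge0_ler_powR; rewrite ?nnegrE ?subr_ge0 ?enorm_ge0 ?(ltW zd) ?(ltW d0)//; have := sa => h; rewrite /b; lra.
have ab : 0 < a - b by have := sa => h; rewrite /b; lra.
apply/cvgrPdist_le => e e0; near=> delta.
have d0 : 0 < delta by near: delta; exact: nbhs_right_gt.
apply: le_trans (bound _ d0) _.
near: delta.
have : ((`|C| * I) * delta `^ (a - b)) @[delta --> 0^'+] --> (0 : R).
  by rewrite -[X in _ --> X](mulr0 (`|C| * I)); apply: cvgMr; exact: powR_cvg0.
move=> /cvgrPdist_le /(_ e e0); apply: filterS => delta.
rewrite sub0r normrN; apply: le_trans; exact: ler_norm.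
Unshelve. all: by end_near. Qed.

End one_sided.

(** * Euclidean consequences of Hoelder continuity in the geodesic distance *)

Section geodesic.
Context {R : realType} {n : nat}.
Implicit Types (x y z : 'rV[R]_n).

Lemma geodesic_ge0 x y : 0 <= geodesic x y.
Proof.
apply: lb_le_inf; first by exists (enorm (x - y - (2 * pi) *: ivec R 0)), 0.
by move=> _ [nu _ <-]; exact: enorm_ge0.
Qed.

Lemma geodesic_le x y : geodesic x y <= enorm (x - y).
Proof.
apply: ge_inf; first by exists 0 => _ [nu _ <-]; exact: enorm_ge0.
exists 0 => //; congr enorm; apply/rowP => i; rewrite !mxE mulr0 subr0//.
Qed.

Lemma holder_enorm alpha (f : 'rV[R]_n -> R) : 0 < alpha -> holder alpha f ->
  exists2 C : R, 0 <= C & forall x y, `|f x - f y| <= C * enorm (x - y) `^ alpha.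
Proof.
move=> a0 [C HC]; exists `|C| => // x y; apply: le_trans (HC x y) _.
apply: (@le_trans _ _ (`|C| * geodesic x y `^ alpha)); first by rewrite ler_wpM2r ?powR_ge0// ler_norm.
by rewrite ler_wpM2l//; apply: ge0_ler_powR; rewrite ?nnegrE ?geodesic_ge0 ?enorm_ge0 ?geodesic_le ?ltW.
Qed.

(** Along the staircase of [telescope_coords] the remainder is a sum of coordinates of [z] times
    differences of partial derivatives at points within [|z|] of each other. *)
Lemma first_order_bound alpha (f : 'rV[R]_n -> R) : 0 < alpha ->
  (forall i x, derivable f x (Defs.basis R i)) ->
  (forall i, holder alpha (fun x => 'D_(Defs.basis R i) f x)) ->
  exists2 C : R, 0 <= C &
    forall x z, `|f x - f (x - z) - dot (grad f x) z| <= C * enorm z `^ (1 + alpha).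
Proof.
move=> a0 df hf.
have /choice[C HC] (i : 'I_n) : exists C : R, 0 <= C /\
    forall x y, `|'D_(Defs.basis R i) f x - 'D_(Defs.basis R i) f y| <= C * enorm (x - y) `^ alpha.
  by have [C C0 HC] := holder_enorm a0 (hf i); exists C.
exists (\sum_i C i); first by apply: sumr_ge0 => i _; have [] := HC i.
move=> x z; have [xi [xiz ->]] := telescope_coords x z df.
rewrite /dot -sumrB mulr_suml; apply: le_trans (ler_norm_sum _ _ _) _; apply: ler_sum => i _.
rewrite mxE mulrC -mulrBl normrM distrC.
have -> : enorm z `^ (1 + alpha) = enorm z `^ alpha * enorm z.
  rewrite mulrC -[1 + alpha]addrC.
  have := @mulr_powRB1 R (enorm z) (alpha + 1) (enorm_ge0 z); rewrite addrK => -> //.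
  by rewrite addr_gt0.
rewrite mulrA; apply: ler_pM => //; last exact: coord_le_enorm.
have [C0 {}HC] := HC i; apply: le_trans (HC _ _) _; rewrite ler_wpM2l//.
by apply: ge0_ler_powR; rewrite ?nnegrE ?enorm_ge0 ?xiz// ltW.
Qed.

End geodesic.

Theorem theorem1p5 (R : realType) (n : nat) (hn : (0 < n)%N)
    (sigma : R) (hsigma0 : 0 < sigma) (hsigma2 : sigma < 2) :
  (forall x : 'rV[R]_n, Q x -> x != 0 ->
    [/\ (@lebesgue_measure R).-integrable `]0, +oo[
          (EFin \o frac_integrand sigma x),
        0 < frac_kernel sigma x &
        (frac_kernel sigma x)%:E =
        ((2 `^ sigma * Gamma ((n%:R + sigma) / 2)
          / (`|Gamma (- (sigma / 2))| * pi `^ (n%:R / 2)))%:E *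
         \esum_(nu in [set: 'rV[int]_n])
           (1 / enorm (x - (2 * pi) *: ivec R nu) `^ (n%:R + sigma))%:E)%E])
  /\
  (sigma < 1 ->
   forall (f : 'rV[R]_n -> R) (eps : R),
     0 < eps -> 0 < sigma + eps <= 1 -> Ckalpha_torus 0 (sigma + eps) f ->
     exists g : 'rV[R]_n -> R,
       frac_lap_is_continuous_fun sigma f g /\
       forall x : 'rV[R]_n,
         let F := fun z => (f x - f (x - z)) * frac_kernel sigma z in
         Rn_integrable Q F /\ g x = Rn_int Q F)
  /\
  (1 <= sigma ->
   forall (f : 'rV[R]_n -> R) (eps : R),
     0 < eps -> 0 < sigma + eps - 1 <= 1 ->
     Ckalpha_torus 1 (sigma + eps - 1) f ->
     exists g : 'rV[R]_n -> R,
       frac_lap_is_continuous_fun sigma f g /\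
       forall x : 'rV[R]_n,
         let F := fun z =>
           (f x - f (x - z) - dot (grad f x) z) * frac_kernel sigma z in
         let G := fun z => (f x - f (x - z)) * frac_kernel sigma z in
         let D := fun delta : R => Q `&` [set z | delta <= enorm z] in
         [/\ Rn_integrable Q F,
             g x = Rn_int Q F,
             forall delta, 0 < delta -> Rn_integrable (D delta) G &
             Rn_int (D delta) G @[delta --> 0^'+] --> g x]).
Proof.
have s02 : 0 < sigma < 2 by rewrite hsigma0.
(* Both parts of the theorem supply a function [F x z] of order [|z|^a] whose symmetrization is the
   second difference; this gives the bound that [main] asks for. *)
have sum_le (f : 'rV[R]_n -> R) (F : 'rV[R]_n -> 'rV[R]_n -> R) (C a : R) :
    (forall x z, diff2 f x z = F x z + F x (- z)) ->
    (forall x z, `|F x z| <= C * enorm z `^ a) ->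
    forall x z, `|diff2 f x z| <= (C + C) * enorm z `^ a.
  move=> dF FC x z; rewrite dF mulrDl; apply: le_trans (ler_normD _ _) _.
  by rewrite lerD// -[enorm z]enormN.
have main (f : 'rV[R]_n -> R) (C a : R) : Defs.periodic f -> continuous f -> sigma < a -> a <= 2 ->
    (forall x z, `|diff2 f x z| <= C * enorm z `^ a) ->
    frac_lap_is_continuous_fun sigma f (sing sigma f).
  move=> pf cf sa a2 fC; apply: frac_lap_of_multiplier => //.
  - exact: sing_periodic.
  - exact: (sing_continuous hsigma0 hsigma2 sa a2 cf fC).
  - by move=> nu x; apply: (fcomp_sing hsigma0 hsigma2 sa a2 pf cf fC).
split; last split.
- move=> x Qx x0; split.
  + exact: frac_integrand_integrable.
  + exact: frac_kernel_gt0.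
  + exact: frac_kernel_esum.
- move=> s1 f eps e0 /andP[se0 se1] [pf [_ cf0] hf].
  have cf : continuous f := cf0 [::] isT.
  have [C C0 HC] := holder_enorm se0 (hf [::] erefl).
  have sa : sigma < sigma + eps by rewrite ltrDl.
  have a2 : sigma + eps <= 2 by apply: le_trans se1 _; rewrite ler1n.
  pose F x z := f x - f (x - z).
  have dF x z : diff2 f x z = F x z + F x (- z) by rewrite /F /diff2 opprK; ring.
  have FC x z : `|F x z| <= C * enorm z `^ (sigma + eps).
    by apply: le_trans (HC _ _) _; rewrite subKr.
  exists (sing sigma f); split; first exact: main pf cf sa a2 (sum_le _ _ _ _ dF FC).
  move=> x; apply: (sing_one_sided hsigma0 hsigma2 sa a2 _ (dF x) (FC x)).
  by apply: contB; [exact: contC|exact: continuous_subl].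
- move=> s1 f eps e0 /andP[se0 se1] [pf [df cf0] hf].
  have cf : continuous f := cf0 [::] isT.
  have [C C0 HC] := first_order_bound se0 (df [::] isT) (fun i => hf [:: i] erefl).
  (* The derivative contributes the missing order, so the exponent is again [sigma + eps], now at
     most 2. *)
  have aE : 1 + (sigma + eps - 1) = sigma + eps by ring.
  rewrite aE in HC.
  have sa : sigma < sigma + eps by rewrite ltrDl.
  have a2 : sigma + eps <= 2 by rewrite -lerBlDr (le_trans se1)//; lra.
  pose F x z := f x - f (x - z) - dot (grad f x) z.
  have dF x z : diff2 f x z = F x z + F x (- z) by rewrite /F /diff2 dotNr !opprK; ring.
  have fC := sum_le _ _ _ _ dF HC.
  exists (sing sigma f); split; first exact: main pf cf sa a2 fC.
  move=> x /=.
  have cF : continuous (F x).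
    by apply: contB; [apply: contB; [exact: contC|exact: continuous_subl]|exact: continuous_dot].
  have [iF EF] := sing_one_sided hsigma0 hsigma2 sa a2 cF (dF x) (HC x).
  split => //.
  + move=> delta d0; exact: truncated_integrable.
  + exact: (sing_principal_value hsigma0 hsigma2 sa a2 pf cf fC).
Qed.
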